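(* Let $\widetilde\Omega\subset\mathbb{C}$ be a bounded simply-connected domain with $0\in\widetilde\Omega$, and let $v\in W^{1,\infty}(\widetilde\Omega;\mathbb{C})$ satisfy $v(0)=0$ and the non-linear Beltrami system $$\frac{\partial v}{\partial\bar z}(z)=\frac43\left(\frac{\partial v}{\partial z}(z)\right)^3,\qquad \left|\frac{\partial v}{\partial z}(z)\right|=\frac12\qquad\text{for a.e. }z\in\widetilde\Omega .$$ Then $$Dv\in W^{\sigma,4}_{loc}(\widetilde\Omega)\quad\text{for all }\sigma\in\left(0,\tfrac13\right).$$ In addition, given $\widetilde\Omega'\subset\subset\widetilde\Omega$, there is a constant $C$ such that for all $\epsilon\in\left(0,\tfrac12\mathrm{dist}(\widetilde\Omega',\partial\widetilde\Omega)\right)$, $$\int_{\widetilde\Omega'}\int_{B_\epsilon(0)}\frac{|Dv(z+y)-Dv(z)|^4}{\epsilon^{2+\frac43}}\,dy\,dz<C,$$ where $C$ is independent of $\epsilon$.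
   Context: For $z=x_1+ix_2$, $\frac{\partial}{\partial\bar z}=\frac12\left(\frac{\partial}{\partial x_1}+i\frac{\partial}{\partial x_2}\right)$ and $\frac{\partial}{\partial z}=\frac12\left(\frac{\partial}{\partial x_1}-i\frac{\partial}{\partial x_2}\right)$. $Dv$ is the (real $2\times2$) gradient matrix of $v$ viewed as a map into $\mathbb{R}^2$. $W^{\sigma,4}$ is the fractional Sobolev (Gagliardo–Slobodeckij) space: $g\in W^{\sigma,4}(U)$ iff $g\in L^4(U)$ and $\int_U\int_U\frac{|g(x)-g(y)|^4}{|x-y|^{2+4\sigma}}\,dx\,dy<\infty$; $W^{\sigma,4}_{loc}(\widetilde\Omega)$ means membership in $W^{\sigma,4}(U)$ for all $U\subset\subset\widetilde\Omega$. *)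

(* Defs.v *)
From HB Require Import structures.
From mathcomp Require Import all_boot all_order all_algebra.
From mathcomp Require Import all_classical all_reals all_analysis.
From mathcomp Require Import complex.

Set Implicit Arguments.
Unset Strict Implicit.
Unset Printing Implicit Defensive.

Import Order.TTheory GRing.Theory Num.Theory.
Import numFieldNormedType.Exports.

Local Open Scope classical_set_scope.
Local Open Scope ring_scope.

(* The complex plane plays two roles: as a domain it is R * R,
   with (x1, x2) standing for z = x1 + i x2, because that is where the product
   topology and the product Borel sigma-algebra live; as a codomain it is R[i].
   Functions are representatives of their a.e. classes. *)

Notation plane R := (measurableTypeR R * measurableTypeR R)%type.

Definition area (R : realType) := (@lebesgue_measure R \x @lebesgue_measure R)%E.

Arguments area R : clear implicits.

Section plane_geometry.
Context {R : realType}.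
Implicit Types (A B U Omega : set (plane R)) (x y : plane R).

(* The library norm on a product is the sup norm. *)
Definition enorm x : R := Num.sqrt (x.1 ^+ 2 + x.2 ^+ 2).

Definition edisk (r : R) : set (plane R) := [set y | enorm y < r].

(* Extended-real, so that the distance to the empty set is +oo. *)
Definition edist_set A B : \bar R :=
  ereal_inf [set (enorm (a - b))%:E | a in A & b in B].

Definition boundary A : set (plane R) := closure A `\` interior A.

Definition compactly_inside U Omega := compact (closure U) /\ closure U `<=` Omega.

Definition path_connected A := forall x y, A x -> A y ->
  exists p : R -> plane R,
    [/\ {within `[0, 1], continuous p},
        (forall t, t \in `[0, 1] -> A (p t)), p 0 = x & p 1 = y].

(* H is a homotopy relative to the base point p 0. *)
Definition loops_contract A := forall p : R -> plane R,
  {within `[0, 1], continuous p} -> (forall t, t \in `[0, 1] -> A (p t)) ->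
  p 0 = p 1 ->
  exists H : R * R -> plane R,
    [/\ {within `[0, 1] `*` `[0, 1], continuous H},
        (forall s t, s \in `[0, 1] -> t \in `[0, 1] -> A (H (s, t))),
        (forall t, t \in `[0, 1] -> H (0, t) = p t /\ H (1, t) = p 0) &
        (forall s, s \in `[0, 1] -> H (s, 0) = p 0 /\ H (s, 1) = p 0)].

Definition simply_connected A := path_connected A /\ loops_contract A.

End plane_geometry.

Section sobolev.
Context {R : realType}.
Implicit Types (U Omega : set (plane R)) (f phi : plane R -> R).
Implicit Types (v : plane R -> R[i]) (G : plane R -> 'M[R]_2).

Definition basis_vec (j : 'I_2) : plane R := if j == 0 then (1, 0) else (0, 1).

Definition partial (j : 'I_2) f : plane R -> R := fun x => 'D_(basis_vec j) f x.

Fixpoint Ck (k : nat) f : Prop :=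
  if k is k'.+1 then
    continuous f /\
    forall j, (forall x, derivable f x (basis_vec j)) /\ Ck k' (partial j f)
  else continuous f.

Definition test_function Omega phi :=
  (forall k, Ck k phi) /\ compactly_inside [set x | phi x != 0] Omega.

(* Meant for f and g that are locally integrable on Omega. *)
Definition weak_partial Omega (j : 'I_2) f (g : plane R -> R) :=
  forall phi,
  test_function Omega phi ->
  \int[area R]_(x in Omega) (f x * partial j phi x) =
    - \int[area R]_(x in Omega) (g x * phi x).

(* L^p(U): the extension by 0 outside U belongs to L^p of the plane. *)
Definition Lp_on U (p : \bar R) f : Prop := f \_ U \in Lfun (area R) p.

Definition cpart (k : 'I_2) (w : R[i]) : R :=
  if k == 0 then complex.Re w else complex.Im w.

(* v is in W^{1,oo}(Omega; C) and G represents its gradient, a real matrix with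
   entries G z k j = d_j v_k (z). *)
Definition W1oo Omega v G :=
  [/\ forall k, Lp_on Omega +oo%E (fun z => cpart k (v z)),
      forall k j, Lp_on Omega +oo%E (fun z => G z k j) &
      forall k j, weak_partial Omega j (fun z => cpart k (v z)) (fun z => G z k j)].

(* The continuous representative of v takes the value c at z0. *)
Definition value_at Omega v (z0 : plane R) (c : R[i]) :=
  exists w : plane R -> R[i],
    [/\ forall k, {within Omega, continuous (fun z => cpart k (w z))},
        {ae area R, forall z, Omega z -> w z = v z} & w z0 = c].

Definition dcol (A : 'M[R]_2) (j : 'I_2) : R[i] := Complex (A 0 j) (A 1 j).

(* Wirtinger derivatives, read off the gradient matrix. *)
Definition d_z (A : 'M[R]_2) : R[i] :=
  2^-1 * (dcol A 0 - Complex 0 1 * dcol A 1).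

Definition d_zbar (A : 'M[R]_2) : R[i] :=
  2^-1 * (dcol A 0 + Complex 0 1 * dcol A 1).

Definition frob (A : 'M[R]_2) : R := Num.sqrt (\sum_i \sum_j A i j ^+ 2).

(* W^{s,4}(U). On the null set x = y the quotient is 0 / 0 = 0. *)
Definition Ws4 (s : R) U G :=
  (forall i j, Lp_on U 4%:E (fun z => G z i j)) /\
  (\int[area R]_(x in U) \int[area R]_(y in U)
     (frob (G x - G y) ^+ 4 / enorm (x - y) `^ (2 + 4 * s))%:E < +oo)%E.

Definition Ws4_loc (s : R) Omega G := forall U,
  measurable U -> compactly_inside U Omega -> Ws4 s U G.

End sobolev.

(* Main.v *)
Require Import Defs.
From HB Require Import structures.
From mathcomp Require Import all_boot all_order all_algebra.
From mathcomp Require Import all_classical all_reals all_analysis.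
From mathcomp Require Import complex.
From mathcomp Require Import measurable_realfun ess_sup_inf ring lra.
Set Implicit Arguments.
Unset Strict Implicit.
Unset Printing Implicit Defensive.
Import Order.TTheory GRing.Theory Num.Theory.
Import numFieldNormedType.Exports.
Local Open Scope classical_set_scope.
Local Open Scope ring_scope.

(** The two equations confine the gradient of [v], almost everywhere, to the curve of
    matrices with d_z = e^(it)/2 and d_zbar = e^(3it)/6. On this curve the determinant
    controls the distance: det (A - B) >= |A - B|^4 / 18 ([belt_det]). This is applied to
    the gradient Dw of the difference w(z) = v(z + y) - v(z), for a fixed small y.

    The determinant is a null Lagrangian. For a cut-off eta, integration by parts turns
    the integral of eta^4 det Dw into one of w times D(eta^4) times Dw, and w is
    at most of size |y| because v is Lipschitz. Since D(eta^4) is of size eta^3,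
      int eta^4 |Dw|^4 <= C |y| int eta^3 |Dw|,
    and Young's inequality with exponents 4 and 4/3 absorbs Dw into the left-hand side and
    leaves C |y|^(4/3) ([translation_estimate]). Finitely many boxes cover a compact part
    of the domain ([compact_estimate]).

    Integrating C |y|^(4/3) over the disk of radius eps gives a multiple of eps^(2 + 4/3),
    which is the second claim ([besov_estimate]). Integrating it against the weight
    |y|^(-2 - 4 sigma) converges near the origin exactly when sigma < 1/3; a sum over
    dyadic annuli makes this precise and yields the first claim ([sobolev_estimate]).

    The components of w being merely Sobolev functions, the integration by parts is done
    after mollifying the first one ([null_lagrangian_mollify]): the kernel is moved to the
    test function by Fubini, where the weak derivatives of the second component cancel.
    The mollified w keeps the Lipschitz bound ([mollify_lipschitz]), and the mollified
    gradient converges in L^1 on boxes ([mollify_small]) because translations are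
    continuous in L^1 ([l1_shift_small]).

    The gradient itself is replaced by a representative which lies on the curve at every
    point ([belt_grad]). Tonelli's theorem carries the double integrals over to it and
    puts the integral over y outside, where the estimate for fixed y applies
    ([integral_representative]). *)

(** * Bounded functions carried by sets of finite measure *)

Section tame.
Context d (T : measurableType d) (R : realType).
Variable mu : {measure set T -> \bar R}.
Implicit Types f g : T -> R.

Definition bddm f := measurable_fun setT f /\ exists M, forall x, `|f x| <= M.

(** Bounded functions carried by a set of finite measure. They are integrable, and stable
    under sums, translations and products with bounded functions, which disposes of
    the integrability conditions of all integrals below. *)
Definition tame f := measurable_fun setT f /\ exists M A,
  [/\ measurable A, (mu A < +oo)%E & forall x, `|f x| <= M * \1_A x].

Lemma tame_bddm f : tame f -> bddm f.
Proof.
case=> mf [M [A [mA Aoo fM]]]; split=> //; exists `|M| => x.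
apply: (le_trans (fM x)); rewrite indicE; case: (x \in A).
  by rewrite mulr1 ler_norm.
by rewrite mulr0.
Qed.

Lemma tame_integrable f : tame f -> mu.-integrable setT (EFin \o f).
Proof.
case=> mf [M [A [mA Aoo fM]]].
apply: (@le_integrable _ _ _ mu setT measurableT _ (fun x => (M * \1_A x)%:E)) => //.
- exact/measurable_EFinP.
- move=> x _ /=; rewrite lee_fin; apply: le_trans (fM x) _; exact: ler_norm.
under eq_fun do rewrite EFinM.
apply: integrableZl => //.
apply/integrableP; split; first exact/measurable_EFinP.
under eq_integral => x _ do rewrite /= ger0_norm//.
by rewrite integral_indic// setIT.
Qed.

Lemma tame_dom f g : measurable_fun setT f -> tame g ->
  (forall x, `|f x| <= `|g x|) -> tame f.
Proof.
move=> mf [mg [M [A [mA Aoo gM]]]] fg; split=> //; exists M, A; split=> // x.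
exact: le_trans (fg x) (gM x).
Qed.

Lemma bddmM f g : bddm f -> bddm g -> bddm (fun x => f x * g x).
Proof.
move=> [mf [M fM]] [mg [N gN]]; split; first exact: measurable_funM.
by exists (M * N) => x; rewrite normrM ler_pM.
Qed.

Lemma bddmD f g : bddm f -> bddm g -> bddm (fun x => f x + g x).
Proof.
move=> [mf [M fM]] [mg [N gN]]; split; first exact: measurable_funD.
by exists (M + N) => x; rewrite (le_trans (ler_normD _ _))// lerD.
Qed.

Lemma bddmN f : bddm f -> bddm (fun x => - f x).
Proof.
move=> [mf [M fM]]; split; last by exists M => x; rewrite normrN.
exact: measurableT_comp.
Qed.

Lemma bddmB f g : bddm f -> bddm g -> bddm (fun x => f x - g x).
Proof. by move=> bf bg; apply: bddmD => //; exact: bddmN. Qed.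

Lemma bddm_cst (c : R) : bddm (fun=> c).
Proof. by split; [exact: measurable_cst|exists `|c|]. Qed.

Lemma bddm_norm f : bddm f -> bddm (fun x => `|f x|).
Proof.
move=> [mf [M fM]]; split; last by exists M => x; rewrite normr_id.
exact: measurableT_comp.
Qed.

Lemma bddmX f n : bddm f -> bddm (fun x => f x ^+ n).
Proof.
move=> bf; elim: n => [|n IH]; first exact: (bddm_cst 1).
by under [X in bddm X]eq_fun do rewrite exprS; exact: bddmM.
Qed.

Lemma tameMl f g : tame f -> bddm g -> tame (fun x => f x * g x).
Proof.
move=> [mf [M [A [mA Aoo fM]]]] [mg [N gN]]; split; first exact: measurable_funM.
exists (M * N), A; split => // x; rewrite normrM mulrAC.
by rewrite ler_pM.
Qed.

Lemma tameMr f g : bddm f -> tame g -> tame (fun x => f x * g x).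
Proof.
by move=> bf tg; under [X in tame X]eq_fun do rewrite mulrC; exact: tameMl.
Qed.

Lemma tameN f : tame f -> tame (fun x => - f x).
Proof.
move=> [mf tf]; split; first exact: measurableT_comp.
case: tf => M [A [mA Aoo fM]]; exists M, A; split => // x.
by rewrite normrN.
Qed.

Lemma tameD f g : tame f -> tame g -> tame (fun x => f x + g x).
Proof.
move=> [mf [M [A [mA Aoo fM]]]] [mg [N [B [mB Boo gN]]]].
split; first exact: measurable_funD.
exists (`|M| + `|N|), (A `|` B); split => //; first exact: measurableU.
  rewrite (le_lt_trans (measureU2 _ _ _))//; exact: lte_add_pinfty.
move=> x; rewrite (le_trans (ler_normD _ _))// mulrDl lerD//.
  apply: le_trans (fM x) _; rewrite !indicE in_setU.
  case: (x \in A) => /=; first by rewrite !mulr1 ler_norm.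
  by rewrite mulr0 mulr_ge0.
apply: le_trans (gN x) _; rewrite !indicE in_setU orbC.
case: (x \in B) => /=; first by rewrite !mulr1 ler_norm.
by rewrite mulr0 mulr_ge0.
Qed.

Lemma tameB f g : tame f -> tame g -> tame (fun x => f x - g x).
Proof. by move=> tf tg; apply: tameD => //; exact: tameN. Qed.

Lemma tame_norm f : tame f -> tame (fun x => `|f x|).
Proof.
move=> tf; apply: (tame_dom _ tf) => [|x]; last by rewrite normr_id.
by apply: measurableT_comp => //; case: tf.
Qed.

Lemma tame_indic A : measurable A -> (mu A < +oo)%E -> tame (\1_A : T -> R).
Proof.
move=> mA Aoo; split=> //; exists 1, A; split=> // x.
by rewrite mul1r ger0_norm.
Qed.

End tame.

Section Rint.
Context d (T : measurableType d) (R : realType).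
Variable mu : {measure set T -> \bar R}.
Implicit Types f g : T -> R.
Local Notation int f := (Rintegral mu setT f).

Lemma RintD f g : tame mu f -> tame mu g ->
  int (fun x => f x + g x) = int f + int g.
Proof. by move=> tf tg; apply: RintegralD => //; exact: tame_integrable. Qed.

Lemma RintB f g : tame mu f -> tame mu g ->
  int (fun x => f x - g x) = int f - int g.
Proof. by move=> tf tg; apply: RintegralB => //; exact: tame_integrable. Qed.

Lemma RintZ c f : tame mu f -> int (fun x => c * f x) = c * int f.
Proof. by move=> tf; apply: RintegralZl => //; exact: tame_integrable. Qed.

Lemma RintN f : tame mu f -> int (fun x => - f x) = - int f.
Proof.
move=> tf; rewrite -mulN1r -RintZ//; congr Rintegral.
by apply/funext => x; rewrite mulN1r.
Qed.

Lemma le_Rint f g : tame mu f -> tame mu g -> (forall x, f x <= g x) ->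
  int f <= int g.
Proof. by move=> tf tg fg; apply: le_Rintegral => //; exact: tame_integrable. Qed.

Lemma ge0_Rint f : (forall x, 0 <= f x) -> 0 <= int f.
Proof. by move=> f0; exact: Rintegral_ge0. Qed.

Lemma le_norm_Rint f : tame mu f -> `|int f| <= int (fun x => `|f x|).
Proof. by move=> tf; apply: le_normr_Rintegral => //; exact: tame_integrable. Qed.

Lemma eq_Rint f g : f =1 g -> int f = int g.
Proof. by move=> fg; congr Rintegral; exact/funext. Qed.

Lemma EFin_Rint f : tame mu f -> (int f)%:E = (\int[mu]_x (f x)%:E)%E.
Proof.
by move=> tf; rewrite /Rintegral fineK//; apply: integrable_fin_num => //; exact: tame_integrable.
Qed.

Lemma Rint_indic A : measurable A -> int (\1_A) = fine (mu A).
Proof. by move=> mA; rewrite /Rintegral integral_indic// setIT. Qed.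

End Rint.

Section tame2.
Context d1 d2 (T1 : measurableType d1) (T2 : measurableType d2) (R : realType).
Variable m1 : {sigma_finite_measure set T1 -> \bar R}.
Variable m2 : {sigma_finite_measure set T2 -> \bar R}.
Implicit Types f : T1 * T2 -> R.

(** The carrier is a rectangle, so that every section and every partial integral is again
    tame, which fails for a general set of finite product measure. *)
Definition tame2 f := measurable_fun setT f /\ exists M A B,
  [/\ measurable A, measurable B, (m1 A < +oo)%E, (m2 B < +oo)%E &
    forall x y, `|f (x, y)| <= M * \1_A x * \1_B y].

Lemma tame2_tame f : tame2 f -> tame (m1 \x m2)%E f.
Proof.
case=> mf [M [A [B [mA mB Aoo Boo fM]]]]; split=> //; exists M, (A `*` B).
split; first exact: measurableX.
  by rewrite /= product_measure1E// lte_mul_pinfty// ge0_fin_numE.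
move=> [x y]; apply: le_trans (fM x y) _.
by rewrite !indicE in_setX/= -mulrA -natrM mulnb.
Qed.

Lemma tame2_secl f x : tame2 f -> tame m2 (fun y => f (x, y)).
Proof.
case=> mf [M [A [B [mA mB Aoo Boo fM]]]]; split; first exact: measurableT_comp.
by exists (M * \1_A x), B; split.
Qed.

Lemma tame2_secr f y : tame2 f -> tame m1 (fun x => f (x, y)).
Proof.
case=> mf [M [A [B [mA mB Aoo Boo fM]]]]; split; first exact: measurableT_comp.
by exists (M * \1_B y), A; split=> // x; rewrite mulrAC.
Qed.

Lemma tame2_intl f : tame2 f -> tame m1 (fun x => Rintegral m2 setT (fun y => f (x, y))).
Proof.
move=> tf; have itf := tame_integrable (tame2_tame tf).
have [mf [M [A [B [mA mB Aoo Boo fM]]]]] := tf; split.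
  apply/measurable_EFinP; rewrite (_ : _ \o _ = fubini_F m2 (EFin \o f)).
    exact: measurable_fubini_F itf.
  by apply/funext => x /=; rewrite EFin_Rint//; exact: tame2_secl.
exists (`|M| * fine (m2 B)), A; split=> // x.
apply: le_trans (le_norm_Rint (tame2_secl x tf)) _.
rewrite -mulrA mulrC -mulrA mulrC -Rint_indic// -mulrA -RintZ; last exact: tame_indic.
rewrite -RintZ; last by apply: tameMr; [exact: bddm_cst|exact: tame_indic].
apply: le_Rint.
- by apply: tame_norm; exact: tame2_secl.
- do 2 (apply: tameMr; first exact: bddm_cst); exact: tame_indic.
move=> y; apply: le_trans (fM x y) _.
rewrite -mulrA [_ * (`|M| * _)]mulrCA ler_wpM2r ?mulr_ge0 ?ler_norm//.
Qed.

Lemma tame_Fubini f : tame2 f ->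
  Rintegral m1 setT (fun x => Rintegral m2 setT (fun y => f (x, y))) =
  Rintegral m2 setT (fun y => Rintegral m1 setT (fun x => f (x, y))).
Proof.
move=> tf; have itf := tame_integrable (tame2_tame tf).
rewrite {1 3}/Rintegral; congr fine.
transitivity (\int[m1]_x \int[m2]_y (f (x, y))%:E)%E.
  by apply: eq_integral => x _; rewrite EFin_Rint//; exact: tame2_secl.
rewrite (Fubini itf).
by apply: eq_integral => x _; rewrite EFin_Rint//; exact: tame2_secr.
Qed.

End tame2.

Section tame2_swap.
Context d1 d2 (T1 : measurableType d1) (T2 : measurableType d2) (R : realType).
Variable m1 : {sigma_finite_measure set T1 -> \bar R}.
Variable m2 : {sigma_finite_measure set T2 -> \bar R}.
Implicit Types f : T1 * T2 -> R.

Lemma tame2_swap f : tame2 m1 m2 f -> tame2 m2 m1 (fun z => f (z.2, z.1)).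
Proof.
case=> mf [M [A [B [mA mB Aoo Boo fM]]]]; split.
  apply: (measurableT_comp mf).
  by apply: measurable_fun_pair; [exact: measurable_snd|exact: measurable_fst].
by exists M, B, A; split => // x y; rewrite mulrAC.
Qed.

Lemma tame2_intr f : tame2 m1 m2 f ->
  tame m2 (fun y => Rintegral m1 setT (fun x => f (x, y))).
Proof. by move=> /tame2_swap /tame2_intl. Qed.

End tame2_swap.

(** * The plane measure and its translations *)

Section plane_measure.
Context (R : realType).

(** A copy of [area] that carries the structure of a sigma-finite measure. *)
Definition area2 : set (plane R) -> \bar R := area R.

HB.instance Definition _ := Measure.on area2.

Lemma area2X (A B : set (measurableTypeR R)) : measurable A -> measurable B ->
  area2 (A `*` B) = (lebesgue_measure A * lebesgue_measure B)%E.
Proof. by move=> mA mB; rewrite /area2 /area /= product_measure1E. Qed.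

Definition box (r : R) : set (plane R) := `[- r, r] `*` `[- r, r].

Lemma measurable_box r : measurable (box r).
Proof. by apply: measurableX; exact: measurable_itv. Qed.

Lemma area2_box r : 0 <= r -> area2 (box r) = ((r *+ 2) ^+ 2)%:E.
Proof.
move=> r0; rewrite area2X; [|exact: measurable_itv..].
rewrite !lebesgue_measure_itv /= lte_fin.
move: r0; rewrite le_eqVlt => /predU1P[<-|r0].
  by rewrite oppr0 ltxx mule0 mul0rn expr0n.
by rewrite ifT; [rewrite -EFinB -EFinM opprK -mulr2n expr2|lra].
Qed.

Lemma box_lty r : (area2 (box r) < +oo)%E.
Proof.
have [r0|r0] := leP 0 r; first by rewrite area2_box// ltry.
have -> : box r = set0; last by rewrite measure0.
rewrite -subset0 => x [/=]; rewrite in_itv/= => /andP[h1 h2] _.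
have : - r <= r by apply: le_trans h2.
lra.
Qed.

Lemma bigcup_box : \bigcup_n (box n%:R) = setT.
Proof.
rewrite -subTset => x _.
pose m := (Num.truncn (`|x.1| + `|x.2|)).+1.
have hm : `|x.1| + `|x.2| <= m%:R.
  by apply: ltW; apply: truncnS_gt.
exists m => //; split; rewrite /= in_itv/= -ler_norml.
  by apply: le_trans hm; rewrite lerDl.
by apply: le_trans hm; rewrite lerDr.
Qed.

Let area2_sigma_finite : sigma_finite setT area2.
Proof.
exists (fun n => box n%:R); first by rewrite bigcup_box.
by move=> n; split; [exact: measurable_box|exact: box_lty].
Qed.

HB.instance Definition _ := Measure_isSigmaFinite.Build _ _ _ area2
  area2_sigma_finite.

End plane_measure.
Arguments area2 R : clear implicits.

Section measure_preserving.
Context d (T : measurableType d) (R : realType).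
Variable mu : {measure set T -> \bar R}.
Variable phi : T -> T.
Hypothesis mphi : measurable_fun setT phi.
Hypothesis muphi : forall A, measurable A -> mu (phi @^-1` A) = mu A.

Let phi_mixin := isMeasurableFun.Build _ _ _ _ _ mphi.
Let phi_pack : {mfun T >-> T} := HB.pack phi phi_mixin.

Lemma ge0_integral_preserving (f : T -> \bar R) : measurable_fun setT f ->
  (forall x, (0 <= f x)%E) -> (\int[mu]_x f (phi x) = \int[mu]_x f x)%E.
Proof.
move=> mf f0.
rewrite -[LHS](@ge0_integral_pushforward _ _ _ _ _ phi mphi mu setT f)//.
by apply: eq_measure_integral => A mA _ /=; rewrite /pushforward muphi.
Qed.

Lemma tame_preserving (f : T -> R) : tame mu f -> tame mu (fun x => f (phi x)).
Proof.
case=> mf [M [A [mA Aoo fM]]]; split; first exact: measurableT_comp.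
exists M, (phi @^-1` A); split.
- by rewrite -[X in measurable X]setTI; exact: mphi.
- by rewrite muphi.
by move=> x; exact: fM (phi x).
Qed.

Lemma Rint_preserving (f : T -> R) : tame mu f ->
  Rintegral mu setT (fun x => f (phi x)) = Rintegral mu setT f.
Proof.
move=> tf; rewrite /Rintegral; congr fine.
have itf : mu.-integrable (phi @^-1` setT) ((EFin \o f) \o phi).
  by rewrite preimage_setT; apply: tame_integrable; exact: tame_preserving.
have mf : measurable_fun setT (EFin \o f) by apply/measurable_EFinP; case: tf.
have := @integral_pushforward _ _ _ _ _ phi mphi mu setT (EFin \o f) mf itf measurableT.
rewrite preimage_setT => <-.
by apply: eq_measure_integral => A mA _ /=; rewrite /pushforward muphi.
Qed.

End measure_preserving.

Section translation.
Context (R : realType).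
Local Notation leb := (@lebesgue_measure R).

Lemma measurable_shift1 (a : R) :
  measurable_fun setT ((fun x => x + a) : measurableTypeR R -> measurableTypeR R).
Proof. exact: measurable_funD. Qed.

(** Both sides are measures in [A] that agree on half-open intervals. *)
Lemma lebesgue_shift (a : R) (A : set (measurableTypeR R)) : measurable A ->
  leb ((fun x => x + a) @^-1` A) = leb A.
Proof.
pose phi : measurableTypeR R -> measurableTypeR R := fun x => x + a.
pose phi_mixin := isMeasurableFun.Build _ _ _ _ phi (measurable_shift1 a).
pose phi_pack : {mfun _ >-> _} := HB.pack phi phi_mixin.
move=> mA; apply/esym.
apply: (@lebesgue_measure_unique R (pushforward leb phi_pack)) => //= _ [[b c]] _ <-.
rewrite /pushforward /= (_ : _ @^-1` _ = `]b - a, c - a]%classic); last first.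
  by apply/seteqP; split => x /=; rewrite !in_itv/= /phi ltrBlDr lerBrDr.
rewrite !lebesgue_measure_itv/= !lte_fin ltrD2r.
by case: ifP => // _; rewrite -!EFinB; congr EFin; rewrite opprB addrA subrK.
Qed.

Lemma measurable_shift (y : plane R) : measurable_fun setT (fun x : plane R => x + y).
Proof.
apply/measurable_fun_pairP; split => /=.
  by apply: (measurableT_comp (measurable_shift1 y.1)); exact: measurable_fst.
by apply: (measurableT_comp (measurable_shift1 y.2)); exact: measurable_snd.
Qed.

Lemma area2_shift (y : plane R) (A : set (plane R)) : measurable A ->
  area2 R ((fun x => x + y) @^-1` A) = area2 R A.
Proof.
pose phi : plane R -> plane R := fun x => x + y.
pose phi_mixin := isMeasurableFun.Build _ _ _ _ phi (measurable_shift y).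
pose phi_pack : {mfun _ >-> _} := HB.pack phi phi_mixin.
move=> mA; apply/esym.
apply: (@product_measure_unique _ _ _ _ R leb leb (pushforward (area2 R) phi_pack)) => //= B C mB mC.
rewrite /pushforward /= (_ : _ @^-1` _ =
  ((fun x => x + y.1) @^-1` B) `*` ((fun x => x + y.2) @^-1` C)); last by [].
rewrite area2X ?lebesgue_shift//.
  by rewrite -[X in measurable X]setTI; exact: measurable_shift1.
by rewrite -[X in measurable X]setTI; exact: measurable_shift1.
Qed.

Lemma ge0_integral_shift (y : plane R) (f : plane R -> \bar R) :
  measurable_fun setT f -> (forall x, (0 <= f x)%E) ->
  (\int[area2 R]_x f (x + y)%R = \int[area2 R]_x f x)%E.
Proof.
apply: ge0_integral_preserving; [exact: measurable_shift|exact: area2_shift].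
Qed.

Lemma tame_shift (y : plane R) (f : plane R -> R) :
  tame (area2 R) f -> tame (area2 R) (fun x => f (x + y)).
Proof.
apply: tame_preserving; [exact: measurable_shift|exact: area2_shift].
Qed.

Lemma Rint_shift (y : plane R) (f : plane R -> R) : tame (area2 R) f ->
  Rintegral (area2 R) setT (fun x => f (x + y)) = Rintegral (area2 R) setT f.
Proof.
apply: Rint_preserving; [exact: measurable_shift|exact: area2_shift].
Qed.

End translation.

(** * Smooth functions of one variable *)

Section smooth.
Context (R : realType).
Implicit Types f g a b : R -> R.

(** The one-variable analogue of [Ck]; the derivative is existentially quantified, so that
    the closure properties follow by induction on [k]. *)
Fixpoint Ck1 (k : nat) f : Prop :=
  if k is k'.+1 then
    exists2 g : R -> R, (forall x : R, is_derive x 1 f (g x)) & Ck1 k' g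
  else continuous f.

Definition smooth f := forall k, Ck1 k f.

Lemma is_derive_continuous f g : (forall x : R, is_derive x 1 f (g x)) -> continuous f.
Proof.
move=> fg x; have [fx _] := fg x.
by apply: differentiable_continuous; apply/derivable1_diffP.
Qed.

Lemma Ck1W k f : Ck1 k.+1 f -> Ck1 k f.
Proof.
elim: k f => [|k IH] f [g fg gk] /=; first exact: is_derive_continuous fg.
by exists g => //; exact: IH.
Qed.

Lemma Ck1_cst k (c : R) : Ck1 k (fun=> c).
Proof.
elim: k c => [|k IH] c /=; first by move=> x; exact: cvg_cst.
by exists (fun=> 0) => // x; exact: is_derive_cst.
Qed.

Lemma Ck1D k f g : Ck1 k f -> Ck1 k g -> Ck1 k (fun x => f x + g x).
Proof.
elim: k f g => [|k IH] f g /=; first by move=> cf cg x; apply: cvgD; [exact: cf|exact: cg].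
move=> [f' ff' kf'] [g' gg' kg']; exists (fun x => f' x + g' x); last exact: IH.
by move=> x; exact: is_deriveD.
Qed.

Lemma Ck1M k f g : Ck1 k f -> Ck1 k g -> Ck1 k (fun x => f x * g x).
Proof.
elim: k f g => [|k IH] f g; first by move=> cf cg x; apply: cvgM; [exact: cf|exact: cg].
move=> kf kg; have [f' ff' kf'] := kf; have [g' gg' kg'] := kg.
exists (fun x => f x * g' x + g x * f' x).
  by move=> x; exact: is_deriveM.
by apply: Ck1D; apply: IH => //; exact: Ck1W.
Qed.

Lemma Ck1_affine k f (c e : R) : Ck1 k f -> Ck1 k (fun x => f (c * x + e)).
Proof.
elim: k f => [|k IH] f.
  move=> cf x; apply: (@continuous_comp _ _ _ (fun x => c * x + e) f); last exact: cf.
  by apply: cvgD; [apply: cvgM; [exact: cvg_cst|exact: cvg_id]|exact: cvg_cst].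
move=> [f' ff' kf']; exists (fun x => c * f' (c * x + e)).
  move=> x; have h : is_derive x 1 (fun x => c * x + e) c.
    have := is_deriveD (is_deriveZ c (is_derive_id x 1)) (is_derive_cst e x 1).
    by rewrite addr0 scaler1.
  have := @is_derive1_comp R f (fun x => c * x + e) x (f' (c * x + e)) c (ff' _) h.
  by rewrite mulrC; apply.
by apply: Ck1M; [exact: Ck1_cst|exact: IH].
Qed.

Lemma smoothM f g : smooth f -> smooth g -> smooth (fun x => f x * g x).
Proof. by move=> sf sg k; exact: Ck1M. Qed.

Lemma smooth_cst (c : R) : smooth (fun=> c).
Proof. by move=> k; exact: Ck1_cst. Qed.

Lemma smoothX f n : smooth f -> smooth (fun x => f x ^+ n).
Proof.
move=> sf; elim: n => [|n IH]; first exact: (smooth_cst 1).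
by under [X in smooth X]eq_fun do rewrite exprS; exact: smoothM.
Qed.

Lemma smooth_affine f (c e : R) : smooth f -> smooth (fun x => f (c * x + e)).
Proof. by move=> sf k; exact: Ck1_affine. Qed.

Lemma smooth_derive f (x : R) : smooth f -> is_derive x 1 f (f^`()%classic x).
Proof.
move=> /(_ 1%N) [g fg _]; have [fx _] := fg x.
by rewrite derive1E; exact: derivableP.
Qed.

Lemma is_derive_eta f g : (forall x : R, is_derive x 1 f (g x)) -> f^`()%classic = g.
Proof. by move=> fg; apply/funext => x; rewrite derive1E; apply: derive_val. Qed.

Lemma smooth_derive1 f : smooth f -> smooth f^`()%classic.
Proof. by move=> sf k; have [g fg gk] := sf k.+1; rewrite (is_derive_eta fg). Qed.

Lemma smooth_continuous f : smooth f -> continuous f.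
Proof. by move=> sf; exact: (sf 0%N). Qed.

(** [x^-n exp(-1/x)] on the right half-line; these functions are closed under
    differentiation up to linear combinations. *)
Definition flat (n : nat) (x : R) : R := if 0 < x then x^-1 ^+ n * expR (- x^-1) else 0.

(** From e^s >= s^(n+1) / (n+1)! at s = 1/x. The bound of [flat n.+1] is what gives
    [flat n] a zero derivative at the origin. *)
Lemma flat_le n (x : R) : `|flat n x| <= n.+1`!%:R * `|x|.
Proof.
rewrite /flat; case: ifPn => [x0|_]; last by rewrite normr0 mulr_ge0.
have xV0 : 0 < x^-1 by rewrite invr_gt0.
rewrite ger0_norm; last by rewrite mulr_ge0 ?expR_ge0// exprn_ge0// ltW.
rewrite expRN ler_pdivrMr ?expR_gt0// (gtr0_norm x0).
have h := expR_ge1Dxn n (ltW xV0).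
have {}h : x^-1 ^+ n.+1 / n.+1`!%:R <= expR x^-1 by apply: le_trans h; rewrite lerDr.
rewrite ler_pdivrMr ?ltr0n ?fact_gt0// in h.
rewrite exprS ler_pdivrMl// in h.
apply: le_trans h _; rewrite le_eqVlt; apply/orP; left; apply/eqP; ring.
Qed.

Lemma flat_derive n (x : R) : is_derive x 1 (flat n) (flat n.+2 x + (- n%:R) * flat n.+1 x).
Proof.
case: (ltgtP x 0) => [x0|x0|->].
- rewrite {2 3}/flat ltNge (ltW x0)/= mulr0 addr0.
  apply: (@near_eq_is_derive _ _ _ (cst 0)) => //.
  near=> y; rewrite /flat ifF//; apply/negbTE; rewrite -leNgt.
  by near: y; apply: lt_le_nbhsl.
- pose F : R -> R := fun y => y^-1 ^+ n * expR (- y^-1).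
  rewrite {2 3}/flat x0.
  apply: (@near_eq_is_derive _ _ _ F).
    near=> y; rewrite /flat ifT//.
    by near: y; exact: lt_nbhsr.
  have xn0 : x != 0 by rewrite gt_eqF.
  have dV : is_derive x 1 (fun y : R => y^-1) (- x ^- 2).
    have := @is_deriveV R id x 1 1 xn0 (is_derive_id x 1).
    by rewrite scaler1.
  have dX : is_derive x 1 (fun y : R => y^-1 ^+ n) ((n%:R * x^-1 ^+ n.-1) *: (- x ^- 2)).
    rewrite (_ : (fun _ => _) = (fun y => y^-1) ^+ n); last first.
      by apply/funext => y; rewrite exprfctE.
    have := @is_deriveX R R (fun y => y^-1) n x 1 _ dV; exact.
  have dE : is_derive x 1 (fun y : R => expR (- y^-1)) (expR (- x^-1) * x ^- 2).
    have := @is_derive1_comp R expR (fun y => - y^-1) x (expR (- x^-1)) (x ^- 2).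
    by apply; rewrite -[X in is_derive _ _ _ X](opprK (x ^- 2)); exact: (is_deriveN dV).
  apply: is_derive_eq (is_deriveM dX dE) _.
  rewrite /GRing.scale/= -[x ^- 2]exprVn !exprS.
  case: n {F dX} => [|n] /=; first by rewrite !mul0r; ring.
  by rewrite exprS; ring.
- rewrite /flat ltxx mulr0 addr0 -/(flat n).
  have c0 : flat n.+1 h @[h --> 0^'] --> (0 : R).
    have c1 : n.+2`!%:R * `|h| @[h --> (0:R)^'] --> (0 : R).
      rewrite -[X in _ --> X](mulr0 n.+2`!%:R) -[X in _ * X](normr0 R).
      apply: cvgM; first exact: cvg_cst.
      by apply: cvg_norm; apply: nbhs_dnbhs; exact: cvg_id.
    apply/norm_cvg0P; apply: (squeeze_cvgr _ (cvg_cst _) c1).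
    by near=> h; rewrite normr_ge0 flat_le.
  have E : (fun h => h^-1 *: ((flat n \o shift 0) (h *: 1) - flat n 0)) @ 0^' --> (0 : R).
    apply: cvg_trans c0; apply: near_eq_cvg; near=> h.
    rewrite /= addr0 scaler1 /flat ltxx subr0; case: ifPn => h0.
      by rewrite /GRing.scale/= exprS mulrA.
    by rewrite scaler0.
  apply: DeriveDef; first by apply/cvg_ex; exists 0.
  exact: cvg_lim E.
Unshelve. all: by end_near. Qed.

Lemma smooth_flat n : smooth (flat n).
Proof.
move=> k; elim: k n => [|k IH] n.
  exact: is_derive_continuous (flat_derive n).
exists (fun x => flat n.+2 x + (- n%:R) * flat n.+1 x); first exact: flat_derive.
by apply: Ck1D => //; apply: Ck1M => //; exact: Ck1_cst.
Qed.

End smooth.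

(** * Cut-offs and products of one-variable test functions *)

Section cutoff.
Context (R : realType).
Implicit Types a b : R -> R.

Definition test1 (r : R) a := smooth a /\ forall t, r < `|t| -> a t = 0.

Lemma test1_derive r a : test1 r a -> test1 r a^`()%classic.
Proof.
move=> [sa a0]; split; first exact: smooth_derive1.
move=> t rt; rewrite derive1E.
have : is_derive t 1 a 0.
  apply: (@near_eq_is_derive _ _ _ (cst 0)).
  have : open [set t : R | r < `|t|].
    rewrite (_ : [set _ | _] = Num.norm @^-1` [set t | r < t])//.
    apply: open_comp => [x _|]; [exact: norm_continuous|exact: open_gt].
  rewrite openE => /(_ t rt); apply: filterS => x /= rx.
  by rewrite a0.
by move=> d; rewrite derive_val.
Qed.

Lemma test1M r a b : test1 r a -> smooth b -> test1 r (fun t => a t * b t).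
Proof.
by move=> [sa a0] sb; split=> [|t /a0 ->]; [exact: smoothM|rewrite mul0r].
Qed.

Lemma test1W r s a : r <= s -> test1 r a -> test1 s a.
Proof. by move=> rs [sa a0]; split=> // t st; apply: a0; exact: le_lt_trans st. Qed.

Lemma test1_bounded r a : test1 r a -> exists M, forall t, `|a t| <= M.
Proof.
move=> [sa a0].
have [r0|r0] := ltP r 0.
  by exists 0 => t; rewrite a0 ?normr0// (lt_le_trans r0).
have cM : {within `[- r, r], continuous (fun t => `|a t|)}.
  apply: continuous_subspaceT => t; apply: continuous_comp.
    exact: smooth_continuous.
  exact: norm_continuous.
have [|c _ cP] := @EVT_max R (fun t => `|a t|) (- r) r _ cM; first lra.
exists `|a c| => t; have [tr|rt] := leP `|t| r.
  by apply: cP; rewrite in_itv/= -ler_norml.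
by rewrite a0// normr0.
Qed.

Lemma test1_shift r a u : test1 r a -> test1 (r + `|u|) (fun t => a (t - u)).
Proof.
move=> [sa a0]; split.
  have := @smooth_affine R a 1 (- u) sa.
  by under eq_fun do rewrite mul1r.
move=> t rt; apply: a0; have := ler_normD (t - u) u; rewrite subrK; lra.
Qed.

Lemma test1_flip r a u : test1 r a -> test1 (r + `|u|) (fun t => a (u - t)).
Proof.
move=> [sa a0]; split.
  have := @smooth_affine R a (- 1) u sa.
  by under eq_fun do rewrite mulN1r addrC.
move=> t rt; apply: a0; have := ler_normB u (u - t).
by rewrite opprB addrC subrK; lra.
Qed.

Lemma test1_scale r a (s : R) : 0 < s -> test1 r a -> test1 (r * s) (fun t => a (t / s)).
Proof.
move=> s0 [sa a0]; split.
  have := @smooth_affine R a (s^-1) 0 sa.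
  by under eq_fun do rewrite addr0 mulrC.
move=> t rt; apply: a0; rewrite normrM normfV (gtr0_norm s0).
by rewrite ltr_pdivlMr.
Qed.

Definition cutoff (t : R) : R := flat 0 (1 + t) * flat 0 (1 - t).

Lemma flat0_bound (t : R) : 0 <= flat 0 t <= 1.
Proof.
rewrite /flat; case: ifP => // t0; last by rewrite lexx ler01.
by rewrite expr0 mul1r expR_ge0 -(@expR0 R) ler_expR oppr_le0 invr_ge0 ltW.
Qed.

Lemma cutoff_bound t : 0 <= cutoff t <= 1.
Proof.
have /andP[a1 a2] := flat0_bound (1 + t); have /andP[b1 b2] := flat0_bound (1 - t).
by rewrite mulr_ge0//= mulr_ile1.
Qed.

Lemma cutoff_even t : cutoff (- t) = cutoff t.
Proof. by rewrite /cutoff opprK mulrC. Qed.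

Lemma cutoff_test1 : test1 1 cutoff.
Proof.
split.
  apply: smoothM.
    have := @smooth_affine R (flat 0) 1 1 (@smooth_flat R 0).
    by under eq_fun do rewrite mul1r addrC.
  have := @smooth_affine R (flat 0) (-1) 1 (@smooth_flat R 0).
  by under eq_fun do rewrite mulN1r addrC.
move=> t; rewrite ltr_normr => /orP[h|h]; rewrite /cutoff /flat.
  by rewrite [X in _ * X]ifF ?mulr0//; apply/negbTE; rewrite -leNgt; lra.
by rewrite ifF ?mul0r//; apply/negbTE; rewrite -leNgt; lra.
Qed.

Definition cutoff_min : R := expR (- 2) ^+ 2.

Lemma cutoff_min_gt0 : 0 < cutoff_min.
Proof. by rewrite exprn_gt0 ?expR_gt0. Qed.

(** Both factors are at least [flat 0 (1/2)], which is e^-2. *)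
Lemma cutoff_ge t : `|t| <= 2^-1 -> cutoff_min <= cutoff t.
Proof.
rewrite ler_norml => /andP[h1 h2].
have H (s : R) : 2^-1 <= s -> expR (- 2) <= flat 0 s.
  move=> hs; have s0 : 0 < s by lra.
  rewrite /flat s0 expr0 mul1r ler_expR lerN2.
  by rewrite -[leRHS]invrK lef_pV2// posrE; lra.
by rewrite /cutoff_min expr2 ler_pM ?expR_ge0// H//; lra.
Qed.

End cutoff.

Section tensor.
Context (R : realType).
Implicit Types a b : R -> R.

Definition tensor a b (x : plane R) : R := a x.1 * b x.2.

Lemma tensor_continuous a b : continuous a -> continuous b -> continuous (tensor a b).
Proof.
move=> ca cb x; apply: (@continuousM _ _ (fun x : plane R => a x.1) (fun x => b x.2)).
  by apply: continuous_comp; [exact: cvg_fst|exact: ca].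
by apply: continuous_comp; [exact: cvg_snd|exact: cb].
Qed.

Lemma measurable_tensor a b : continuous a -> continuous b ->
  measurable_fun setT (tensor a b).
Proof.
move=> ca cb; apply: measurable_funM.
  apply: (@measurableT_comp _ _ _ _ _ _ a _ fst); last exact: measurable_fst.
  exact: continuous_measurable_fun.
apply: (@measurableT_comp _ _ _ _ _ _ b _ snd); last exact: measurable_snd.
exact: continuous_measurable_fun.
Qed.

Lemma partial0_tensor a b : smooth a -> (forall x, derivable (tensor a b) x (basis_vec 0))
  /\ partial 0 (tensor a b) = tensor a^`()%classic b.
Proof.
move=> sa.
have H (x : plane R) :
    (fun h => h^-1 *: ((tensor a b \o shift x) (h *: basis_vec 0) - tensor a b x)) @ 0^'
      --> tensor a^`()%classic b x.
  have [da va] := smooth_derive x.1 sa.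
  have da' : (fun h => h^-1 *: ((a \o shift x.1) (h *: 1) - a x.1)) @ 0^' --> a^`()%classic x.1.
    by rewrite -va; exact: da.
  have cv : (fun h => (h^-1 *: ((a \o shift x.1) (h *: 1) - a x.1)) * b x.2) @ 0^' -->
      tensor a^`()%classic b x by apply: cvgM => //; exact: cvg_cst.
  apply: cvg_trans cv; apply: near_eq_cvg; near=> h.
  rewrite /tensor /basis_vec /= /GRing.scale/= mulr0 add0r mulr1.
  by rewrite -mulrBl mulrA.
split=> [x|]; first by apply/cvg_ex; eexists; exact: H.
by apply/funext => x; apply: cvg_lim (H x).
Unshelve. all: by end_near. Qed.

Lemma partial1_tensor a b : smooth b -> (forall x, derivable (tensor a b) x (basis_vec 1))
  /\ partial 1 (tensor a b) = tensor a b^`()%classic.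
Proof.
move=> sb.
have H (x : plane R) :
    (fun h => h^-1 *: ((tensor a b \o shift x) (h *: basis_vec 1) - tensor a b x)) @ 0^'
      --> tensor a b^`()%classic x.
  have [db vb] := smooth_derive x.2 sb.
  have db' : (fun h => h^-1 *: ((b \o shift x.2) (h *: 1) - b x.2)) @ 0^' --> b^`()%classic x.2.
    by rewrite -vb; exact: db.
  have cv : (fun h => a x.1 * (h^-1 *: ((b \o shift x.2) (h *: 1) - b x.2))) @ 0^' -->
      tensor a b^`()%classic x by apply: cvgM => //; exact: cvg_cst.
  apply: cvg_trans cv; apply: near_eq_cvg; near=> h.
  rewrite /tensor /basis_vec /= /GRing.scale/= mulr0 add0r mulr1.
  by rewrite -mulrBr mulrCA.
split=> [x|]; first by apply/cvg_ex; eexists; exact: H.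
by apply/funext => x; apply: cvg_lim (H x).
Unshelve. all: by end_near. Qed.

Lemma Ck_tensor k a b : smooth a -> smooth b -> Ck k (tensor a b).
Proof.
elim: k a b => [|k IH] a b sa sb; first by apply: tensor_continuous; exact: smooth_continuous.
split; first by apply: tensor_continuous; exact: smooth_continuous.
move=> j; case: (eqVneq j 0) => [->|j0].
  have [d ->] := @partial0_tensor a b sa; split=> //.
  by apply: IH => //; exact: smooth_derive1.
have -> : j = 1 by apply/val_inj; case: j j0 => -[|[|]].
have [d ->] := @partial1_tensor a b sb; split=> //.
by apply: IH => //; exact: smooth_derive1.
Qed.

Lemma tame_tensor r a b : test1 r a -> test1 r b -> tame (area2 R) (tensor a b).
Proof.
move=> ta tb; have [M aM] := test1_bounded ta; have [N bN] := test1_bounded tb.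
have [sa a0] := ta; have [sb b0] := tb.
split; first by apply: measurable_tensor; exact: smooth_continuous.
exists (M * N), (box r); split; [exact: measurable_box|exact: box_lty|] => x.
rewrite indicE; case: (asboolP (x \in box r)) => hx; last first.
  suff -> : tensor a b x = 0.
    by rewrite normr0 mulr_ge0// mulr_ge0// (le_trans (normr_ge0 _) (aM 0), le_trans (normr_ge0 _) (bN 0)).
  apply: contrapT => h; apply: hx; apply/mem_set.
  split; rewrite /= in_itv/= -ler_norml leNgt; apply/negP => /[dup] hh.
    by move=> /a0 e; apply: h; rewrite /tensor e mul0r.
  by move=> /b0 e; apply: h; rewrite /tensor e mulr0.
by rewrite hx mulr1 normrM ler_pM.
Qed.

(** Products of one-variable functions are the test functions against which the weak
    gradient is used; their support lies in a box that fits into [Omega]. *)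
Lemma test_function_tensor (Omega : set (plane R)) r (c : plane R) a b :
  test1 r a -> test1 r b -> (forall x, box r x -> Omega (x + c)) ->
  test_function Omega (tensor (fun t => a (t - c.1)) (fun t => b (t - c.2))).
Proof.
move=> ta tb rO.
have [sa a0] := test1_shift c.1 ta; have [sb b0] := test1_shift c.2 tb.
split; first by move=> k; exact: Ck_tensor.
set S := [set x | _].
pose B : set (plane R) := `[c.1 - r, c.1 + r]%classic `*` `[c.2 - r, c.2 + r]%classic.
have cB : compact B by apply: compact_setX; exact: segment_compact.
have clB : closed B.
  by apply: compact_closed => //; exact: norm_hausdorff.
have SB : closure S `<=` B.
  rewrite ((closure_id B).1 clB); apply: closure_subset => x; rewrite /S /= /tensor => /eqP h.
  have [[_ a0'] [_ b0']] := (ta, tb).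
  split; rewrite /= in_itv/= -ler_distlC leNgt; apply/negP; rewrite distrC => e.
    by apply: h; rewrite a0'// mul0r.
  by apply: h; rewrite b0'// mulr0.
split; first by apply: (subclosed_compact _ cB SB); exact: closed_closure.
move=> x /SB [/= h1 h2]; rewrite -(subrK c x); apply: rO.
move: h1 h2; rewrite !in_itv/= => h1 h2.
by split; rewrite /= in_itv/=; lra.
Qed.

End tensor.

(** * Continuity of translations in L^1 *)

Section dominated.
Context d (T : measurableType d) (R : realType).
Variable mu : {measure set T -> \bar R}.

Lemma Rint_dominated0 (f : nat -> T -> R) (M : R) (A : set T) :
  measurable A -> (mu A < +oo)%E ->
  (forall n, measurable_fun setT (f n)) ->
  (forall n x, `|f n x| <= M * \1_A x) ->
  (forall x, f ^~ x @ \oo --> (0 : R)) ->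
  (fun n => \int[mu]_x f n x) @ \oo --> (0 : R).
Proof.
move=> mA Aoo mf fM f0.
have tg : tame mu (fun x => M * \1_A x).
  split; first by apply: measurable_funM => //; exact: measurable_indic.
  exists `|M|, A; split => // x; rewrite normrM (@ger0_norm _ (\1_A x))//.
have := @dominated_cvg _ _ _ mu setT measurableT (fun n x => (f n x)%:E)
  (fun=> 0%E) (fun x => (M * \1_A x)%:E).
rewrite integral0 => H.
suff : (fun n => \int[mu]_x (f n x)%:E)%E @ \oo --> 0%:E by move/fine_cvg.
apply: H => //.
- by move=> n; apply/measurable_EFinP.
- by move=> x _; apply: cvg_EFin (f0 x); near=> n.
- exact: tame_integrable.
- by move=> n x _ /=; rewrite lee_fin.
Unshelve. all: by end_near. Qed.

End dominated.

Section translation_continuity.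
Context (R : realType).
Local Notation leb := (@lebesgue_measure R).
Local Notation mR := (measurableTypeR R).

Definition seg (r : R) : set R := `[- r, r]%classic.

Lemma measurable_seg r : measurable (seg r : set mR).
Proof. exact: measurable_itv. Qed.

Lemma seg_lty r : (leb (seg r) < +oo)%E.
Proof. by rewrite lebesgue_measure_itv /=; case: ifP => _; rewrite -?EFinB ltry. Qed.

Lemma segP r (x : R) : seg r x <-> (`|x| <= r)%R.
Proof. by rewrite /seg /= in_itv/= -ler_norml. Qed.

Lemma indic_segE r (x : R) : (\1_(seg r) x : R) = (`|x| <= r)%R%:R.
Proof.
rewrite indicE; congr (_%:R); congr nat_of_bool.
by apply/idP/idP => [/set_mem/segP|/segP/mem_set].
Qed.

(** A continuous [g] is close to [f] in L^1 on the larger segment of half-length [k + 1],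
    which contains the translates; for [g] itself dominated convergence applies. *)
Lemma translation_cvg1 (f : R -> R) (k : R) (s : nat -> R) : 0 <= k ->
  bddm (f : mR -> R) -> (forall n, `|s n| <= 1) -> s @ \oo --> (0 : R) ->
  (fun n => \int[leb]_x (\1_(seg k) x * `|f (x + s n) - f x|)) @ \oo --> (0 : R).
Proof.
move=> k0 bf s1 s0; have [mf [M fM]] := bf.
set T := (fun n => _).
have T0 n : 0 <= T n by apply: ge0_Rint => x; exact: mulr_ge0.
apply/cvgrPdist_le => e e0.
pose E := seg (k + 1).
have tE : tame leb (\1_E : mR -> R) by apply: tame_indic; [exact: measurable_seg|exact: seg_lty].
have itf : leb.-integrable E (EFin \o f).
  apply: measurable_bounded_integrable.
  - exact: measurable_seg.
  - exact: seg_lty.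
  - exact: measurable_funS mf.
  - exists M; split; first exact: num_real.
    by move=> y My x _ /=; apply: le_trans (fM x) (ltW My).
have [g_ [cg _ fg]] := approximation_continuous_integrable (measurable_seg (k + 1))
  (seg_lty (k + 1)) itf.
have e4 : 0 < e / 4 by rewrite divr_gt0.
have [N _ /(_ N (leqnn N)) gN] : \forall n \near \oo,
    (\int[leb]_(z in E) `|(f z - g_ n z)%:E| < (e / 4)%:E)%E.
  apply: (fg [set y | y < (e / 4)%:E]%E); apply: open_nbhs_nbhs; split => /=.
    exact: open_ereal_lt_ereal.
  by rewrite lte_fin.
move: (g_ N) (cg N) gN => g {}cg gN.
have [C gC] : exists C, forall x, E x -> `|g x| <= C.
  have cE : {within `[- (k + 1), k + 1], continuous (fun t => `|g t|)}.
    apply: continuous_subspaceT => t; apply: continuous_comp; first exact: cg.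
    exact: norm_continuous.
  have [|c _ cP] := EVT_max _ cE; first lra.
  by exists `|g c| => x Ex; exact: cP.
have mg : measurable_fun setT (g : mR -> R) by exact: continuous_measurable_fun.
have mfg : measurable_fun setT (fun x => `|f x - g x| : R).
  by apply: measurableT_comp => //; exact: measurable_funB.
have tfg : tame leb (fun x : R => \1_E x * `|f x - g x|).
  split; first by apply: measurable_funM => //; exact: measurable_indic (measurable_seg _).
  exists (M + C), E; split; [exact: measurable_seg|exact: seg_lty|] => x.
  rewrite indicE; have [/set_mem Ex|_] := boolP (x \in E); last by rewrite mul0r mulr0 normr0.
  by rewrite mul1r mulr1 normr_id (le_trans (ler_normB _ _))// lerD// gC.
have fgA : \int[leb]_x (\1_E x * `|f x - g x|) <= e / 4.
  rewrite -lee_fin EFin_Rint//; apply: le_trans (ltW gN).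
  rewrite [leRHS]integral_mkcond le_eqVlt; apply/orP; left; apply/eqP.
  apply: eq_integral => x _; rewrite patchE indicE.
  by case: ifPn => _; rewrite ?mul1r ?mul0r.
pose G n x : R := \1_(seg k) x * `|g (x + s n) - g x|.
have EE x n : `|x| <= k -> E x /\ E (x + s n).
  move=> xk; split; apply/segP; first lra.
  by rewrite (le_trans (ler_normD _ _))// lerD.
have mG n : measurable_fun setT (G n : mR -> R).
  apply: measurable_funM; first exact: measurable_indic (measurable_seg _).
  apply: measurableT_comp => //; apply: measurable_funB => //.
  by apply: (measurableT_comp mg); exact: measurable_shift1.
have GC n x : `|G n x| <= (C + C) * \1_(seg k) x.
  rewrite /G indic_segE; have [xk|_] := boolP (`|x| <= k); last by rewrite mul0r mulr0 normr0.
  have [E1 E2] := EE x n xk.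
  by rewrite mul1r mulr1 normr_id (le_trans (ler_normB _ _))// lerD// gC.
have tG n : tame leb (G n).
  split=> //; exists (C + C), (seg k); split => //; [exact: measurable_seg|exact: seg_lty].
have G0 : (fun n => \int[leb]_x (G n x)) @ \oo --> (0 : R).
  apply: (Rint_dominated0 (measurable_seg k) (seg_lty k) mG GC) => x.
  rewrite /G -[X in _ --> X](mulr0 (\1_(seg k) x)).
  apply: cvgM; first exact: cvg_cst.
  rewrite -[X in _ --> X](normr0 R) -[X in `|X|](subrr (g x)).
  apply: cvg_norm; apply: cvgB; last exact: cvg_cst.
  apply: (@cvg_comp _ _ _ (fun n => x + s n) g _ (nbhs x)); last exact: cg.
  have : (fun n => x + s n) @ \oo --> x + 0 by apply: cvgD => //; exact: cvg_cst.
  by rewrite addr0.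
move/cvgrPdist_le : G0 => /(_ _ e4).
apply: filterS => n; rewrite sub0r normrN => Gn.
rewrite sub0r normrN ger0_norm//.
pose F x := \1_E x * `|f x - g x|.
have tFs : tame leb (fun x : R => F (x + s n)).
  by apply: (tame_preserving (measurable_shift1 (s n)) (lebesgue_shift (s n))).
have tf : tame leb (fun x : R => \1_(seg k) x * `|f (x + s n) - f x|).
  apply: tameMl; first by apply: tame_indic; [exact: measurable_seg|exact: seg_lty].
  apply: bddm_norm; apply: bddmB => //.
  split; first by apply: (measurableT_comp mf); exact: measurable_shift1.
  by exists M.
apply: (@le_trans _ _ (\int[leb]_x (F (x + s n) + (G n x + F x)))).
  apply: le_Rint => //; first by apply: tameD => //; exact: tameD.
  move=> x; rewrite /F /G indic_segE.
  have [xk|_] := boolP (`|x| <= k); last first.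
    by rewrite !mul0r add0r addr_ge0// mulr_ge0.
  have [E1 E2] := EE x n xk.
  rewrite !indicE !mem_set// !mul1r.
  have -> : f (x + s n) - f x = (f (x + s n) - g (x + s n)) + ((g (x + s n) - g x) + (g x - f x)) by ring.
  by rewrite (le_trans (ler_normD _ _))// lerD2l (le_trans (ler_normD _ _))// lerD2l distrC.
rewrite RintD//; last exact: tameD.
rewrite RintD//.
have -> : \int[leb]_x F (x + s n) = \int[leb]_x F x.
  exact: (Rint_preserving (measurable_shift1 (s n)) (lebesgue_shift (s n))).
have FA : \int[leb]_x F x <= e / 4 by exact: fgA.
have := le_trans (ler_norm (\int[leb]_x G n x)) Gn.
move: (\int[leb]_x F x) (\int[leb]_x G n x) FA => A B; clear -e0; lra.
Qed.

End translation_continuity.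

Section translation_continuity2.
Context (R : realType).
Local Notation leb := (@lebesgue_measure R).
Implicit Types f h : plane R -> R.

Lemma indic_boxE r (x : plane R) :
  (\1_(box r) x : R) = \1_(seg r) x.1 * \1_(seg r) x.2.
Proof. by rewrite !indicE in_setX/= -natrM mulnb. Qed.

Lemma measurable_indic_box r : measurable_fun setT (\1_(box r) : plane R -> R).
Proof. exact: measurable_indic (measurable_box _). Qed.

Lemma tame_box r : tame (area2 R) (\1_(box r) : plane R -> R).
Proof. by apply: tame_indic; [exact: measurable_box|exact: box_lty]. Qed.

Lemma tame2_box f M k : measurable_fun setT f ->
  (forall x, `|f x| <= M * \1_(box k) x) -> tame2 leb leb f.
Proof.
move=> mf fM; split => //; exists M, (seg k), (seg k); split.
- exact: measurable_seg.
- exact: measurable_seg.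
- exact: seg_lty.
- exact: seg_lty.
by move=> x y; rewrite -mulrA -(indic_boxE k (x, y)).
Qed.

Lemma Rint_area2_12 f : tame2 leb leb f ->
  \int[area2 R]_x f x = \int[leb]_x (\int[leb]_y f (x, y)).
Proof.
move=> tf; have itf := tame_integrable (tame2_tame tf).
rewrite {1 2}/Rintegral; congr fine.
rewrite -[LHS](integral12_prod_meas1 itf).
by apply: eq_integral => x _; rewrite EFin_Rint//; exact: (tame2_secl x tf).
Qed.

Lemma Rint_area2_21 f : tame2 leb leb f ->
  \int[area2 R]_x f x = \int[leb]_y (\int[leb]_x f (x, y)).
Proof. by move=> tf; rewrite Rint_area2_12//; exact: tame_Fubini. Qed.

Section outer.
Variables (f : nat -> plane R -> R) (M k : R).
Hypothesis mf : forall n, measurable_fun setT (f n).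
Hypothesis fM : forall n x, `|f n x| <= M * \1_(box k) x.

Let tf n : tame2 leb leb (f n). Proof. exact: tame2_box (mf n) (fM n). Qed.
Let tseg : tame leb (\1_(seg k) : R -> R).
Proof. by apply: tame_indic; [exact: measurable_seg|exact: seg_lty]. Qed.

Lemma Rint_area2_cvg12 :
  (forall x, (fun n => \int[leb]_y f n (x, y)) @ \oo --> (0 : R)) ->
  (fun n => \int[area2 R]_x f n x) @ \oo --> (0 : R).
Proof.
move=> f0; under eq_fun do rewrite Rint_area2_12//.
apply: (@Rint_dominated0 _ _ _ leb _ (M * \int[leb]_y \1_(seg k) y) _
  (measurable_seg k) (seg_lty k) _ _ f0) => [n|n x].
  by have [] := tame2_intl (tf n).
apply: le_trans (le_norm_Rint (tame2_secl x (tf n))) _.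
rewrite mulrAC -RintZ//; apply: le_Rint => [||y].
- by apply: tame_norm; exact: (tame2_secl x (tf n)).
- by apply: tameMr => //; exact: bddm_cst.
- by have := fM n (x, y); rewrite indic_boxE mulrA.
Qed.

Lemma Rint_area2_cvg21 :
  (forall y, (fun n => \int[leb]_x f n (x, y)) @ \oo --> (0 : R)) ->
  (fun n => \int[area2 R]_x f n x) @ \oo --> (0 : R).
Proof.
move=> f0; under eq_fun do rewrite Rint_area2_21//.
apply: (@Rint_dominated0 _ _ _ leb _ (M * \int[leb]_y \1_(seg k) y) _
  (measurable_seg k) (seg_lty k) _ _ f0) => [n|n y].
  by have [] := tame2_intr (tf n).
apply: le_trans (le_norm_Rint (tame2_secr y (tf n))) _.
rewrite mulrAC -RintZ//; apply: le_Rint => [||x].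
- by apply: tame_norm; exact: (tame2_secr y (tf n)).
- by apply: tameMr => //; exact: bddm_cst.
- by have := fM n (x, y); rewrite indic_boxE/= [\1_(seg k) x * _]mulrC mulrA.
Qed.

End outer.

Lemma plane_addh (x : plane R) (s : R) : x + (s, 0) = (x.1 + s, x.2) :> plane R.
Proof. by apply/pair_equal_spec; split; rewrite //= addr0. Qed.

Lemma plane_addv (x : plane R) (s : R) : x + (0, s) = (x.1, x.2 + s) :> plane R.
Proof. by apply/pair_equal_spec; split; rewrite //= addr0. Qed.

Definition l1_shift k h (s : plane R) : R :=
  \int[area2 R]_x (\1_(box k) x * `|h (x + s) - h x|).

Lemma bddm_shift h (s : plane R) : bddm h -> bddm (fun x : plane R => h (x + s)).
Proof.
move=> [mh [M hM]]; split; last by exists M.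
by apply: (measurableT_comp mh); exact: measurable_shift.
Qed.

Lemma tame_l1_shift k h (s : plane R) : bddm h -> tame (area2 R) (fun x : plane R => \1_(box k) x * `|h (x + s) - h x|).
Proof.
move=> bh; apply: tameMl; first exact: tame_box.
by apply: bddm_norm; apply: bddmB => //; exact: bddm_shift.
Qed.

Lemma l1_shift_bound k h (s : plane R) M : (forall x, `|h x| <= M) -> forall x : plane R,
  `|\1_(box k) x * `|h (x + s) - h x| | <= (M + M) * \1_(box k) x.
Proof.
move=> hM x; rewrite normrM normr_id (@ger0_norm _ (\1_(box k) x))// mulrC.
by rewrite ler_wpM2r// (le_trans (ler_normB _ _))// lerD.
Qed.

Lemma l1_shift_cvg_horizontal k h (s : nat -> R) : 0 <= k -> bddm h ->
  (forall n, `|s n| <= 1) -> s @ \oo --> (0 : R) ->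
  (fun n => l1_shift k h (s n, 0)) @ \oo --> (0 : R).
Proof.
move=> k0 bh s1 s0; have [mh [M hM]] := bh.
apply: (@Rint_area2_cvg21 _ (M + M) k) => [n|n|y].
- by have [] := tame_l1_shift k (s n, 0) bh.
- exact: l1_shift_bound.
pose f x := h (x, y).
have bf : bddm (f : measurableTypeR R -> R).
  by split; [exact: measurableT_comp|exists M => x; exact: hM].
have := translation_cvg1 k0 bf s1 s0.
have tf n : tame leb (fun x : R => \1_(seg k) x * `|f (x + s n) - f x|).
  apply: tameMl; first by apply: tame_indic; [exact: measurable_seg|exact: seg_lty].
  apply: bddm_norm; apply: bddmB => //; case: bf => mf [N fN]; split; last by exists N.
  by apply: (measurableT_comp mf); exact: measurable_shift1.
move=> cv; rewrite (_ : (fun n => _) = (fun n =>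
    \1_(seg k) y * \int[leb]_x (\1_(seg k) x * `|f (x + s n) - f x|))); last first.
  apply/funext => n; rewrite -RintZ//; apply: eq_Rint => x.
  by rewrite plane_addh indic_boxE/= /f mulrCA mulrA.
rewrite -[X in _ --> X](mulr0 (\1_(seg k) y)).
by apply: cvgM => //; exact: cvg_cst.
Qed.

Lemma l1_shift_cvg_vertical k h (s : nat -> R) : 0 <= k -> bddm h ->
  (forall n, `|s n| <= 1) -> s @ \oo --> (0 : R) ->
  (fun n => l1_shift k h (0, s n)) @ \oo --> (0 : R).
Proof.
move=> k0 bh s1 s0; have [mh [M hM]] := bh.
apply: (@Rint_area2_cvg12 _ (M + M) k) => [n|n|x].
- by have [] := tame_l1_shift k (0, s n) bh.
- exact: l1_shift_bound.
pose f y := h (x, y).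
have bf : bddm (f : measurableTypeR R -> R).
  by split; [exact: measurableT_comp|exists M => y; exact: hM].
have := translation_cvg1 k0 bf s1 s0.
have tf n : tame leb (fun x : R => \1_(seg k) x * `|f (x + s n) - f x|).
  apply: tameMl; first by apply: tame_indic; [exact: measurable_seg|exact: seg_lty].
  apply: bddm_norm; apply: bddmB => //; case: bf => mf [N fN]; split; last by exists N.
  by apply: (measurableT_comp mf); exact: measurable_shift1.
move=> cv; rewrite (_ : (fun n => _) = (fun n =>
    \1_(seg k) x * \int[leb]_x (\1_(seg k) x * `|f (x + s n) - f x|))); last first.
  apply/funext => n; rewrite -RintZ//; apply: eq_Rint => y.
  by rewrite plane_addv indic_boxE/= /f mulrA.
rewrite -[X in _ --> X](mulr0 (\1_(seg k) x)).
by apply: cvgM => //; exact: cvg_cst.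
Qed.

Lemma l1_shift_ge0 k h s : 0 <= l1_shift k h s.
Proof. by apply: ge0_Rint => x; exact: mulr_ge0. Qed.

(** The translation is made in two steps, along the axes. The vertical step displaces
    the box on which the horizontal one is measured, whence [k + 1]. *)
Lemma l1_shift_triangle k h s : bddm h -> `|s.2| <= 1 ->
  l1_shift k h s <= l1_shift (k + 1) h (s.1, 0) + l1_shift k h (0, s.2).
Proof.
move=> bh s1.
have t1 := tame_shift (0, s.2) (tame_l1_shift (k + 1) (s.1, 0) bh).
have t2 := tame_l1_shift k (0, s.2) bh.
rewrite {2}/l1_shift -(Rint_shift (0, s.2)); last exact: tame_l1_shift.
rewrite -RintD//.
apply: le_Rint; [exact: tame_l1_shift|exact: tameD|].
move=> x; have -> : x + (0, s.2) + (s.1, 0) = x + s.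
  by rewrite plane_addv plane_addh.
have := ler_distD (h (x + (0, s.2))) (h (x + s)) (h x).
set A := `|_ - _|; set B := `|_ - _|; set C := `|_ - _| => ABC.
apply: (@le_trans _ _ (\1_(box k) x * (B + C))); first exact: ler_wpM2l.
rewrite mulrDr lerD2r; apply: ler_wpM2r; first exact: normr_ge0.
rewrite plane_addv !indic_boxE/= !indic_segE -!natrM !mulnb ler_nat.
have H : (`|x.1| <= k) && (`|x.2| <= k) ->
    (`|x.1| <= k + 1) && (`|x.2 + s.2| <= k + 1).
  move=> /andP[x1 x2]; rewrite (le_trans x1) ?lerDl//=.
  by rewrite (le_trans (ler_normD _ _))// lerD.
move: H; case: (_ && _) => [->//|_]; exact: leq0n.
Qed.

(** A counterexample for every [delta = 1/(n+1)] would give sequences of horizontal and of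
    vertical translations tending to 0 along which the two steps do not. *)
Lemma l1_shift_small k h (e : R) : 0 <= k -> bddm h -> 0 < e ->
  exists2 delta, 0 < delta <= 1 &
    forall s : plane R, `|s.1| <= delta -> `|s.2| <= delta -> l1_shift k h s <= e.
Proof.
move=> k0 bh e0; apply: contrapT => H.
have dn (n : nat) : 0 < (n.+1%:R^-1 : R) <= 1.
  by rewrite invr_gt0 ltr0n/= invf_le1// ler1n.
have {}H (n : nat) : exists s : plane R,
    [/\ `|s.1| <= n.+1%:R^-1, `|s.2| <= n.+1%:R^-1 & e < l1_shift k h s].
  apply: contrapT => H'; apply: H; exists n.+1%:R^-1 => // s s1 s2.
  by rewrite leNgt; apply/negP => h'; apply: H'; exists s.
have [s sP] := choice H.
have c0 (u : nat -> R) : (forall n, `|u n| <= n.+1%:R^-1) -> u @ \oo --> (0 : R).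
  move=> un; apply/norm_cvg0P.
  apply: (squeeze_cvgr _ (cvg_cst _) (@cvg_harmonic R)).
  by near=> n; rewrite normr_ge0 un.
have le1 (u : nat -> R) : (forall n, `|u n| <= n.+1%:R^-1) -> forall n, `|u n| <= 1.
  by move=> un n; apply: le_trans (un n) _; have /andP[] := dn n.
have s1 n : `|(s n).1| <= n.+1%:R^-1 by have [] := sP n.
have s2 n : `|(s n).2| <= n.+1%:R^-1 by have [] := sP n.
have k1 : 0 <= k + 1 by exact: addr_ge0.
have cv : (fun n => l1_shift (k + 1) h ((s n).1, 0) + l1_shift k h (0, (s n).2)) @ \oo --> (0 : R).
  rewrite -[X in _ --> X](addr0 0); apply: cvgD.
    exact: l1_shift_cvg_horizontal k1 bh (le1 _ s1) (c0 _ s1).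
  exact: l1_shift_cvg_vertical k0 bh (le1 _ s2) (c0 _ s2).
move/cvgrPdist_lt : cv => /(_ e e0).
move=> [N _ /(_ N (leqnn N))]; rewrite /= sub0r normrN ger0_norm ?addr_ge0 ?l1_shift_ge0// => lte.
have [_ _ elt] := sP N.
have := lt_trans (lt_le_trans elt (l1_shift_triangle k bh (le1 _ s2 N))) lte.
by rewrite ltxx.
Unshelve. all: by end_near. Qed.

End translation_continuity2.

(** * Mollification *)

Section mollifier.
Context (R : realType).
Local Notation leb := (@lebesgue_measure R).
Local Notation P := (plane R).
Implicit Types (h : plane R -> R) (a b : R -> R).

Lemma tame_test1 r a : test1 r a -> tame leb (a : measurableTypeR R -> R).
Proof.
move=> ta; have [M aM] := test1_bounded ta; have [sa a0] := ta; split.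
  by apply: continuous_measurable_fun; exact: smooth_continuous.
exists M, (seg r); split; [exact: measurable_seg|exact: seg_lty|] => x.
rewrite indic_segE; have [xr|xr] := leP `|x| r; first by rewrite mulr1.
by rewrite a0// normr0 mulr0.
Qed.

Definition cutoff_mass (delta : R) : R := \int[leb]_t cutoff (t / delta).

Lemma cutoff_scaled_test1 delta : 0 < delta -> test1 delta (fun t : R => cutoff (t / delta)).
Proof. by move=> d0; have := test1_scale d0 (cutoff_test1 R); rewrite mul1r. Qed.

Lemma cutoff_mass_gt0 delta : 0 < delta -> 0 < cutoff_mass delta.
Proof.
move=> d0; have ts : tame leb (\1_(seg (delta / 2)) : R -> R).
  by apply: tame_indic; [exact: measurable_seg|exact: seg_lty].
apply: (@lt_le_trans _ _ (cutoff_min R * \int[leb]_t \1_(seg (delta / 2)) t)).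
  apply: mulr_gt0; first exact: cutoff_min_gt0.
  rewrite Rint_indic; last exact: measurable_seg.
  rewrite [X in fine X](_ : _ = delta%:E).
    exact: d0.
  transitivity (leb (seg (delta / 2))) => //.
  rewrite lebesgue_measure_itv/= lte_fin ifT; last by lra.
  by rewrite -EFinB; congr EFin; field.
rewrite -RintZ//; apply: le_Rint.
- by apply: tameMr => //; exact: bddm_cst.
- exact: tame_test1 (cutoff_scaled_test1 d0).
move=> t; rewrite indic_segE; have [td|_] := leP `|t| (delta / 2); last first.
  by rewrite mulr0; have /andP[] := cutoff_bound (t / delta).
rewrite mulr1; apply: cutoff_ge; rewrite normrM normfV (gtr0_norm d0).
by rewrite ler_pdivrMr// mulrC.
Qed.

Definition moll (delta t : R) : R := (cutoff_mass delta)^-1 * cutoff (t / delta).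

Lemma moll_test1 delta : 0 < delta -> test1 delta (moll delta).
Proof.
move=> d0; have := test1M (cutoff_scaled_test1 d0) (smooth_cst (cutoff_mass delta)^-1).
by under eq_fun do rewrite mulrC.
Qed.

Lemma moll_ge0 delta t : 0 < delta -> 0 <= moll delta t.
Proof.
move=> d0; apply: mulr_ge0; first by rewrite invr_ge0 ltW// cutoff_mass_gt0.
by have /andP[] := cutoff_bound (t / delta).
Qed.

Lemma moll_even delta t : moll delta (- t) = moll delta t.
Proof. by rewrite /moll mulNr cutoff_even. Qed.

Lemma Rint_moll delta : 0 < delta -> \int[leb]_t moll delta t = 1.
Proof.
move=> d0; rewrite RintZ; last exact: tame_test1 (cutoff_scaled_test1 d0).
by rewrite mulVf// gt_eqF// cutoff_mass_gt0.
Qed.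

Definition kern (delta : R) : plane R -> R := tensor (moll delta) (moll delta).

Lemma tame_kern delta : 0 < delta -> tame (area2 R) (kern delta).
Proof. by move=> d0; apply: (@tame_tensor _ delta); exact: moll_test1. Qed.

Lemma kern_ge0 delta x : 0 < delta -> 0 <= kern delta x.
Proof. by move=> d0; apply: mulr_ge0; exact: moll_ge0. Qed.

Lemma kern_even delta (x : P) : kern delta (- x) = kern delta x.
Proof. by rewrite /kern /tensor /= !moll_even. Qed.

Lemma kern_out delta (x : P) : 0 < delta -> ~ box delta x -> kern delta x = 0.
Proof.
move=> d0 /not_andP xd; have [_ m0] := moll_test1 d0; rewrite /kern /tensor.
case: xd => /=; rewrite in_itv/= -ler_norml => /negP; rewrite -ltNge => /m0 ->.
  by rewrite mul0r.
by rewrite mulr0.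
Qed.

Lemma tame2_tensor a b r : test1 r a -> test1 r b -> tame2 leb leb (tensor a b).
Proof.
move=> ta tb; have [M aM] := test1_bounded ta; have [N bN] := test1_bounded tb.
have [[sa a0] [sb b0]] := (ta, tb).
have M0 : 0 <= M by apply: le_trans (aM 0).
have N0 : 0 <= N by apply: le_trans (bN 0).
split; first by apply: measurable_tensor; exact: smooth_continuous.
exists (M * N), (seg r), (seg r); split; rewrite ?seg_lty//; try exact: measurable_seg.
move=> x y; rewrite !indic_segE /tensor/=.
have [xr|xr] := leP `|x| r; last by rewrite a0// mul0r normr0 mulr0 mul0r.
have [yr|yr] := leP `|y| r; last by rewrite b0// mulr0 normr0 mulr0.
by rewrite !mulr1 normrM ler_pM.
Qed.

Lemma Rint_kern delta : 0 < delta -> \int[area2 R]_x kern delta x = 1.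
Proof.
move=> d0; have tm := moll_test1 d0.
rewrite (Rint_area2_12 (tame2_tensor tm tm)) /tensor /=.
rewrite -[RHS](Rint_moll d0); apply: eq_Rint => x.
by rewrite RintZ ?Rint_moll ?mulr1//; exact: (tame_test1 tm).
Qed.

Definition mollify delta h (x : P) : R := \int[area2 R]_u (h u * kern delta (x - u)).

Lemma tame_mollify_integrand delta h (x : P) : 0 < delta -> bddm h ->
  tame (area2 R) (fun u : P => h u * kern delta (x - u)).
Proof.
move=> d0 bh; apply: tameMr => //.
have tm := moll_test1 d0.
have t1 := test1_flip x.1 tm; have t2 := test1_flip x.2 tm.
have rr : delta + `|x.1| <= delta + `|x.1| + `|x.2| by rewrite lerDl.
have rr' : delta + `|x.2| <= delta + `|x.1| + `|x.2| by rewrite lerD2r lerDl.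
exact: tame_tensor (test1W rr t1) (test1W rr' t2).
Qed.

Lemma mollifyE delta h (x : P) : 0 < delta -> bddm h ->
  mollify delta h x = \int[area2 R]_s (h (x + s) * kern delta s).
Proof.
move=> d0 bh; rewrite /mollify -(Rint_shift x); last exact: tame_mollify_integrand.
by apply: eq_Rint => s; rewrite opprD addrCA subrr addr0 kern_even addrC.
Qed.

Lemma measurable_plane_add : measurable_fun setT (fun z : P * P => z.1 + z.2).
Proof.
have m1 : measurable_fun setT (fun z : P * P => z.1.1 : R).
  by apply: (measurableT_comp measurable_fst); exact: measurable_fst.
have m2 : measurable_fun setT (fun z : P * P => z.1.2 : R).
  by apply: (measurableT_comp measurable_snd); exact: measurable_fst.
have m3 : measurable_fun setT (fun z : P * P => z.2.1 : R).
  by apply: (measurableT_comp measurable_fst); exact: measurable_snd.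
have m4 : measurable_fun setT (fun z : P * P => z.2.2 : R).
  by apply: (measurableT_comp measurable_snd); exact: measurable_snd.
by apply: measurable_fun_pair; exact: measurable_funD.
Qed.

Lemma measurable_plane_sub : measurable_fun setT (fun z : P * P => z.1 - z.2).
Proof.
have m1 : measurable_fun setT (fun z : P * P => z.1.1 : R).
  by apply: (measurableT_comp measurable_fst); exact: measurable_fst.
have m2 : measurable_fun setT (fun z : P * P => z.1.2 : R).
  by apply: (measurableT_comp measurable_snd); exact: measurable_fst.
have m3 : measurable_fun setT (fun z : P * P => z.2.1 : R).
  by apply: (measurableT_comp measurable_fst); exact: measurable_snd.
have m4 : measurable_fun setT (fun z : P * P => z.2.2 : R).
  by apply: (measurableT_comp measurable_snd); exact: measurable_snd.
by apply: measurable_fun_pair; exact: measurable_funB.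
Qed.

Lemma tame2_mollify k delta h : 0 < delta -> bddm h ->
  tame2 (area2 R) (area2 R)
    (fun z : P * P => \1_(box k) z.1 * (h (z.1 + z.2) - h z.1) * kern delta z.2).
Proof.
move=> d0 [mh [M hM]]; have [mk [N [B [mB Boo kN]]]] := tame_kern d0.
have mb := measurable_indic_box (R:=R) k.
split.
  apply: measurable_funM; last by apply: (measurableT_comp mk); exact: measurable_snd.
  apply: measurable_funM.
    by apply: (measurableT_comp mb); exact: measurable_fst.
  apply: measurable_funB.
    by apply: (measurableT_comp mh); exact: measurable_plane_add.
  by apply: (measurableT_comp mh); exact: measurable_fst.
exists ((M + M) * N), (box k), B; split => //; [exact: measurable_box|exact: box_lty|].
move=> x s /=; move: (kern delta s) (kN s) => q qN.
rewrite !normrM (@ger0_norm _ (\1_(box k) x))//.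
have N0 : 0 <= N * \1_B s by apply: le_trans qN.
have -> : (M + M) * N * \1_(box k) x * \1_B s = (\1_(box k) x * (M + M)) * (N * \1_B s) by ring.
apply: ler_pM => //.
apply: ler_wpM2l => //; by rewrite (le_trans (ler_normB _ _))// lerD.
Qed.

Lemma mollify_diff k delta h (x : P) : 0 < delta -> bddm h ->
  \1_(box k) x * (mollify delta h x - h x) =
  \int[area2 R]_s (\1_(box k) x * (h (x + s) - h x) * kern delta s).
Proof.
move=> d0 bh; have tk := tame_kern d0.
have t1 : tame (area2 R) (fun s : P => h (x + s) * kern delta s).
  apply: tameMr => //; have := bddm_shift x bh.
  by under eq_fun do rewrite addrC.
rewrite mollifyE// -[X in _ - X]mulr1 -(Rint_kern d0) -RintZ// -RintB//; last first.
  by apply: tameMr => //; exact: bddm_cst.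
rewrite -RintZ.
  by apply: eq_Rint => s; rewrite -mulrBl mulrA.
by apply: tameB => //; apply: tameMr => //; exact: bddm_cst.
Qed.

Lemma tame_mollify k delta h : 0 < delta -> bddm h ->
  tame (area2 R) (fun x : P => \1_(box k) x * (mollify delta h x - h x)).
Proof.
move=> d0 bh; under [X in tame _ X]eq_fun do rewrite mollify_diff//.
exact: tame2_intl (tame2_mollify k d0 bh).
Qed.

(** By Fubini the L^1 distance of [h] to its mollification is at most the mean of
    [l1_shift k h] over the support of the kernel. *)
Lemma mollify_small k h (e : R) : 0 <= k -> bddm h -> 0 < e ->
  exists2 delta0, 0 < delta0 <= 1 & forall delta, 0 < delta <= delta0 ->
    \int[area2 R]_x `|\1_(box k) x * (mollify delta h x - h x)| <= e.
Proof.
move=> k0 bh e0; have [d0 d01 Hd] := l1_shift_small k0 bh e0.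
exists d0 => // delta /andP[dp dd0].
have tK := tame2_mollify k dp bh.
have tK' : tame2 (area2 R) (area2 R)
    (fun z : P * P => `|\1_(box k) z.1 * (h (z.1 + z.2) - h z.1) * kern delta z.2|).
  case: tK => mK [M [A [B [mA mB Aoo Boo KM]]]]; split; first exact: measurableT_comp.
  by exists M, A, B; split => // x y; rewrite normr_id.
apply: (@le_trans _ _ (\int[area2 R]_x (\int[area2 R]_s
    `|\1_(box k) x * (h (x + s) - h x) * kern delta s|))).
  apply: le_Rint.
  - by apply: tame_norm; exact: tame_mollify.
  - exact: tame2_intl tK'.
  - by move=> x; rewrite mollify_diff//; apply: le_norm_Rint; exact: tame2_secl x tK.
rewrite (tame_Fubini tK') -[leRHS]mulr1 -(Rint_kern dp) -RintZ; last exact: tame_kern.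
apply: le_Rint.
- exact: tame2_intr tK'.
- by apply: tameMr; [exact: bddm_cst|exact: tame_kern].
move=> s; rewrite (_ : \int[_]_x _ = kern delta s * l1_shift k h s); last first.
  rewrite /l1_shift -RintZ; last exact: tame_l1_shift.
  apply: eq_Rint => x; rewrite (normrM _ (kern delta s)) (ger0_norm (kern_ge0 s dp)).
  by rewrite normrM (@ger0_norm _ (\1_(box k) x))// mulrC.
rewrite mulrC; have [sB|sB] := pselect (box delta s); last by rewrite kern_out// !mulr0.
rewrite ler_wpM2r ?kern_ge0//; apply: Hd; apply: le_trans dd0.
  by case: sB => /=; rewrite in_itv/= -ler_norml.
by case: sB => _ /=; rewrite in_itv/= -ler_norml.
Qed.

Lemma mollify_bound delta h M (x : P) : 0 < delta -> bddm h -> (forall x, `|h x| <= M) ->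
  `|mollify delta h x| <= M.
Proof.
move=> d0 bh hM; have t := tame_mollify_integrand x d0 bh.
have b1 : bddm (fun _ : P => 1 : R) by exact: bddm_cst.
have tf : tame (area2 R) (fun u : P => kern delta (x - u)).
  by have := tame_mollify_integrand x d0 b1; under eq_fun do rewrite mul1r.
have E : \int[area2 R]_u kern delta (x - u) = 1.
  transitivity (mollify delta (fun=> 1) x); first by apply: eq_Rint => u; rewrite mul1r.
  by rewrite mollifyE// -[RHS](Rint_kern d0); apply: eq_Rint => u; rewrite mul1r.
apply: le_trans (le_norm_Rint t) _; rewrite -[M]mulr1 -E -RintZ//.
apply: le_Rint; [exact: tame_norm|by apply: tameMr => //; exact: bddm_cst|].
move=> u; rewrite (normrM _ (kern _ _)) (ger0_norm (kern_ge0 (x - u) d0)).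
by rewrite ler_wpM2r ?kern_ge0.
Qed.

End mollifier.

(** * Convolution and weak gradients *)

Section convolution.
Context (R : realType).
Local Notation P := (plane R).
Implicit Types (f g h w A : plane R -> R) (a b : R -> R).

(** Convolution with an arbitrary kernel: besides the mollifier, its partial derivatives
    occur as kernels. *)
Definition convk (kap : P -> R) w (x : P) : R := \int[area2 R]_u (w u * kap (x - u)).

Lemma tensor_out r a b (x : P) : test1 r a -> test1 r b -> ~ box r x -> tensor a b x = 0.
Proof.
move=> [_ a0] [_ b0] /not_andP xd; rewrite /tensor.
case: xd => /=; rewrite in_itv/= -ler_norml => /negP; rewrite -ltNge.
  by move/a0 ->; rewrite mul0r.
by move/b0 ->; rewrite mulr0.
Qed.

Lemma bddm_tensor r a b : test1 r a -> test1 r b -> bddm (tensor a b).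
Proof. by move=> ta tb; exact: tame_bddm (tame_tensor ta tb). Qed.

Lemma tame2_convk r d A w a b : test1 d a -> test1 d b -> bddm w -> bddm A ->
  (forall x, ~ box r x -> A x = 0) ->
  tame2 (area2 R) (area2 R) (fun z : P * P => A z.1 * (w z.2 * tensor a b (z.1 - z.2))).
Proof.
move=> ta tb [mw [M wM]] [mA [N AN]] A0; have [mt [C tC]] := bddm_tensor ta tb.
split.
  apply: measurable_funM; first by apply: (measurableT_comp mA); exact: measurable_fst.
  apply: measurable_funM; first by apply: (measurableT_comp mw); exact: measurable_snd.
  by apply: (measurableT_comp mt); exact: measurable_plane_sub.
have M0 : 0 <= M by apply: le_trans (wM 0).
have N0 : 0 <= N by apply: le_trans (AN 0).
have C0 : 0 <= C by apply: le_trans (tC 0).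
exists (N * (M * C)), (box r), (box (r + d)).
split; [exact: measurable_box|exact: measurable_box|exact: box_lty|exact: box_lty|].
move=> x u /=; have [xr|/A0 ->] := pselect (box r x); last first.
  rewrite mul0r normr0; apply: mulr_ge0; last exact: ler0n.
  apply: mulr_ge0; last exact: ler0n.
  by apply: mulr_ge0 => //; exact: mulr_ge0.
have [ur|ur] := pselect (box (r + d) u).
  rewrite !indicE !mem_set// !mulr1 normrM; apply: ler_pM => //.
  by rewrite normrM; apply: ler_pM.
rewrite (tensor_out ta tb); last first.
  move: xr => [] /=; rewrite !in_itv/= -!ler_norml => x1 x2 [] /=.
  rewrite !in_itv/= -!ler_norml => h1 h2; apply: ur; split; rewrite /= in_itv/= -ler_norml.
    have := ler_normB x.1 (x.1 - u.1); rewrite opprB addrC subrK => h.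
    by apply: le_trans h _; rewrite lerD.
  have := ler_normB x.2 (x.2 - u.2); rewrite opprB addrC subrK => h.
  by apply: le_trans h _; rewrite lerD.
rewrite !mulr0 normr0; apply: mulr_ge0; last exact: ler0n.
apply: mulr_ge0; last exact: ler0n.
by apply: mulr_ge0 => //; exact: mulr_ge0.
Qed.

Lemma tame_convk d w a b (x : P) : test1 d a -> test1 d b -> bddm w ->
  tame (area2 R) (fun u : P => w u * tensor a b (x - u)).
Proof.
move=> ta tb bw; apply: tameMr => //.
have t1 := test1_flip x.1 ta; have t2 := test1_flip x.2 tb.
have rr : d + `|x.1| <= d + `|x.1| + `|x.2| by rewrite lerDl.
have rr' : d + `|x.2| <= d + `|x.1| + `|x.2| by rewrite lerD2r lerDl.
exact: tame_tensor (test1W rr t1) (test1W rr' t2).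
Qed.

Lemma tame_convk_shift d A a b (u : P) : test1 d a -> test1 d b -> bddm A ->
  tame (area2 R) (fun x : P => A x * tensor a b (x - u)).
Proof.
move=> ta tb bA; apply: tameMr => //.
have t1 := test1_shift u.1 ta; have t2 := test1_shift u.2 tb.
have rr : d + `|u.1| <= d + `|u.1| + `|u.2| by rewrite lerDl.
have rr' : d + `|u.2| <= d + `|u.1| + `|u.2| by rewrite lerD2r lerDl.
exact: tame_tensor (test1W rr t1) (test1W rr' t2).
Qed.

Section adjoint.
Variables (r d : R) (A w : P -> R) (a b : R -> R).
Hypotheses (ta : test1 d a) (tb : test1 d b) (bw : bddm w) (bA : bddm A).
Hypothesis A0 : forall x, ~ box r x -> A x = 0.

Lemma tame_mul_convk : tame (area2 R) (fun x : P => A x * convk (tensor a b) w x).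
Proof.
rewrite (_ : (fun x => _) =
    (fun x => \int[area2 R]_u (A x * (w u * tensor a b (x - u))))).
  exact: tame2_intl (tame2_convk ta tb bw bA A0).
by apply/funext => x; rewrite RintZ//; exact: (tame_convk x ta tb bw).
Qed.

Lemma tame_mul_coconvk :
  tame (area2 R) (fun u : P => w u * \int[area2 R]_x (A x * tensor a b (x - u))).
Proof.
rewrite (_ : (fun u => _) =
    (fun u => \int[area2 R]_x (A x * (w u * tensor a b (x - u))))).
  exact: tame2_intr (tame2_convk ta tb bw bA A0).
apply/funext => u; rewrite -RintZ; last exact: (tame_convk_shift u ta tb bA).
by apply: eq_Rint => x; rewrite mulrCA.
Qed.

Lemma convk_adjoint :
  \int[area2 R]_x (A x * convk (tensor a b) w x) =
  \int[area2 R]_u (w u * \int[area2 R]_x (A x * tensor a b (x - u))).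
Proof.
have tK := tame2_convk ta tb bw bA A0.
transitivity (\int[area2 R]_x (\int[area2 R]_u (A x * (w u * tensor a b (x - u))))).
  by apply: eq_Rint => x; rewrite RintZ//; exact: (tame_convk x ta tb bw).
rewrite (tame_Fubini tK); apply: eq_Rint => u /=.
rewrite -RintZ; last exact: (tame_convk_shift u ta tb bA).
by apply: eq_Rint => x; rewrite mulrCA.
Qed.

End adjoint.

(** [(g0, g1)] is the weak gradient of [f] on the box of half-side [r], tested on
    products of one-variable functions: this form survives translations and differences
    ([wgrad_shift], [wgradB]) and matches the product form of the mollifier. *)
Definition wgrad r f g0 g1 := forall a b, test1 r a -> test1 r b ->
  (\int[area2 R]_x (f x * tensor a^`()%classic b x) =
     - (\int[area2 R]_x (g0 x * tensor a b x))) /\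
  (\int[area2 R]_x (f x * tensor a b^`()%classic x) =
     - (\int[area2 R]_x (g1 x * tensor a b x))).

Lemma wgradW r s f g0 g1 : s <= r -> wgrad r f g0 g1 -> wgrad s f g0 g1.
Proof. by move=> sr wf a b ta tb; apply: wf; exact: test1W sr _. Qed.

Lemma wgradB r f g0 g1 f' g0' g1' :
  bddm f -> bddm g0 -> bddm g1 -> bddm f' -> bddm g0' -> bddm g1' ->
  wgrad r f g0 g1 -> wgrad r f' g0' g1' ->
  wgrad r (fun x => f x - f' x) (fun x => g0 x - g0' x) (fun x => g1 x - g1' x).
Proof.
move=> bf b0 b1 bf' b0' b1' wf wf' a b ta tb.
have [e1 e2] := wf a b ta tb; have [e1' e2'] := wf' a b ta tb.
have ta' := test1_derive ta; have tb' := test1_derive tb.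
have H h h' p q : bddm h -> bddm h' -> test1 r p -> test1 r q ->
    \int[area2 R]_x ((h x - h' x) * tensor p q x) =
    \int[area2 R]_x (h x * tensor p q x) - \int[area2 R]_x (h' x * tensor p q x).
  move=> bh bh' t1 t2; rewrite -RintB; last 2 first.
  - by apply: tameMr => //; exact: tame_tensor t1 t2.
  - by apply: tameMr => //; exact: tame_tensor t1 t2.
  by apply: eq_Rint => x; rewrite mulrBl.
by rewrite !H// e1 e1' e2 e2'; split; ring.
Qed.

Lemma derive1_shift a u : smooth a ->
  (fun t => a (t - u))^`()%classic = (fun t => a^`()%classic (t - u)).
Proof.
move=> sa; apply: is_derive_eta => t.
have h : is_derive t 1 (fun t : R => t - u) 1.
  by have := is_deriveB (is_derive_id t 1) (is_derive_cst u t 1); rewrite subr0.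
have := @is_derive1_comp R a (fun t => t - u) t _ 1 (smooth_derive (t - u) sa) h.
by rewrite mulr1.
Qed.

Lemma derive1_flip a u : smooth a ->
  (fun t => a (u - t))^`()%classic = (fun t => - a^`()%classic (u - t)).
Proof.
move=> sa; apply: is_derive_eta => t.
have h : is_derive t 1 (fun t : R => u - t) (-1).
  by have := is_deriveB (is_derive_cst u t 1) (is_derive_id t 1); rewrite sub0r.
have := @is_derive1_comp R a (fun t => u - t) t _ (-1) (smooth_derive (u - t) sa) h.
by rewrite mulrN1.
Qed.

Lemma wgrad_shift r s f g0 g1 (y : P) :
  bddm f -> bddm g0 -> bddm g1 -> `|y.1| <= s -> `|y.2| <= s ->
  wgrad r f g0 g1 ->
  wgrad (r - s) (fun x => f (x + y)) (fun x => g0 (x + y)) (fun x => g1 (x + y)).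
Proof.
move=> bf b0 b1 y1 y2 wf a b ta tb.
have tW c (u : R) : `|u| <= s -> test1 (r - s) c -> test1 r (fun t => c (t - u)).
  by move=> us /(test1_shift u); apply: test1W; rewrite -lerBrDr lerB.
have H h p q : bddm h -> test1 (r - s) p -> test1 (r - s) q ->
    \int[area2 R]_x (h (x + y) * tensor p q x) =
    \int[area2 R]_x (h x * tensor (fun t => p (t - y.1)) (fun t => q (t - y.2)) x).
  move=> bh t1 t2; rewrite -[RHS](Rint_shift y); last first.
    by apply: tameMr => //; apply: (@tame_tensor _ r); exact: tW.
  by apply: eq_Rint => x; rewrite /tensor /= !addrK.
have ta' := test1_derive ta; have tb' := test1_derive tb.
rewrite !H//; have [e1 e2] := wf _ _ (tW _ _ y1 ta) (tW _ _ y2 tb).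
have [sa _] := ta; have [sb _] := tb.
by rewrite !derive1_shift// in e1 e2.
Qed.

(** A point [x] at depth [d] inside the box sees the reflected kernel [a (x.1 - _)],
    [b (x.2 - _)] as a test function; the two sign changes, of the reflection and of
    the weak derivative, cancel. *)
Lemma wgrad_convk r d f g0 g1 a b (x : P) : bddm f -> bddm g0 -> bddm g1 ->
  test1 d a -> test1 d b -> `|x.1| <= r - d -> `|x.2| <= r - d -> wgrad r f g0 g1 ->
  convk (tensor a^`()%classic b) f x = convk (tensor a b) g0 x /\
  convk (tensor a b^`()%classic) f x = convk (tensor a b) g1 x.
Proof.
move=> bf b0 b1 ta tb x1 x2 wf.
have tW c (u : R) : `|u| <= r - d -> test1 d c -> test1 r (fun t => c (u - t)).
  by move=> us /(test1_flip u); apply: test1W; rewrite -lerBrDl.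
have [sa _] := ta; have [sb _] := tb.
have ta' := test1_derive ta; have tb' := test1_derive tb.
have [e1 e2] := wf _ _ (tW _ _ x1 ta) (tW _ _ x2 tb).
rewrite !derive1_flip// in e1 e2.
have N h p q : bddm h -> test1 d p -> test1 d q ->
    \int[area2 R]_u (h u * tensor (fun t => - p (x.1 - t)) (fun t => q (x.2 - t)) u) =
    - convk (tensor p q) h x.
  move=> bh t1 t2; rewrite /convk -RintN; last exact: tame_convk t1 t2 bh.
  by apply: eq_Rint => u; rewrite /tensor /= mulNr mulrN.
have N' h p q : bddm h -> test1 d p -> test1 d q ->
    \int[area2 R]_u (h u * tensor (fun t => p (x.1 - t)) (fun t => - q (x.2 - t)) u) =
    - convk (tensor p q) h x.
  move=> bh t1 t2; rewrite /convk -RintN; last exact: tame_convk t1 t2 bh.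
  by apply: eq_Rint => u; rewrite /tensor /= !mulrN.
by rewrite N// in e1; rewrite N'// in e2; split; exact: oppr_inj.
Qed.

End convolution.

(** * The null Lagrangian *)

Section null_lagrangian.
Context (R : realType).
Local Notation P := (plane R).
Implicit Types (f g h w : plane R -> R) (a b : R -> R).

Lemma derive1M a b : smooth a -> smooth b ->
  (fun t => a t * b t)^`()%classic =
  (fun t => a^`()%classic t * b t + a t * b^`()%classic t).
Proof.
move=> sa sb; apply: is_derive_eta => t.
have := is_deriveM (smooth_derive t sa) (smooth_derive t sb).
by rewrite addrC [X in X + _]mulrC; exact.
Qed.

Variables (r d rho : R) (al be : R -> R) (w1 g11 g12 w2 g21 g22 : P -> R).
Hypotheses (d0 : 0 < d) (rdrho : r + d <= rho).
Hypotheses (tal : test1 r al) (tbe : test1 r be).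
Hypotheses (bw1 : bddm w1) (b11 : bddm g11) (b12 : bddm g12).
Hypotheses (b21 : bddm g21) (b22 : bddm g22).
Hypotheses (wg1 : wgrad rho w1 g11 g12) (wg2 : wgrad rho w2 g21 g22).

Let m := moll d.
Let m' := m^`()%classic.
Let tm : test1 d m. Proof. exact: moll_test1. Qed.
Let tm' : test1 d m'. Proof. exact: test1_derive. Qed.
Let al' := al^`()%classic.
Let be' := be^`()%classic.
Let tal' : test1 r al'. Proof. exact: test1_derive. Qed.
Let tbe' : test1 r be'. Proof. exact: test1_derive. Qed.

Let A1 x := tensor al' be x * g22 x.
Let A2 x := tensor al be x * g22 x.
Let A3 x := tensor al be' x * g21 x.
Let A4 x := tensor al be x * g21 x.

Let bA a b g : test1 r a -> test1 r b -> bddm g -> bddm (fun x => tensor a b x * g x).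
Proof. by move=> ta tb bg; apply: bddmM => //; exact: bddm_tensor ta tb. Qed.

Let outA a b g (x : P) : test1 r a -> test1 r b -> ~ box r x -> tensor a b x * g x = 0.
Proof. by move=> ta tb xr; rewrite (tensor_out ta tb xr) mul0r. Qed.

Let J A k1 k2 (u : P) := \int[area2 R]_x (A x * tensor k1 k2 (x - u)).

(** The products [p] and [q] of the cut-off with the kernel are themselves test functions,
    and the integrals of [g22] against p' q and of [g21] against p q' are both minus the
    integral of [w2] against p' q': second derivatives commute. *)
Let J_cancel u : J A1 m m u + J A2 m' m u - J A3 m m u - J A4 m m' u = 0.
Proof.
pose p t := al t * m (t - u.1).
pose q t := be t * m (t - u.2).
have [sal _] := tal; have [sbe _] := tbe; have [sm _] := tm.
have smu (c : R) : smooth (fun t => m (t - c)) by have [] := test1_shift c tm.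
have tp : test1 r p by exact: test1M.
have tq : test1 r q by exact: test1M.
have tp' := test1_derive tp; have tq' := test1_derive tq.
have p'E : p^`()%classic = (fun t => al' t * m (t - u.1) + al t * m' (t - u.1)).
  rewrite (derive1M sal (smu u.1)) (derive1_shift u.1 sm); reflexivity.
have q'E : q^`()%classic = (fun t => be' t * m (t - u.2) + be t * m' (t - u.2)).
  rewrite (derive1M sbe (smu u.2)) (derive1_shift u.2 sm); reflexivity.
have d00 : 0 <= d by exact: ltW.
have rrho : r <= rho by apply: le_trans rdrho; rewrite lerDl.
have [_ E2] := wg2 (test1W rrho tp') (test1W rrho tq).
have [E1 _] := wg2 (test1W rrho tp) (test1W rrho tq').
have J12 : J A1 m m u + J A2 m' m u = \int[area2 R]_x (g22 x * tensor p^`()%classic q x).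
  rewrite /J -RintD; last 2 first.
  - by apply: (tame_convk_shift u tm tm); exact: bA.
  - by apply: (tame_convk_shift u tm' tm); exact: bA.
  by apply: eq_Rint => x; rewrite /A1 /A2 p'E /tensor /q /=; ring.
have J34 : J A3 m m u + J A4 m m' u = \int[area2 R]_x (g21 x * tensor p q^`()%classic x).
  rewrite /J -RintD; last 2 first.
  - by apply: (tame_convk_shift u tm tm); exact: bA.
  - by apply: (tame_convk_shift u tm tm'); exact: bA.
  by apply: eq_Rint => x; rewrite /A3 /A4 q'E /tensor /p /=; ring.
have -> : J A1 m m u + J A2 m' m u - J A3 m m u - J A4 m m' u =
  (J A1 m m u + J A2 m' m u) - (J A3 m m u + J A4 m m' u) by ring.
by rewrite J12 J34; apply/eqP; rewrite subr_eq0 -eqr_opp -E1 -E2.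
Qed.

Let T A k1 k2 := \int[area2 R]_x (A x * convk (tensor k1 k2) w1 x).

Let Q A k1 k2 (u : P) := w1 u * J A k1 k2 u.

Let T_adjoint a b g k1 k2 : test1 r a -> test1 r b -> bddm g -> test1 d k1 -> test1 d k2 ->
  T (fun x => tensor a b x * g x) k1 k2 =
    \int[area2 R]_u Q (fun x => tensor a b x * g x) k1 k2 u /\
  tame (area2 R) (Q (fun x => tensor a b x * g x) k1 k2).
Proof.
move=> ta tb bg t1 t2; split.
  exact: convk_adjoint t1 t2 bw1 (bA ta tb bg) (fun x => @outA _ _ g x ta tb).
exact: tame_mul_coconvk t1 t2 bw1 (bA ta tb bg) (fun x => @outA _ _ g x ta tb).
Qed.

Let T_cancel : T A1 m m + T A2 m' m - T A3 m m - T A4 m m' = 0.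
Proof.
have [a1 t1] := T_adjoint tal' tbe b22 tm tm.
have [a2 t2] := T_adjoint tal tbe b22 tm' tm.
have [a3 t3] := T_adjoint tal tbe' b21 tm tm.
have [a4 t4] := T_adjoint tal tbe b21 tm tm'.
rewrite [T A1 _ _]a1 [T A2 _ _]a2 [T A3 _ _]a3 [T A4 _ _]a4.
have J0 u : Q A1 m m u + Q A2 m' m u - Q A3 m m u - Q A4 m m' u = 0.
  by rewrite /Q -mulrDr -!mulrBr J_cancel mulr0.
move: {a1 a2 a3 a4} (Q A1 m m) (Q A2 m' m) (Q A3 m m) (Q A4 m m') t1 t2 t3 t4 J0.
move=> q1 q2 q3 q4 t1 t2 t3 t4 J0.
rewrite -(RintD t1 t2) -(RintB (tameD t1 t2) t3) -(RintB (tameB (tameD t1 t2) t3) t4).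
transitivity (\int[area2 R]_u (0 : R)); first exact: eq_Rint.
by rewrite /Rintegral integral0.
Qed.

(** The classical identity is that [g22 d_1 w - g21 d_2 w] is the divergence of [w] times
    the rotated gradient of [w2], for smooth [w]. Here [w] is a mollification of [w1]:
    Fubini moves the kernel to the other factor, where [J_cancel] is the statement that
    the rotated gradient is free of divergence. *)
Lemma null_lagrangian_mollify :
  \int[area2 R]_x (tensor al be x * (g22 x * mollify d g11 x - g21 x * mollify d g12 x)) =
  - \int[area2 R]_x ((tensor al^`()%classic be x * g22 x -
                      tensor al be^`()%classic x * g21 x) * mollify d w1 x).
Proof.
have inbox (x : P) : box r x -> (`|x.1| <= rho - d) /\ (`|x.2| <= rho - d).
  by case=> /=; rewrite !in_itv/= -!ler_norml => h1 h2; split; rewrite lerBrDr;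
    apply: le_trans rdrho; rewrite lerD2r.
have E2 : T A2 m' m = \int[area2 R]_x (tensor al be x * g22 x * mollify d g11 x).
  apply: eq_Rint => x; have [xr|xr] := pselect (box r x); last first.
    by rewrite /A2 (tensor_out tal tbe xr) !mul0r.
  have [x1 x2] := inbox x xr.
  by have [-> _] := wgrad_convk bw1 b11 b12 tm tm x1 x2 wg1.
have E4 : T A4 m m' = \int[area2 R]_x (tensor al be x * g21 x * mollify d g12 x).
  apply: eq_Rint => x; have [xr|xr] := pselect (box r x); last first.
    by rewrite /A4 (tensor_out tal tbe xr) !mul0r.
  have [x1 x2] := inbox x xr.
  by have [_ ->] := wgrad_convk bw1 b11 b12 tm tm x1 x2 wg1.
have t1 := tame_mul_convk tm tm bw1 (bA tal' tbe b22) (fun x => @outA _ _ g22 x tal' tbe).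
have t3 := tame_mul_convk tm tm bw1 (bA tal tbe' b21) (fun x => @outA _ _ g21 x tal tbe').
have t2 := tame_mul_convk tm tm b11 (bA tal tbe b22) (fun x => @outA _ _ g22 x tal tbe).
have t4 := tame_mul_convk tm tm b12 (bA tal tbe b21) (fun x => @outA _ _ g21 x tal tbe).
transitivity (T A2 m' m - T A4 m m').
  rewrite E2 E4; apply: etrans (RintB t2 t4); apply: eq_Rint => x.
  by rewrite mulrBr !mulrA.
transitivity (- (T A1 m m - T A3 m m)).
  have := T_cancel; move: (T A1 m m) (T A2 m' m) (T A3 m m) (T A4 m m') => c1 c2 c3 c4 h.
  by apply/eqP; rewrite -subr_eq0 -h; apply/eqP; ring.
congr (- _); apply: etrans (esym (RintB t1 t3)) _; apply: eq_Rint => x.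
by rewrite mulrBl.
Qed.

End null_lagrangian.

(** * Lipschitz bound for mollified functions *)

Section lipschitz.
Context (R : realType).
Local Notation P := (plane R).
Implicit Types (f g h w : plane R -> R) (a b : R -> R).

(** A domination independent of [x] as long as [x] stays in a bounded set, as required to
    differentiate under the integral sign. *)
Let box_dominated d a b f M C (K : R) (x u : P) : test1 d a -> test1 d b ->
  (forall x, `|f x| <= M) -> (forall x, `|tensor a b x| <= C) ->
  `|x.1| + d <= K -> `|x.2| + d <= K ->
  `|f u * tensor a b (x - u)| <= M * C * \1_(box K) u.
Proof.
move=> ta tb fM tC h1 h2.
have M0 : 0 <= M by apply: le_trans (fM 0).
have C0 : 0 <= C by apply: le_trans (tC 0).
have [ur|ur] := pselect (box K u).
  by rewrite indicE mem_set// mulr1 normrM; exact: ler_pM.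
rewrite (tensor_out ta tb) ?mulr0 ?normr0; first by rewrite !mulr_ge0.
move=> [] /=; rewrite !in_itv/= -!ler_norml => x1 x2; apply: ur.
split; rewrite /= in_itv/= -ler_norml.
  have := ler_normB x.1 (x.1 - u.1); rewrite opprB addrC subrK => h.
  by apply: le_trans h _; apply: le_trans h1; rewrite lerD2l.
have := ler_normB x.2 (x.2 - u.2); rewrite opprB addrC subrK => h.
by apply: le_trans h _; apply: le_trans h2; rewrite lerD2l.
Qed.

Lemma convk_derive1 d f a b (t x2 : R) : bddm f -> test1 d a -> test1 d b ->
  is_derive t 1 (fun t => convk (tensor a b) f (t, x2))
    (convk (tensor a^`()%classic b) f (t, x2)).
Proof.
move=> bf ta tb; have ta' := test1_derive ta; have [sa _] := ta.
have [_ [M fM]] := bf; have [_ [C tC]] := bddm_tensor ta' tb.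
pose F (s : R) (u : P) : R := f u * tensor a b ((s, x2) - u).
have dF (s : R) (u : P) : is_derive s 1 (F^~ u) (f u * tensor a^`()%classic b ((s, x2) - u)).
  have h : is_derive s 1 (fun s => a (s - u.1)) (a^`()%classic (s - u.1)).
    have := smooth_derive s (proj1 (test1_shift u.1 ta)).
    by rewrite derive1_shift.
  have := is_deriveZ (f u * b (x2 - u.2)) h.
  rewrite /GRing.scale/= => H.
  have -> : f u * tensor a^`()%classic b ((s, x2) - u) =
      f u * b (x2 - u.2) * a^`()%classic (s - u.1) by rewrite /tensor /=; ring.
  rewrite (_ : F^~ u = (fun s => f u * b (x2 - u.2) * a (s - u.1))) //.
  by apply/funext => s'; rewrite /F /tensor /=; ring.
have d1F (s : R) (u : P) : partial1of2 F s u = f u * tensor a^`()%classic b ((s, x2) - u).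
  by rewrite /partial1of2 derive1E; apply: derive_val.
pose K := `|t| + 1 + `|x2| + `|d|.
have It : `]t - 1, t + 1[%classic t by rewrite /= in_itv/= ltrBlDr ltrDl ltr01.
have iF s : `]t - 1, t + 1[%classic s -> (area2 R).-integrable setT (EFin \o F s).
  by move=> _; apply: tame_integrable; exact: tame_convk ta tb bf.
have derF s u : `]t - 1, t + 1[%classic s -> [set: P] u -> derivable (F^~ u) s 1.
  by move=> _ _; have [] := dF s u.
have G0 (u : P) : 0 <= M * C * \1_(box K) u.
  by rewrite !mulr_ge0// ?(le_trans _ (fM 0))// (le_trans _ (tC 0)).
have iG : (area2 R).-integrable setT (EFin \o (fun u => M * C * \1_(box K) u)).
  by apply: tame_integrable; apply: tameMr; [exact: bddm_cst|exact: tame_box].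
have Gub s u : `]t - 1, t + 1[%classic s -> [set: P] u ->
    `|partial1of2 F s u| <= M * C * \1_(box K) u.
  move=> /= st _; rewrite d1F; apply: (box_dominated (d := d)) => //=.
    have : `|s| <= `|t| + 1.
      rewrite -{1}(subrK t s) addrC (le_trans (ler_normD _ _))// lerD2l.
      by rewrite ler_norml; move: st; rewrite in_itv/= => /andP[/ltW + /ltW]; lra.
    by have := ler_norm d; have := normr_ge0 x2; rewrite /K; lra.
  by have := ler_norm d; have := normr_ge0 t; rewrite /K; lra.
have := derivable_under_integral measurableT It iF derF G0 iG Gub.
have := differentiation_under_integral measurableT It iF derF G0 iG Gub.
move=> e1 e2; apply: DeriveDef; first exact: e2.
rewrite -derive1E; rewrite [LHS]e1; apply: eq_Rint => u; exact: d1F.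
Qed.

Lemma convk_derive2 d f a b (t x1 : R) : bddm f -> test1 d a -> test1 d b ->
  is_derive t 1 (fun t => convk (tensor a b) f (x1, t))
    (convk (tensor a b^`()%classic) f (x1, t)).
Proof.
move=> bf ta tb; have tb' := test1_derive tb; have [sb _] := tb.
have [_ [M fM]] := bf; have [_ [C tC]] := bddm_tensor ta tb'.
pose F (s : R) (u : P) : R := f u * tensor a b ((x1, s) - u).
have dF (s : R) (u : P) : is_derive s 1 (F^~ u) (f u * tensor a b^`()%classic ((x1, s) - u)).
  have h : is_derive s 1 (fun s => b (s - u.2)) (b^`()%classic (s - u.2)).
    have := smooth_derive s (proj1 (test1_shift u.2 tb)).
    by rewrite derive1_shift.
  have := is_deriveZ (f u * a (x1 - u.1)) h.
  rewrite /GRing.scale/= => H.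
  have -> : f u * tensor a b^`()%classic ((x1, s) - u) =
      f u * a (x1 - u.1) * b^`()%classic (s - u.2) by rewrite /tensor /=; ring.
  rewrite (_ : F^~ u = (fun s => f u * a (x1 - u.1) * b (s - u.2))) //.
  by apply/funext => s'; rewrite /F /tensor /=; ring.
have d1F (s : R) (u : P) : partial1of2 F s u = f u * tensor a b^`()%classic ((x1, s) - u).
  by rewrite /partial1of2 derive1E; apply: derive_val.
pose K := `|t| + 1 + `|x1| + `|d|.
have It : `]t - 1, t + 1[%classic t by rewrite /= in_itv/= ltrBlDr ltrDl ltr01.
have iF s : `]t - 1, t + 1[%classic s -> (area2 R).-integrable setT (EFin \o F s).
  by move=> _; apply: tame_integrable; exact: tame_convk ta tb bf.
have derF s u : `]t - 1, t + 1[%classic s -> [set: P] u -> derivable (F^~ u) s 1.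
  by move=> _ _; have [] := dF s u.
have G0 (u : P) : 0 <= M * C * \1_(box K) u.
  by rewrite !mulr_ge0// ?(le_trans _ (fM 0))// (le_trans _ (tC 0)).
have iG : (area2 R).-integrable setT (EFin \o (fun u => M * C * \1_(box K) u)).
  by apply: tame_integrable; apply: tameMr; [exact: bddm_cst|exact: tame_box].
have Gub s u : `]t - 1, t + 1[%classic s -> [set: P] u ->
    `|partial1of2 F s u| <= M * C * \1_(box K) u.
  move=> /= st _; rewrite d1F; apply: (box_dominated (d := d)) => //=.
    by have := ler_norm d; have := normr_ge0 t; rewrite /K; lra.
  have : `|s| <= `|t| + 1.
    rewrite -{1}(subrK t s) addrC (le_trans (ler_normD _ _))// lerD2l.
    by rewrite ler_norml; move: st; rewrite in_itv/= => /andP[/ltW + /ltW]; lra.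
  by have := ler_norm d; have := normr_ge0 x1; rewrite /K; lra.
have := derivable_under_integral measurableT It iF derF G0 iG Gub.
have := differentiation_under_integral measurableT It iF derF G0 iG Gub.
move=> e1 e2; apply: DeriveDef; first exact: e2.
rewrite -derive1E; rewrite [LHS]e1; apply: eq_Rint => u; exact: d1F.
Qed.

Lemma lipschitz_of_derive (F F' : R -> R) (k L : R) :
  (forall t : R, is_derive t 1 F (F' t)) -> (forall t, `|t| <= k -> `|F' t| <= L) ->
  forall s t, `|s| <= k -> `|t| <= k -> `|F t - F s| <= L * `|t - s|.
Proof.
move=> dF F'L.
have H s t : s <= t -> `|s| <= k -> `|t| <= k -> `|F t - F s| <= L * `|t - s|.
  move=> st sk tk; have cF : {within `[s, t], continuous F}.
    exact: continuous_subspaceT (is_derive_continuous dF).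
  have [c cst ->] := @MVT_segment R F F' s t st (fun x _ => dF x) cF.
  rewrite normrM ler_wpM2r//; apply: F'L.
  move: sk tk cst; rewrite !ler_norml in_itv/= => /andP[s1 s2] /andP[t1 t2] /andP[c1 c2].
  by rewrite (le_trans s1 c1) (le_trans c2 t2).
move=> s t sk tk; have [st|/ltW ts] := leP s t; first exact: H.
by rewrite distrC [in leRHS]distrC; exact: H.
Qed.

(** The partial derivatives of the mollification are the mollified [g0] and [g1], hence
    bounded by [L]; the increment is followed along two segments parallel to the axes. *)
Lemma mollify_lipschitz r d f g0 g1 L (x y : P) : 0 < d ->
  bddm f -> bddm g0 -> bddm g1 -> wgrad r f g0 g1 ->
  (forall x, `|g0 x| <= L) -> (forall x, `|g1 x| <= L) ->
  box (r - d) x -> box (r - d) (x + y) ->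
  `|mollify d f (x + y) - mollify d f x| <= L * (`|y.1| + `|y.2|).
Proof.
move=> d0 bf b0 b1 wf g0L g1L [] /=; rewrite !in_itv/= -!ler_norml => x1 x2 [] /=.
rewrite !in_itv/= -!ler_norml => xy1 xy2.
have tm := moll_test1 d0.
have H1 : `|mollify d f (x.1 + y.1, x.2) - mollify d f (x.1, x.2)| <= L * `|y.1|.
  have := @lipschitz_of_derive _ _ (r - d) L
    (fun t => convk_derive1 t x.2 bf tm tm) _ x.1 (x.1 + y.1) x1 xy1.
  rewrite [x.1 + _ - _]addrC addKr; apply => t tr.
  have [-> _] := @wgrad_convk R r d f g0 g1 _ _ (t, x.2) bf b0 b1 tm tm tr x2 wf.
  exact: mollify_bound.
have H2 : `|mollify d f (x.1 + y.1, x.2 + y.2) - mollify d f (x.1 + y.1, x.2)| <= L * `|y.2|.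
  have := @lipschitz_of_derive _ _ (r - d) L
    (fun t => convk_derive2 t (x.1 + y.1) bf tm tm) _ x.2 (x.2 + y.2) x2 xy2.
  rewrite [x.2 + _ - _]addrC addKr; apply => t tr.
  have [_ ->] := @wgrad_convk R r d f g0 g1 _ _ (x.1 + y.1, t) bf b0 b1 tm tm xy1 tr wf.
  exact: mollify_bound.
have -> : x + y = (x.1 + y.1, x.2 + y.2) by [].
have -> : mollify d f x = mollify d f (x.1, x.2) by congr mollify; exact: surjective_pairing.
rewrite (le_trans (ler_distD (mollify d f (x.1 + y.1, x.2)) _ _))//.
by rewrite addrC mulrDr lerD.
Qed.

End lipschitz.

(** * The algebra of the Beltrami curve *)

Section algebra.
Context (R : realFieldType).

(** Real form of the two Beltrami equations for the gradient matrix with rows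
    [(a, b)] and [(c, d)]. *)
Definition belt (a b c d : R) :=
  let p := (a + d) / 2 in let q := (c - b) / 2 in
  [/\ p ^+ 2 + q ^+ 2 = 4^-1, (a - d) / 2 = 4 / 3 * (p ^+ 3 - 3 * p * q ^+ 2) &
      (c + b) / 2 = 4 / 3 * (3 * p ^+ 2 * q - q ^+ 3)].

Definition sqnorm4 (a b c d : R) := a ^+ 2 + b ^+ 2 + c ^+ 2 + d ^+ 2.

Lemma belt_param a b c d : belt a b c d -> exists p q X Y,
  [/\ p ^+ 2 + q ^+ 2 = 4^-1, X = 4 / 3 * (p ^+ 3 - 3 * p * q ^+ 2),
      Y = 4 / 3 * (3 * p ^+ 2 * q - q ^+ 3) & [/\ a = p + X, b = Y - q, c = q + Y & d = p - X]].
Proof.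
move=> [h1 h2 h3]; exists ((a + d) / 2), ((c - b) / 2), ((a - d) / 2), ((c + b) / 2).
by split=> //; split; field.
Qed.

(** The moduli of d_z and d_zbar are 1/2 and 1/6, and each entry is a real or imaginary
    part of their sum or difference. *)
Lemma belt_bound a b c d : belt a b c d ->
  [/\ `|a| <= 1, `|b| <= 1, `|c| <= 1 & `|d| <= 1].
Proof.
move=> /belt_param[p [q [X [Y [pq eX eY [-> -> -> ->]]]]]].
have XY : X ^+ 2 + Y ^+ 2 = 36^-1.
  have -> : X ^+ 2 + Y ^+ 2 = 16 / 9 * (p ^+ 2 + q ^+ 2) ^+ 3 by rewrite eX eY; field.
  by rewrite pq; field.
have H (x y k : R) : 0 <= k -> x ^+ 2 + y ^+ 2 = k ^+ 2 -> `|x| <= k /\ `|y| <= k.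
  move=> k0 e; split; rewrite -(@ler_pXn2r _ 2) ?nnegrE// real_normK ?num_real// -e.
    by rewrite lerDl sqr_ge0.
  by rewrite lerDr sqr_ge0.
have [||p1 q1] := H p q 2^-1; [lra|by rewrite pq; field|].
have [||X1 Y1] := H X Y 6^-1; [lra|by rewrite XY; field|].
have le1 : 2^-1 + 6^-1 <= 1 :> R by lra.
split; apply: le_trans le1.
- by rewrite (le_trans (ler_normD _ _))// lerD.
- by rewrite [leRHS]addrC (le_trans (ler_normB _ _))// lerD.
- by rewrite (le_trans (ler_normD _ _))// lerD.
- by rewrite (le_trans (ler_normB _ _))// lerD.
Qed.

(** With s and t the distances of the two values of d_z and of d_zbar, the determinant is
    s^2 - t^2 and the squared norm is 2 (s^2 + t^2). As d_zbar is 4/3 times the cube of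
    d_z, tripling the angle, t is a function of s and s^2 - t^2 = 8/3 s^4 - 16/9 s^6. The
    terms of order s^2 cancel, and those of order s^4, positive since s <= 1, give the
    exponent 4. *)
Lemma belt_det a b c d a' b' c' d' : belt a b c d -> belt a' b' c' d' ->
  sqnorm4 (a' - a) (b' - b) (c' - c) (d' - d) ^+ 2 <=
  18 * ((d' - d) * (a' - a) - (c' - c) * (b' - b)).
Proof.
move=> /belt_param[p [q [X [Y [pq eX eY [-> -> -> ->]]]]]].
move=> /belt_param[p' [q' [X' [Y' [pq' eX' eY' [-> -> -> ->]]]]]].
(* [s2] and [t2] are the squared distances; [e] is the inner product of the values of d_z. *)
pose e := p * p' + q * q'.
pose s2 := (p' - p) ^+ 2 + (q' - q) ^+ 2.
pose t2 := (X' - X) ^+ 2 + (Y' - Y) ^+ 2.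
have s2E : s2 = 2^-1 - 2 * e.
  have -> : s2 = (p ^+ 2 + q ^+ 2) + (p' ^+ 2 + q' ^+ 2) - 2 * e by rewrite /s2 /e; ring.
  by rewrite pq pq'; field.
have ef : e ^+ 2 + (p' * q - p * q') ^+ 2 = 16^-1.
  have -> : e ^+ 2 + (p' * q - p * q') ^+ 2 =
    (p ^+ 2 + q ^+ 2) * (p' ^+ 2 + q' ^+ 2) by rewrite /e; ring.
  by rewrite pq pq'; field.
have t2E : t2 = 16 / 9 * (32^-1 - 2 * (4 * e ^+ 3 - 3 / 16 * e)).
  have -> : t2 = 16 / 9 * ((p ^+ 2 + q ^+ 2) ^+ 3 + (p' ^+ 2 + q' ^+ 2) ^+ 3
      - 2 * (e ^+ 3 - 3 * e * (p' * q - p * q') ^+ 2)).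
    by rewrite /t2 eX eY eX' eY' /e; field.
  have -> : (p' * q - p * q') ^+ 2 = 16^-1 - e ^+ 2 by rewrite -ef; ring.
  by rewrite pq pq'; field.
have {}t2E : t2 = s2 - 8 / 3 * s2 ^+ 2 + 16 / 9 * s2 ^+ 3 by rewrite t2E s2E; field.
have s0 : 0 <= s2 by rewrite addr_ge0 ?sqr_ge0.
have t0 : 0 <= t2 by rewrite addr_ge0 ?sqr_ge0.
have e4 : - 4^-1 <= e.
  have : `|e| <= 4^-1; last by rewrite ler_norml => /andP[].
  rewrite -(@ler_pXn2r _ 2) ?nnegrE ?invr_ge0//.
  rewrite real_normK ?num_real//; have := sqr_ge0 (p' * q - p * q').
  have -> : 4^-1 ^+ 2 = 16^-1 :> R by field.
  by rewrite -ef; lra.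
have s1 : s2 <= 1 by rewrite s2E; lra.
have -> : sqnorm4 (p' + X' - (p + X)) (Y' - q' - (Y - q)) (q' + Y' - (q + Y))
    (p' - X' - (p - X)) = 2 * (s2 + t2) by rewrite /sqnorm4 /s2 /t2; ring.
have -> : (p' - X' - (p - X)) * (p' + X' - (p + X)) -
    (q' + Y' - (q + Y)) * (Y' - q' - (Y - q)) = s2 - t2 by rewrite /s2 /t2; ring.
have ts : t2 <= s2.
  rewrite t2E; have -> : s2 - 8 / 3 * s2 ^+ 2 + 16 / 9 * s2 ^+ 3 =
    s2 - s2 ^+ 2 * (8 / 3 - 16 / 9 * s2) by ring.
  by rewrite lerBlDr lerDl mulr_ge0 ?sqr_ge0//; lra.
apply: (@le_trans _ _ ((4 * s2) ^+ 2)).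
  by rewrite ler_pXn2r ?nnegrE//; lra.
have -> : 18 * (s2 - t2) = (4 * s2) ^+ 2 + s2 ^+ 2 * (32 * (1 - s2)) by rewrite t2E; field.
by rewrite lerDl mulr_ge0 ?sqr_ge0//; lra.
Qed.

Lemma young_quartic (a b : R) : 0 <= a -> 0 <= b -> 4 * (a * b ^+ 3) <= a ^+ 4 + 3 * b ^+ 4.
Proof.
move=> a0 b0; rewrite -subr_ge0.
have -> : a ^+ 4 + 3 * b ^+ 4 - 4 * (a * b ^+ 3) =
  (a - b) ^+ 2 * ((a + b) ^+ 2 + 2 * b ^+ 2) by ring.
by rewrite mulr_ge0 ?sqr_ge0// addr_ge0 ?sqr_ge0// mulr_ge0 ?sqr_ge0.
Qed.

End algebra.

(** Here [T ^+ 3] bounds w, [C0 * eta ^+ 3] the derivative of the cut-off, and [S] the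
    squared norm of Dw. The factor 1/36 is half of the 1/18 of [belt_det], which allows
    the term with [S] to be absorbed. *)
Lemma pointwise_young (R : rcfType) (C0 eta T S h1 h2 : R) :
  0 <= C0 -> 0 <= eta <= 1 -> 0 <= T -> h1 ^+ 2 + h2 ^+ 2 <= S ->
  T ^+ 3 * (C0 * eta ^+ 3) * (`|h1| + `|h2|) <=
    36^-1 * (eta ^+ 4 * S ^+ 2) + (18 * C0 + 1) ^+ 4 / 12 * T ^+ 4.
Proof.
move=> C00 /andP[e0 e1] T0 hS; pose n := Num.sqrt S.
have S0 : 0 <= S by apply: le_trans hS; rewrite addr_ge0 ?sqr_ge0.
have n0 : 0 <= n by exact: sqrtr_ge0.
have nS : n ^+ 2 = S by exact: sqr_sqrtr.
have le_n h : h ^+ 2 <= S -> `|h| <= n.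
  by move=> hs; rewrite -(@ler_pXn2r _ 2) ?nnegrE// real_normK ?num_real// nS.
have h1n : `|h1| <= n by apply: le_n; apply: le_trans hS; rewrite lerDl sqr_ge0.
have h2n : `|h2| <= n by apply: le_n; apply: le_trans hS; rewrite lerDr sqr_ge0.
(* The summand 1 ensures [1 <= mu], so that [18 * C0 <= mu ^+ 3]. *)
set mu := 18 * C0 + 1.
have mu1 : 1 <= mu by rewrite /mu; lra.
have mu0 : 0 <= mu by exact: le_trans mu1.
have Y := young_quartic (mulr_ge0 e0 n0) (mulr_ge0 mu0 T0).
apply: (@le_trans _ _ (T ^+ 3 * (C0 * eta) * (n + n))).
  apply: ler_pM; rewrite ?addr_ge0//; first by rewrite !mulr_ge0// exprn_ge0.
    apply: ler_wpM2l; first exact: exprn_ge0.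
    by apply: ler_wpM2l => //; rewrite -[leRHS]expr1 ler_wiXn2l.
  exact: lerD.
have -> : 36^-1 * (eta ^+ 4 * S ^+ 2) + mu ^+ 4 / 12 * T ^+ 4 =
    36^-1 * ((eta * n) ^+ 4 + 3 * (mu * T) ^+ 4) by rewrite -nS; field.
apply: (@le_trans _ _ (36^-1 * (4 * (eta * n * (mu * T) ^+ 3)))); last first.
  by rewrite ler_wpM2l// invr_ge0; lra.
have -> : T ^+ 3 * (C0 * eta) * (n + n) = (18 * C0) * (9^-1 * (eta * n * T ^+ 3)) by field.
have -> : 36^-1 * (4 * (eta * n * (mu * T) ^+ 3)) = mu ^+ 3 * (9^-1 * (eta * n * T ^+ 3)) by field.
apply: ler_wpM2r; first by rewrite !mulr_ge0 ?exprn_ge0// invr_ge0; lra.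
apply: (@le_trans _ _ mu); first by rewrite /mu; lra.
by rewrite -[leLHS]expr1 ler_weXn2l.
Qed.

(** * The translation estimate on a box *)

Section local_estimate.
Context (R : realType).
Local Notation P := (plane R).
Implicit Types (f g h w : plane R -> R).

Lemma mollify_shiftB d f (x y : P) : 0 < d -> bddm f ->
  mollify d (fun u => f (u + y) - f u) x = mollify d f (x + y) - mollify d f x.
Proof.
move=> d0 bf; have bfy := bddm_shift y bf.
rewrite [X in X - _]mollifyE// [mollify d f x]mollifyE// mollifyE//; last exact: bddmB.
rewrite -RintB; last 2 first.
- by apply: tameMr; [have := bddm_shift (x + y) bf; under eq_fun do rewrite addrC|exact: tame_kern].
- by apply: tameMr; [have := bddm_shift x bf; under eq_fun do rewrite addrC|exact: tame_kern].
by apply: eq_Rint => s; rewrite -mulrBl -!addrA [s + y]addrC.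
Qed.

Lemma mollify_L1 k g (e : R) : 0 <= k -> bddm g -> 0 < e ->
  exists2 delta0, 0 < delta0 <= 1 & forall delta, 0 < delta <= delta0 ->
    \int[area2 R]_x (\1_(box k) x * `|mollify delta g x - g x|) <= e.
Proof.
move=> k0 bg e0; have [d0 d01 H] := mollify_small k0 bg e0.
exists d0 => // d dd; apply: le_trans (H d dd); rewrite le_eqVlt; apply/orP; left.
by apply/eqP; apply: eq_Rint => x; rewrite normrM ger0_norm.
Qed.

Definition plateau (r t : R) : R := cutoff (t / (2 * r)).

Lemma plateau_test1 r : 0 < r -> test1 (2 * r) (plateau r).
Proof. by move=> r0; apply: cutoff_scaled_test1; rewrite mulr_gt0. Qed.

Lemma plateau_bound r t : 0 <= plateau r t <= 1.
Proof. exact: cutoff_bound. Qed.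

Lemma plateau4_test1 r : 0 < r -> test1 (2 * r) (fun t => plateau r t ^+ 4).
Proof.
move=> r0; have te := plateau_test1 r0; have [se _] := te.
have := test1M te (smoothX 3 se).
by under eq_fun do rewrite -exprS.
Qed.

Lemma plateau4_derive r : 0 < r -> (fun t => plateau r t ^+ 4)^`()%classic =
  (fun t => 4 * plateau r t ^+ 3 * (plateau r)^`()%classic t).
Proof.
move=> r0; have [se _] := plateau_test1 r0; apply: is_derive_eta => t.
have := is_deriveX 4 (smooth_derive t se).
rewrite (_ : (fun t => plateau r t ^+ 4) = plateau r ^+ 4); last first.
  by apply/funext => s; rewrite exprfctE.
by [].
Qed.

(** The derivative of a fourth power carries the third power as a factor, and that is the
    power of the cut-off which Young's inequality absorbs. *)
Lemma tensor_plateau4_derive r : 0 < r -> exists2 C0, 0 <= C0 & forall x : P,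
  `|tensor (fun t => plateau r t ^+ 4)^`()%classic (fun t => plateau r t ^+ 4) x| <=
     C0 * tensor (plateau r) (plateau r) x ^+ 3 /\
  `|tensor (fun t => plateau r t ^+ 4) (fun t => plateau r t ^+ 4)^`()%classic x| <=
     C0 * tensor (plateau r) (plateau r) x ^+ 3.
Proof.
move=> r0; have [C1 dC] := test1_bounded (test1_derive (plateau_test1 r0)).
have C10 : 0 <= C1 by apply: le_trans (dC 0).
exists (4 * C1); first by rewrite mulr_ge0.
have H s t : `|4 * plateau r s ^+ 3 * (plateau r)^`()%classic s * plateau r t ^+ 4| <=
    4 * C1 * (plateau r s * plateau r t) ^+ 3.
  have /andP[s0 s1] := plateau_bound r s; have /andP[t0 t1] := plateau_bound r t.
  have p3 : 0 <= 4 * plateau r s ^+ 3 by rewrite mulr_ge0 ?exprn_ge0.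
  have p4 : 0 <= plateau r t ^+ 4 by exact: exprn_ge0.
  rewrite (normrM _ (plateau r t ^+ 4)) (normrM (4 * _)) (ger0_norm p3) (ger0_norm p4).
  have -> : 4 * C1 * (plateau r s * plateau r t) ^+ 3 =
    4 * plateau r s ^+ 3 * C1 * plateau r t ^+ 3 by ring.
  apply: ler_pM; [by rewrite mulr_ge0|exact: p4| |exact: ler_wiXn2l].
  exact: ler_wpM2l.
move=> x; rewrite plateau4_derive// /tensor; split; first exact: H.
by rewrite mulrC [plateau r x.1 * _]mulrC; exact: H.
Qed.

Lemma plateau_ge r t : 0 < r -> `|t| <= r -> cutoff_min R <= plateau r t.
Proof.
move=> r0 tr; apply: cutoff_ge; have r2 : 0 < 2 * r by rewrite mulr_gt0.
rewrite normrM normfV (gtr0_norm r2) ler_pdivrMr//.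
by apply: le_trans tr _; rewrite mulrA mulVf// mul1r.
Qed.

(** The squared norm of the increment of the gradient, |Dw|^2. *)
Definition sqdiff (g00 g01 g10 g11 : P -> R) (y x : P) : R :=
  sqnorm4 (g00 (x + y) - g00 x) (g01 (x + y) - g01 x)
          (g10 (x + y) - g10 x) (g11 (x + y) - g11 x).

Lemma bddm_sqdiff g00 g01 g10 g11 (y : P) :
  bddm g00 -> bddm g01 -> bddm g10 -> bddm g11 ->
  bddm (fun x => sqdiff g00 g01 g10 g11 y x ^+ 2).
Proof.
move=> b00 b01 b10 b11; apply: bddmX; rewrite /sqdiff /sqnorm4.
have H g : bddm g -> bddm (fun x : P => (g (x + y) - g x) ^+ 2).
  by move=> bg; apply: bddmX; apply: bddmB => //; exact: bddm_shift.
by apply: bddmD; [apply: bddmD; [apply: bddmD|]|]; exact: H.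
Qed.

Section fixed_translation.
Variables (r : R) (f0 f1 g00 g01 g10 g11 : P -> R) (y : P) (C0 : R).
Hypotheses (r0 : 0 < r) (bf0 : bddm f0) (bf1 : bddm f1).
Hypotheses (b00 : bddm g00) (b01 : bddm g01) (b10 : bddm g10) (b11 : bddm g11).
Hypothesis gbelt : forall x, belt (g00 x) (g01 x) (g10 x) (g11 x).
Hypotheses (wf0 : wgrad (4 * r) f0 g00 g01) (wf1 : wgrad (4 * r) f1 g10 g11).
Hypotheses (y1 : `|y.1| <= r) (y2 : `|y.2| <= r).
Let al t := plateau r t ^+ 4.
Let et : P -> R := tensor (plateau r) (plateau r).
Hypothesis C00 : 0 <= C0.
Hypothesis etC : forall x : P,
  `|tensor al^`()%classic al x| <= C0 * et x ^+ 3 /\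
  `|tensor al al^`()%classic x| <= C0 * et x ^+ 3.

Let D g (x : P) := g (x + y) - g x.
Let bD g : bddm g -> bddm (D g).
Proof. by move=> bg; apply: bddmB => //; exact: bddm_shift. Qed.
Let S := sqdiff g00 g01 g10 g11 y.
Let Y : R := `|y.1| + `|y.2|.
(* [Y] bounds w by the Lipschitz estimate, and [T] is its cube root: [T ^+ 4] is the power
   4/3 of [Y]. *)
Let T : R := Y `^ 3^-1.
Let K : R := (18 * C0 + 1) ^+ 4 / 12 * T ^+ 4.
Let tal : test1 (2 * r) al. Proof. exact: plateau4_test1. Qed.
Let tet : tame (area2 R) et.
Proof. by apply: tame_tensor; exact: plateau_test1. Qed.

Let g_le1 x : [/\ `|g00 x| <= 1, `|g01 x| <= 1, `|g10 x| <= 1 & `|g11 x| <= 1].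
Proof. exact: belt_bound. Qed.

Let T0 : 0 <= T. Proof. exact: powR_ge0. Qed.

Let T3 : T ^+ 3 = Y.
Proof.
have Y0 : 0 <= Y by exact: addr_ge0.
by rewrite -powR_mulrn// -powRrM mulVf// powRr1.
Qed.

Let wD g g' g'' : bddm g -> bddm g' -> bddm g'' -> wgrad (4 * r) g g' g'' ->
  wgrad (3 * r) (D g) (D g') (D g'').
Proof.
move=> bg bg' bg'' wg.
have e : 4 * r - r = 3 * r by ring.
have r34 : 3 * r <= 4 * r.
    apply: ler_wpM2r; first exact: ltW.
    by rewrite ler_nat.
have := wgrad_shift bg bg' bg'' y1 y2 wg; rewrite e => wgy.
by apply: wgradB => //; [exact: bddm_shift..|exact: wgradW wg].
Qed.

Let alE x : tensor al al x = et x ^+ 4.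
Proof. by rewrite /et /tensor exprMn. Qed.

Let outal (x : P) : ~ box (2 * r) x -> et x = 0.
Proof. by move=> xr; have te := plateau_test1 r0; rewrite /et (tensor_out te te). Qed.

(** The null Lagrangian against the mollified difference, estimated by the Lipschitz
    bound on [f0] and Young's inequality. *)
Let rhs_bound (d : R) : 0 < d -> d <= r ->
  \int[area2 R]_x (tensor al al x *
     (D g11 x * mollify d (D g00) x - D g10 x * mollify d (D g01) x)) <=
  36^-1 * \int[area2 R]_x (et x ^+ 4 * S x ^+ 2) + K * \int[area2 R]_x \1_(box (2 * r)) x.
Proof.
move=> d0 dr.
have h2r : 2 * r + d <= 3 * r by apply: (@le_trans _ _ (2 * r + r)); rewrite ?lerD2l//; lra.
rewrite (null_lagrangian_mollify d0 h2r tal tal (bD bf0) (bD b00) (bD b01)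
  (bD b10) (bD b11) (wD bf0 b00 b01 wf0) (wD bf1 b10 b11 wf1)).
have tal' := test1_derive tal.
have tS : tame (area2 R) (fun x => et x ^+ 4 * S x ^+ 2).
  apply: tameMl; last exact: bddm_sqdiff.
  by under eq_fun do rewrite -alE; exact: tame_tensor tal tal.
have tb := tame_box (R := R) (2 * r).
have tL : tame (area2 R) (fun x => (tensor al^`()%classic al x * D g11 x -
    tensor al al^`()%classic x * D g10 x) * mollify d (D f0) x).
  have h1 := @tame_mul_convk R (2 * r) d (fun x => tensor al^`()%classic al x * D g11 x -
    tensor al al^`()%classic x * D g10 x) (D f0) _ _ (moll_test1 d0) (moll_test1 d0) (bD bf0).
  apply: h1.
    by apply: bddmB; apply: bddmM; rewrite ?bD//;
      [exact: bddm_tensor tal' tal|exact: bD|exact: bddm_tensor tal tal'|exact: bD].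
  by move=> x xr; rewrite (tensor_out tal' tal xr) (tensor_out tal tal' xr) !mul0r subrr.
rewrite -(RintN tL) -(RintZ 36^-1 tS) -(RintZ K tb) -RintD; last 2 first.
- by apply: tameMr => //; exact: bddm_cst.
- by apply: tameMr => //; exact: bddm_cst.
apply: le_Rint => [||x].
- exact: tameN.
- by apply: tameD; apply: tameMr => //; exact: bddm_cst.
have [xr|xr] := pselect (box (2 * r) x); last first.
  rewrite (tensor_out tal' tal xr) (tensor_out tal tal' xr) outal// !mul0r subrr mul0r oppr0.
  by rewrite expr0n/= mul0r mulr0 add0r indicE memNset// mulr0.
rewrite [in leRHS]indicE mem_set// mulr1.
have Wb : `|mollify d (D f0) x| <= Y.
  rewrite /D mollify_shiftB// -[Y]mul1r.
  apply: (mollify_lipschitz d0 bf0 b00 b01 wf0).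
  - by move=> z; have [] := g_le1 z.
  - by move=> z; have [] := g_le1 z.
  - case: xr => /=; rewrite !in_itv/= -!ler_norml => x1 x2.
    have h : 2 * r <= 4 * r - d by lra.
    by split; rewrite /= in_itv/= -ler_norml; apply: le_trans h.
  - case: xr => /=; rewrite !in_itv/= -!ler_norml => x1 x2.
    have h : 2 * r + r <= 4 * r - d by lra.
    by split; rewrite /= in_itv/= -ler_norml; apply: le_trans h;
      rewrite (le_trans (ler_normD _ _))// lerD.
have [e1 e2] := etC x.
apply: (@le_trans _ _ (T ^+ 3 * (C0 * et x ^+ 3) * (`|D g11 x| + `|D g10 x|))).
  apply: le_trans (ler_norm _) _; rewrite normrN normrM T3 mulrC -mulrA.
  apply: ler_pM => //; rewrite [leRHS]mulrDr.
  apply: le_trans (ler_normB _ _) _; apply: lerD.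
    by rewrite (normrM (tensor al^`()%classic al x) (D g11 x)) ler_wpM2r.
  by rewrite (normrM (tensor al al^`()%classic x) (D g10 x)) ler_wpM2r.
apply: pointwise_young => //.
  have /andP[a0 a1] := plateau_bound r x.1; have /andP[c0 c1] := plateau_bound r x.2.
  by rewrite /et /tensor mulr_ge0//= mulr_ile1.
rewrite /S /sqdiff /sqnorm4 -/(D g00 x) -/(D g01 x) -/(D g10 x) -/(D g11 x).
by have := sqr_ge0 (D g00 x); have := sqr_ge0 (D g01 x); lra.
Qed.

(** The determinant dominates |Dw|^4 and differs from its mollified version by at most [e]
    in integral; half of the left-hand side is absorbed through [rhs_bound]. *)
Let weighted :
  \int[area2 R]_x (et x ^+ 4 * S x ^+ 2) <= 36 * (K * \int[area2 R]_x \1_(box (2 * r)) x).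
Proof.
set A := \int[area2 R]_x (et x ^+ 4 * S x ^+ 2).
set B := K * _.
have tetal : tame (area2 R) (tensor al al) by exact: tame_tensor tal tal.
have tS : tame (area2 R) (fun x => et x ^+ 4 * S x ^+ 2).
  apply: tameMl; last exact: bddm_sqdiff.
  by under eq_fun do rewrite -alE.
pose Dt x := D g11 x * D g00 x - D g10 x * D g01 x.
have bDt : bddm Dt by apply: bddmB; apply: bddmM; exact: bD.
have tDt : tame (area2 R) (fun x => tensor al al x * Dt x) by exact: tameMl.
have A_det : 18^-1 * A <= \int[area2 R]_x (tensor al al x * Dt x).
  rewrite -RintZ//; apply: le_Rint => //; first by apply: tameMr => //; exact: bddm_cst.
  move=> x; rewrite alE mulrCA ler_wpM2l//; last first.
    by rewrite ler_pdivrMl; [exact: belt_det|lra].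
  have /andP[a0 _] := plateau_bound r x.1; have /andP[c0 _] := plateau_bound r x.2.
  by rewrite exprn_ge0// mulr_ge0.
suff H e : 0 < e -> 18^-1 * A <= 36^-1 * A + B + e.
  have : 18^-1 * A <= 36^-1 * A + B by apply/ler_addgt0Pr => e; exact: H.
  by move: A B {A_det H} => A B; lra.
move=> e0; have e4 : 0 < e / 4 by rewrite divr_gt0.
have r20 : 0 <= 2 * r by rewrite mulr_ge0// ltW.
have [d1 /andP[d10 _] H1] := mollify_L1 r20 (bD b00) e4.
have [d2 /andP[d20 _] H2] := mollify_L1 r20 (bD b01) e4.
pose d := Num.min r (Num.min d1 d2).
have d0 : 0 < d by rewrite !lt_min r0 d10 d20.
have dr : d <= r by rewrite ge_min lexx.
have dd1 : 0 < d <= d1 by rewrite d0 !ge_min lexx !orbT.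
have dd2 : 0 < d <= d2 by rewrite d0 !ge_min lexx !orbT.
have {}H1 := H1 d dd1; have {}H2 := H2 d dd2.
have tm g : bddm g -> tame (area2 R) (fun x : P => \1_(box (2 * r)) x * `|mollify d g x - g x|).
  move=> bg; have := tame_norm (tame_mollify (2 * r) d0 bg).
  by under eq_fun do rewrite normrM ger0_norm//.
have tM g h : bddm g -> bddm h -> tame (area2 R) (fun x => tensor al al x * (h x * mollify d g x)).
  move=> bg bh; under eq_fun do rewrite mulrA.
  apply: (@tame_mul_convk R (2 * r) d _ g _ _ (moll_test1 d0) (moll_test1 d0) bg).
    by apply: bddmM => //; exact: tame_bddm tetal.
  by move=> x xr; rewrite (tensor_out tal tal xr) mul0r.
apply: (le_trans A_det).
have step : \int[area2 R]_x (tensor al al x * Dt x) <=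
   \int[area2 R]_x (tensor al al x *
     (D g11 x * mollify d (D g00) x - D g10 x * mollify d (D g01) x)) +
   (2 * \int[area2 R]_x (\1_(box (2 * r)) x * `|mollify d (D g00) x - D g00 x|) +
    2 * \int[area2 R]_x (\1_(box (2 * r)) x * `|mollify d (D g01) x - D g01 x|)).
  have t1 : tame (area2 R) (fun x => tensor al al x *
     (D g11 x * mollify d (D g00) x - D g10 x * mollify d (D g01) x)).
    by under eq_fun do rewrite mulrBr; apply: tameB; apply: tM; exact: bD.
  have t2 := tm _ (bD b00); have t3 := tm _ (bD b01).
  rewrite -(RintZ 2 t2) -(RintZ 2 t3).
  have t2' : tame (area2 R) (fun x => 2 * (\1_(box (2 * r)) x * `|mollify d (D g00) x - D g00 x|)).
    by apply: tameMr => //; exact: bddm_cst.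
  have t3' : tame (area2 R) (fun x => 2 * (\1_(box (2 * r)) x * `|mollify d (D g01) x - D g01 x|)).
    by apply: tameMr => //; exact: bddm_cst.
  rewrite -(RintD t2' t3') -(RintD t1 (tameD t2' t3')).
  apply: le_Rint => //; first by apply: tameD => //; exact: tameD.
  move=> x; have [xr|xr] := pselect (box (2 * r) x); last first.
    by rewrite alE outal// expr0n/= !mul0r indicE memNset// !mul0r !mulr0 !addr0.
  rewrite indicE mem_set// !mul1r alE.
  have /andP[a0 a1] := plateau_bound r x.1; have /andP[c0 c1] := plateau_bound r x.2.
  have z0 : 0 <= et x ^+ 4 by rewrite exprn_ge0// mulr_ge0.
  have z1 : et x ^+ 4 <= 1 by apply: exprn_ile1; [exact: mulr_ge0|exact: mulr_ile1].
  have D2 g : (forall z, `|g z| <= 1) -> `|D g x| <= 2.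
    by move=> g1; rewrite (le_trans (ler_normB _ _))// (_ : 2 = 1 + 1)// lerD.
  have D11 : `|D g11 x| <= 2 by apply: D2 => z; have [] := g_le1 z.
  have D10 : `|D g10 x| <= 2 by apply: D2 => z; have [] := g_le1 z.
  have B1 : et x ^+ 4 * (D g11 x * (D g00 x - mollify d (D g00) x)) <=
      2 * `|mollify d (D g00) x - D g00 x|.
    apply: le_trans (ler_norm _) _; rewrite (normrM (et x ^+ 4)) (ger0_norm z0).
    rewrite (normrM (D g11 x)) (distrC (D g00 x)).
    apply: (@le_trans _ _ (1 * (2 * `|mollify d (D g00) x - D g00 x|))); last by rewrite mul1r.
    by apply: ler_pM => //; exact: ler_wpM2r.
  have B2 : et x ^+ 4 * (D g10 x * (mollify d (D g01) x - D g01 x)) <=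
      2 * `|mollify d (D g01) x - D g01 x|.
    apply: le_trans (ler_norm _) _; rewrite (normrM (et x ^+ 4)) (ger0_norm z0).
    rewrite (normrM (D g10 x)).
    apply: (@le_trans _ _ (1 * (2 * `|mollify d (D g01) x - D g01 x|))); last by rewrite mul1r.
    by apply: ler_pM => //; exact: ler_wpM2r.
  apply: le_trans (lerD (lexx _) (lerD B1 B2)).
  by rewrite le_eqVlt; apply/orP; left; apply/eqP; rewrite /Dt; ring.
apply: le_trans step _; have := rhs_bound d0 dr; rewrite -/A -/B.
move: H1 H2; set I1 := Rintegral _ _ _; set I2 := Rintegral _ _ _; set I3 := Rintegral _ _ _.
by move: I1 I2 I3 A B {A_det} => I1 I2 I3 A B; lra.
Qed.

(** On [box r] the cut-off is at least [cutoff_min R ^+ 2], so that its fourth power is at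
    least [cutoff_min R ^+ 8]. *)
Lemma translation_estimate :
  \int[area2 R]_x (\1_(box r) x * S x ^+ 2) <=
  36 * ((18 * C0 + 1) ^+ 4 / 12 * \int[area2 R]_x \1_(box (2 * r)) x) /
    (cutoff_min R ^+ 8) * Y `^ (4 / 3).
Proof.
have cm0 := cutoff_min_gt0 R.
have -> : Y `^ (4 / 3) = T ^+ 4.
  by rewrite -powR_mulrn// -powRrM mulrC.
have tS : tame (area2 R) (fun x => et x ^+ 4 * S x ^+ 2).
  apply: tameMl; last exact: bddm_sqdiff.
  by under eq_fun do rewrite -alE; exact: tame_tensor tal tal.
apply: (@le_trans _ _ ((cutoff_min R ^+ 8)^-1 * \int[area2 R]_x (et x ^+ 4 * S x ^+ 2))).
  rewrite -RintZ//; apply: le_Rint.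
  - by apply: tameMl; [exact: tame_box|exact: bddm_sqdiff].
  - by apply: tameMr => //; exact: bddm_cst.
  move=> x; rewrite mulrA ler_wpM2r//; first by rewrite exprn_even_ge0.
  rewrite ler_pdivlMl ?exprn_gt0//.
  have [a0 _] := andP (plateau_bound r x.1); have [c0 _] := andP (plateau_bound r x.2).
  have [xr|xr] := pselect (box r x); last first.
    by rewrite indicE memNset// mulr0 exprn_ge0// mulr_ge0.
  rewrite indicE mem_set// mulr1 (_ : 8 = 2 * 4)%N// exprM.
  case: xr => /=; rewrite !in_itv/= -!ler_norml => x1 x2.
  have c2 : 0 <= cutoff_min R ^+ 2 by rewrite exprn_ge0// ltW.
  have ce : cutoff_min R ^+ 2 <= et x.
    by rewrite expr2; apply: ler_pM; [exact: ltW|exact: ltW|exact: plateau_ge|exact: plateau_ge].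
  by apply: lerXn2r => //; rewrite nnegrE// (le_trans c2).
have := weighted; set A := \int[area2 R]_x (et x ^+ 4 * _); rewrite /K => h.
apply: (@le_trans _ _ ((cutoff_min R ^+ 8)^-1 *
  (36 * ((18 * C0 + 1) ^+ 4 / 12 * T ^+ 4 * \int[area2 R]_x \1_(box (2 * r)) x)))).
  by rewrite ler_wpM2l// invr_ge0 exprn_ge0// ltW.
by rewrite le_eqVlt; apply/orP; left; apply/eqP; ring.
Qed.

End fixed_translation.

End local_estimate.

(** * From the Beltrami system to bounded representatives *)

Section beltrami_real.
Context (R : realType).

Lemma d_zE (A : 'M[R]_2) :
  d_z A = Complex ((A 0 0 + A 1 1) / 2) ((A 1 0 - A 0 1) / 2).
Proof.
have e : (2^-1 : R[i]) = Complex (2^-1) 0.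
  by rewrite -[RHS]/(real_complex R 2^-1) fmorphV rmorph_nat.
by rewrite /d_z /dcol e; apply/eqP; rewrite eq_complex /=; apply/andP; split; apply/eqP; field.
Qed.

Lemma d_zbarE (A : 'M[R]_2) :
  d_zbar A = Complex ((A 0 0 - A 1 1) / 2) ((A 1 0 + A 0 1) / 2).
Proof.
have e : (2^-1 : R[i]) = Complex (2^-1) 0.
  by rewrite -[RHS]/(real_complex R 2^-1) fmorphV rmorph_nat.
by rewrite /d_zbar /dcol e; apply/eqP; rewrite eq_complex /=; apply/andP; split; apply/eqP; field.
Qed.

Lemma beltrami_belt (A : 'M[R]_2) :
  d_zbar A = 4 / 3 * d_z A ^+ 3 -> `|d_z A| = 2^-1 ->
  belt (A 0 0) (A 0 1) (A 1 0) (A 1 1).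
Proof.
rewrite d_zE d_zbarE /belt.
set p := (A 0 0 + A 1 1) / 2; set q := (A 1 0 - A 0 1) / 2.
have e : (4 / 3 : R[i]) = Complex (4 / 3) 0.
  by rewrite -[RHS]/(real_complex R (4 / 3)) rmorphM fmorphV !rmorph_nat.
have e2 : (2^-1 : R[i]) = Complex (2^-1) 0.
  by rewrite -[RHS]/(real_complex R 2^-1) fmorphV rmorph_nat.
rewrite e e2 normc_def /=.
move=> h12 /eqP; rewrite eq_complex /= => /andP[/eqP h3 _].
have pq : p ^+ 2 + q ^+ 2 = 4^-1.
  rewrite -[LHS](@sqr_sqrtr _ (p ^+ 2 + q ^+ 2)); last by rewrite addr_ge0 ?sqr_ge0.
  by rewrite h3; field.
move: h12; rewrite !exprS !expr0 !mulr1.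
move=> /eqP; rewrite eq_complex /= => /andP[/eqP h1 /eqP h2].
split; [by rewrite -pq; ring|by rewrite h1; field|by rewrite h2; field].
Qed.

End beltrami_real.

Section bounded_representatives.
Context (R : realType).
Local Notation P := (plane R).
Implicit Types (f g : P -> R) (Omega : set P).

Lemma area2_setT_gt0 : (0 < area2 R setT)%E.
Proof.
apply: (@lt_le_trans _ _ (area2 R (box 1))).
  by rewrite area2_box// lte_fin exprn_gt0// mulrn_wgt0.
by apply: le_measure => //; rewrite inE//; exact: measurable_box.
Qed.

Lemma Lp_on_measurable Omega p f : Lp_on Omega p f -> measurable_fun setT (f \_ Omega).
Proof. by move=> /sub_Lfun_mfun; rewrite inE. Qed.

Lemma Linfty_ae_bounded Omega f : Lp_on Omega +oo%E f ->
  exists M : R, {ae area2 R, forall x, `|(f \_ Omega) x| <= M}.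
Proof.
move=> /sub_Lfun_finLfun; rewrite inE /= /finite_norm unlock /=.
rewrite ifT; last exact: area2_setT_gt0.
move=> h; have [M HM] := @ess_supr_bounded _ _ _ (area2 R) (fun x => `|(f \_ Omega) x|) h.
by exists M.
Qed.

(** An essentially bounded function is cut to 0 where it exceeds its essential bound. *)
Lemma bounded_representative Omega f : Lp_on Omega +oo%E f ->
  exists2 g, bddm g & {ae area2 R, forall x, (f \_ Omega) x = g x}.
Proof.
move=> Lf; have mF := Lp_on_measurable Lf; have [M HM] := Linfty_ae_bounded Lf.
set F := f \_ Omega in mF HM *.
have mA : measurable [set x | `|F x| <= M].
  rewrite -[X in measurable X]setTI.
  have mN : measurable_fun setT (fun x => `|F x|) by exact: measurableT_comp.
  rewrite (_ : [set x | _] = (fun x => `|F x|) @^-1` `]-oo, M]%classic); first exact: mN.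
  by apply/seteqP; split => x /=; rewrite in_itv.
exists (fun x => F x * \1_[set x | `|F x| <= M] x).
  split; first by apply: measurable_funM => //; exact: measurable_indic.
  exists `|M| => x; rewrite indicE; have [/set_mem h|_] := boolP (x \in _).
    by rewrite mulr1 (le_trans h)// ler_norm.
  by rewrite mulr0 normr0.
by apply: filterS HM => x h; rewrite indicE mem_set// mulr1.
Qed.

Lemma Rint_ae_eq f g : measurable_fun setT f -> measurable_fun setT g ->
  {ae area2 R, forall x, f x = g x} ->
  \int[area2 R]_x f x = \int[area2 R]_x g x.
Proof.
move=> mf mg fg; rewrite /Rintegral; congr fine.
apply: ae_eq_integral => //; try exact/measurable_EFinP.
by apply: filterS fg => x /= -> _.
Qed.

End bounded_representatives.

Section reduction.
Context (R : realType).
Local Notation P := (plane R).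
Variables (Omega : set P) (v : P -> R[i]) (Dv : P -> 'M[R]_2).
Hypothesis vW : W1oo Omega v Dv.
Hypothesis beltrami : {ae area R, forall z, Omega z ->
     d_zbar (Dv z) = 4 / 3 * d_z (Dv z) ^+ 3 /\ `|d_z (Dv z)| = 2^-1}.

(** The extension of [Dv] by zero is measurable on the whole plane. *)
Definition grad0 (k j : 'I_2) : P -> R := (fun z => Dv z k j) \_ Omega.

Lemma measurable_grad0 k j : measurable_fun setT (grad0 k j).
Proof. by have [_ H _] := vW; exact: Lp_on_measurable (H k j). Qed.

Lemma grad0_in k j z : Omega z -> grad0 k j z = Dv z k j.
Proof. by move=> Oz; rewrite /grad0 patchE mem_set. Qed.

Definition good : set P := [set z | belt (grad0 0 0 z) (grad0 0 1 z) (grad0 1 0 z) (grad0 1 1 z)].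

Lemma measurable_zero (h : P -> R) : measurable_fun setT h -> measurable [set z | h z = 0].
Proof.
move=> mh; rewrite -[X in measurable X]setTI.
by rewrite (_ : [set z | _] = h @^-1` [set 0])//; exact: mh.
Qed.

Lemma measurable_good : measurable good.
Proof.
pose p z := (grad0 0 0 z + grad0 1 1 z) / 2; pose q z := (grad0 1 0 z - grad0 0 1 z) / 2.
have mp : measurable_fun setT p.
  by apply: measurable_funM => //; apply: measurable_funD; exact: measurable_grad0.
have mq : measurable_fun setT q.
  by apply: measurable_funM => //; apply: measurable_funB; exact: measurable_grad0.
have mX : measurable_fun setT (fun z => (grad0 0 0 z - grad0 1 1 z) / 2).
  by apply: measurable_funM => //; apply: measurable_funB; exact: measurable_grad0.
have mY : measurable_fun setT (fun z => (grad0 1 0 z + grad0 0 1 z) / 2).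
  by apply: measurable_funM => //; apply: measurable_funD; exact: measurable_grad0.
rewrite (_ : good = [set z | p z ^+ 2 + q z ^+ 2 - 4^-1 = 0] `&`
  [set z | (grad0 0 0 z - grad0 1 1 z) / 2 - 4 / 3 * (p z ^+ 3 - 3 * p z * q z ^+ 2) = 0] `&`
  [set z | (grad0 1 0 z + grad0 0 1 z) / 2 - 4 / 3 * (3 * p z ^+ 2 * q z - q z ^+ 3) = 0]).
  have mpn n : measurable_fun setT (fun z => p z ^+ n) by exact: measurable_funX.
  have mqn n : measurable_fun setT (fun z => q z ^+ n) by exact: measurable_funX.
  apply: measurableI; first apply: measurableI; apply: measurable_zero.
  - by apply: measurable_funB => //; exact: measurable_funD.
  - apply: measurable_funB => //; apply: measurable_funM => //.
    apply: measurable_funB => //; apply: measurable_funM => //; exact: measurable_funM.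
  - apply: measurable_funB => //; apply: measurable_funM => //.
    apply: measurable_funB => //; apply: measurable_funM => //; exact: measurable_funM.
apply/seteqP; split => z /=; rewrite /good /belt /= -/(p z) -/(q z).
  by move=> [h1 h2 h3]; split; first split; apply/eqP; rewrite subr_eq0; apply/eqP.
by move=> [[/eqP + /eqP +] /eqP]; rewrite !subr_eq0 => /eqP h1 /eqP h2 /eqP h3; split.
Qed.

Lemma ae_good : {ae area2 R, forall z, Omega z -> good z}.
Proof.
apply: filterS beltrami => z H Oz; have [e1 e2] := H Oz.
by rewrite /good /= !grad0_in//; exact: beltrami_belt.
Qed.

(** The gradient, modified outside [good] so as to lie on the curve at every point: the
    constant diagonal matrix with entries 2/3 and 1/3 is the one with d_z = 1/2. *)
Definition belt_grad (k j : 'I_2) (z : P) : R :=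
  if z \in good then grad0 k j z else if k != j then 0 else if k == 0 then 2 / 3 else 3^-1.

Lemma belt_grad_good k j z : good z -> belt_grad k j z = grad0 k j z.
Proof. by move=> gz; rewrite /belt_grad mem_set. Qed.

Lemma belt_grad_belt z : belt (belt_grad 0 0 z) (belt_grad 0 1 z) (belt_grad 1 0 z) (belt_grad 1 1 z).
Proof.
rewrite /belt_grad; have [/set_mem //|_] := boolP (z \in good).
by rewrite /belt /=; split; field.
Qed.

Lemma bddm_belt_grad k j : bddm (belt_grad k j).
Proof.
split.
  pose c : R := if k != j then 0 else if k == 0 then 2 / 3 else 3^-1.
  rewrite (_ : belt_grad k j = fun z => grad0 k j z * \1_good z + c * (1 - \1_good z)).
    have mi : measurable_fun setT (\1_good : P -> R) by exact: measurable_indic measurable_good.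
    apply: measurable_funD; apply: measurable_funM => //; first exact: measurable_grad0.
    exact: measurable_funB.
  apply/funext => z; rewrite /belt_grad indicE; case: (z \in good).
    by rewrite mulr1 subrr mulr0 addr0.
  by rewrite mulr0 subr0 mulr1 add0r.
exists 1 => z; have [h00 h01 h10 h11] := belt_bound (belt_grad_belt z).
have H (i : 'I_2) : i = 0 \/ i = 1.
  by case: i => -[|[|//]] ?; [left|right]; exact: val_inj.
by case: (H k) => ->; case: (H j) => ->.
Qed.

(** The box is recentred at 0 because [wgrad] is stated there; [f] is a bounded
    representative of the two components of [v]. *)
Lemma weak_gradient : exists f : 'I_2 -> P -> R, (forall k, bddm (f k)) /\
  forall k (c : P) r, (forall x, box r x -> Omega (x + c)) ->
    wgrad r (fun x => f k (x + c)) (fun x => belt_grad k 0 (x + c)) (fun x => belt_grad k 1 (x + c)).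
Proof.
have [Lv LDv wp] := vW.
have /choice[f fP] : forall k, exists g, bddm g /\
    {ae area2 R, forall x, ((fun z => cpart k (v z)) \_ Omega) x = g x}.
  by move=> k; have [g bg ge] := bounded_representative (Lv k); exists g.
exists f; split=> [k|k c r rO a b ta tb]; first by have [] := fP k.
have [bf fae] := fP k.
pose ac t := a (t - c.1); pose bc t := b (t - c.2).
have [sac a0] := test1_shift c.1 ta; have [sbc b0] := test1_shift c.2 tb.
have test := test_function_tensor ta tb rO.
have [d0 e0] := @partial0_tensor R ac bc sac.
have [d1 e1] := @partial1_tensor R ac bc sbc.
have out (x : P) : ~ Omega x -> ~ box r (x - c).
  by move=> Ox /rO; rewrite subrK.
have [sa _] := ta; have [sb _] := tb.
have ta' := test1_derive ta; have tb' := test1_derive tb.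
pose K := r + `|c.1| + `|c.2|.
have tW h (u : R) : `|u| <= `|c.1| + `|c.2| -> test1 r h -> test1 K (fun t => h (t - u)).
  by move=> us /(test1_shift u); apply: test1W; rewrite /K -addrA lerD2l.
have c1 : `|c.1| <= `|c.1| + `|c.2| by rewrite lerDl.
have c2 : `|c.2| <= `|c.1| + `|c.2| by rewrite lerDr.
(* Shifting back to the centre and replacing the representative almost everywhere. *)
have L (h : P -> R) (fh : P -> R) (p q : R -> R) : bddm fh -> test1 r p -> test1 r q ->
    measurable_fun setT (h \_ Omega) ->
    {ae area2 R, forall x, Omega x -> h x = fh x} ->
    \int[area R]_(x in Omega) (h x * tensor (fun t => p (t - c.1)) (fun t => q (t - c.2)) x) =
    \int[area2 R]_x (fh (x + c) * tensor p q x).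
  move=> bfh tp tq mh hae.
  pose ph := tensor (fun t => p (t - c.1)) (fun t => q (t - c.2)).
  have tph : tame (area2 R) ph by apply: (@tame_tensor _ K); exact: tW.
  have ph0 x : ~ Omega x -> ph x = 0.
    by move=> Ox; have := tensor_out tp tq (out x Ox).
  rewrite Rintegral_mkcond.
  transitivity (\int[area2 R]_x (fh x * ph x)).
    transitivity (\int[area2 R]_x ((h \_ Omega) x * ph x)).
      apply: eq_Rint => x; rewrite !patchE; case: ifPn => // _.
      by rewrite mul0r.
    apply: Rint_ae_eq.
    - by apply: measurable_funM => //; case: tph.
    - by apply: measurable_funM; [case: bfh|case: tph].
    apply: filterS hae => x hx; have [Ox|Ox] := pselect (Omega x).
      by rewrite patchE mem_set// hx.
    by rewrite ph0// !mulr0.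
  rewrite -(Rint_shift c); last exact: tameMr.
  by apply: eq_Rint => x; rewrite /ph /tensor /= !addrK.
have mf : measurable_fun setT ((fun z => cpart k (v z)) \_ Omega).
  exact: Lp_on_measurable (Lv k).
have faeO : {ae area2 R, forall x, Omega x -> cpart k (v x) = f k x}.
  by apply: filterS fae => x + Ox; rewrite patchE mem_set.
have gaeO j : {ae area2 R, forall x, Omega x -> Dv x k j = belt_grad k j x}.
  by apply: filterS ae_good => x gx Ox; rewrite belt_grad_good ?grad0_in//; exact: gx.
have w0 := wp k 0 _ test; have w1 := wp k 1 _ test.
rewrite -/ac -/bc in w0 w1.
rewrite e0 (derive1_shift c.1 sa) in w0; rewrite e1 (derive1_shift c.2 sb) in w1.
rewrite (L _ (f k)) // (L _ (belt_grad k 0)) // in w0; last 2 first.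
- exact: bddm_belt_grad.
- exact: measurable_grad0.
rewrite (L _ (f k)) // (L _ (belt_grad k 1)) // in w1; last 2 first.
- exact: bddm_belt_grad.
- exact: measurable_grad0.
Qed.

End reduction.

(** * Passage to compact subsets *)

Section plane_cover.
Variable R : realType.

(* The plane is a product of two aliases of [R], which hides its base point. *)
Let pointed_plane : ptopologicalType := HB.pack (R * R)%type.

Lemma plane_cover_compact (A : set (plane R)) : compact A -> @cover_compact (plane R) A.
Proof.
move=> cA; have : @cover_compact pointed_plane A; last by [].
by rewrite -compact_cover.
Qed.

End plane_cover.

Section compact_estimate.
Context (R : realType).
Local Notation P := (plane R).
Variables (Omega : set P) (f : 'I_2 -> P -> R) (g : 'I_2 -> 'I_2 -> P -> R).
Hypothesis Omega_open : open Omega.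
Hypothesis bf : forall k, bddm (f k).
Hypothesis bg : forall k j, bddm (g k j).
Hypothesis gbelt : forall z, belt (g 0 0 z) (g 0 1 z) (g 1 0 z) (g 1 1 z).
Hypothesis wg : forall k (c : P) r, (forall x, box r x -> Omega (x + c)) ->
  wgrad r (fun x => f k (x + c)) (fun x => g k 0 (x + c)) (fun x => g k 1 (x + c)).

Definition sqincr (y x : P) : R := sqdiff (g 0 0) (g 0 1) (g 1 0) (g 1 1) y x.

Lemma bddm_sqincr2 y : bddm (fun x => sqincr y x ^+ 2).
Proof. exact: bddm_sqdiff. Qed.

Lemma tame_box_sqincr (c : P) r y : tame (area2 R) (fun x : P => \1_(box r) (x - c) * sqincr y x ^+ 2).
Proof.
apply: tameMl; last exact: bddm_sqincr2.
by have := tame_shift (- c) (tame_box (R := R) r).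
Qed.

Lemma centered_estimate (c : P) r : 0 < r -> (forall x, box (4 * r) x -> Omega (x + c)) ->
  exists2 C, 0 <= C & forall y : P, `|y.1| <= r -> `|y.2| <= r ->
    \int[area2 R]_x (\1_(box r) (x - c) * sqincr y x ^+ 2) <= C * (`|y.1| + `|y.2|) `^ (4 / 3).
Proof.
move=> r0 rO; have [C0 C00 etC] := tensor_plateau4_derive r0.
exists (36 * ((18 * C0 + 1) ^+ 4 / 12 * \int[area2 R]_x \1_(box (2 * r)) x) /
    (cutoff_min R ^+ 8)).
  have I0 : 0 <= \int[area2 R]_x (\1_(box (2 * r)) x : R) by exact: ge0_Rint.
  have m0 := ltW (cutoff_min_gt0 R).
  apply: divr_ge0; last exact: exprn_ge0.
  apply: mulr_ge0 => //; apply: mulr_ge0 => //; apply: divr_ge0 => //.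
  by apply: exprn_ge0; rewrite addr_ge0// mulr_ge0.
move=> y y1 y2.
have bgc k j : bddm (fun x : P => g k j (x + c)) by exact: bddm_shift.
have := translation_estimate r0 (bddm_shift c (bf 0)) (bddm_shift c (bf 1)) (bgc 0 0) (bgc 0 1) (bgc 1 0) (bgc 1 1)
  (fun x => gbelt (x + c)) (wg 0 rO) (wg 1 rO) y1 y2 C00 etC.
rewrite -[X in X <= _ -> _](_ : \int[area2 R]_x (\1_(box r) (x - c) * sqincr y x ^+ 2) = _) //.
rewrite -(Rint_shift c); last exact: tame_box_sqincr.
apply: eq_Rint => x; rewrite addrK; congr (_ * _ ^+ 2).
by rewrite /sqincr /sqdiff !(addrAC x y c).
Qed.

Lemma small_box (c : P) : Omega c ->
  exists2 r, 0 < r & forall x, box (4 * r) x -> Omega (x + c).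
Proof.
move=> Oc; have /nbhs_ballP[e /= e0 eO] : nbhs c Omega by exact: open_nbhs_nbhs.
exists (e / 8); first by rewrite divr_gt0.
move=> x [/=]; rewrite !in_itv/= -!ler_norml => x1 x2; apply: eO.
have e4 : 4 * (e / 8) < e by lra.
split; rewrite /ball /=.
  by rewrite opprD addrCA subrr addr0 normrN (le_lt_trans x1).
by rewrite opprD addrCA subrr addr0 normrN (le_lt_trans x2).
Qed.

(** Each point is the centre of a box on which the translation estimate holds; finitely
    many of the boxes cover [A], and the constants add up. *)
Lemma compact_estimate (A : set P) : measurable A -> compactly_inside A Omega ->
  exists e0 C : R, [/\ 0 < e0, 0 <= C & forall y : P, `|y.1| <= e0 -> `|y.2| <= e0 ->
    \int[area2 R]_x (\1_A x * sqincr y x ^+ 2) <= C * (`|y.1| + `|y.2|) `^ (4 / 3)].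
Proof.
move=> mA [cA AO].
have /choice[rC rCP] : forall c : P, exists p : R * R, Omega c ->
    [/\ 0 < p.1, 0 <= p.2 & forall y : P, `|y.1| <= p.1 -> `|y.2| <= p.1 ->
    \int[area2 R]_x (\1_(box p.1) (x - c) * sqincr y x ^+ 2) <= p.2 * (`|y.1| + `|y.2|) `^ (4 / 3)].
  move=> c; have [Oc|Oc] := pselect (Omega c); last by exists (0, 0).
  have [r r0 rO] := small_box Oc; have [C C0 CP] := centered_estimate r0 rO.
  by exists (r, C).
pose U (c : P) := ball c (rC c).1.
have cov := plane_cover_compact cA.
have [D DO AD] : exists2 D : seq P, (forall c, c \in D -> Omega c) &
    forall x, A x -> exists2 c, c \in D & U c x.
  have [|x Ax|D' D'A AD'] := cov P (closure A) U.
  - move=> c Ac; have [r0 _ _] := rCP c (AO c Ac); exact: ball_open.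
  - exists x => //; have [r0 _ _] := rCP x (AO x Ax); exact: ballxx.
  exists (finmap.enum_fset D') => [c cD|x Ax].
    by apply: AO; have := D'A c cD; rewrite inE.
  by have [c /= cD xc] := AD' x (subset_closure Ax); exists c.
have tN (s : seq P) y :
    tame (area2 R) (fun x : P => (\sum_(c <- s) \1_(box (rC c).1) (x - c)) * sqincr y x ^+ 2).
  apply: tameMl; last exact: bddm_sqincr2.
  elim: s => [|c s IH].
    under eq_fun do rewrite big_nil; split=> //; exists 0, set0.
    by rewrite measure0; split => // x; rewrite normr0 mul0r.
  under eq_fun do rewrite big_cons; apply: tameD => //.
  by have := tame_shift (- c) (tame_box (R := R) (rC c).1).
have [e0 [C [e00 C0 CP]]] : exists e0 C : R, [/\ 0 < e0, 0 <= C &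
    forall y : P, `|y.1| <= e0 -> `|y.2| <= e0 ->
    \int[area2 R]_x ((\sum_(c <- D) \1_(box (rC c).1) (x - c)) * sqincr y x ^+ 2) <=
      C * (`|y.1| + `|y.2|) `^ (4 / 3)].
  elim: (D) DO => [_|c s IH sO].
    exists 1, 0; split=> // y _ _; under eq_Rint do rewrite big_nil mul0r.
    by rewrite /Rintegral integral0 mul0r.
  have [|e1 [C1 [e10 C10 C1P]]] := IH; first by move=> c' c's; apply: sO; rewrite inE c's orbT.
  have [r0 C20 C2P] := rCP c (sO c (mem_head _ _)).
  exists (Num.min e1 (rC c).1), ((rC c).2 + C1); split.
  - by rewrite lt_min e10.
  - exact: addr_ge0.
  move=> y; rewrite !le_min => /andP[y1 y1'] /andP[y2 y2'].
  rewrite mulrDl.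
  apply: le_trans (lerD (C2P y y1' y2') (C1P y y1 y2)).
  rewrite -RintD//; last exact: tame_box_sqincr.
  rewrite le_eqVlt; apply/orP; left; apply/eqP; apply: eq_Rint => x.
  by rewrite big_cons mulrDl.
exists e0, C; split=> // y y1 y2; apply: le_trans (CP y y1 y2).
have S0 x : 0 <= sqincr y x ^+ 2 by exact: sqr_ge0.
have leN x : \1_A x <= \sum_(c <- D) \1_(box (rC c).1) (x - c) :> R.
  rewrite indicE; have [/set_mem Ax|_] := boolP (x \in A); last exact: sumr_ge0.
  have [c cD xc] := AD x Ax.
  rewrite (big_rem c)//= indicE mem_set ?lerDl ?sumr_ge0//.
  by case: xc => x1 x2; split; rewrite /= in_itv/= -ler_norml distrC ltW.
have le1 x : \1_A x * sqincr y x ^+ 2 <=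
    (\sum_(c <- D) \1_(box (rC c).1) (x - c)) * sqincr y x ^+ 2 by exact: ler_wpM2r.
apply: le_Rint => //; apply: (tame_dom _ (tN D y)) => [|x].
  apply: measurable_funM; first exact: measurable_indic.
  by have [] := bddm_sqincr2 y.
have l0 : 0 <= \1_A x * sqincr y x ^+ 2 by exact: mulr_ge0.
by rewrite ger0_norm// ger0_norm// (le_trans l0).
Qed.

End compact_estimate.

(** * Euclidean geometry of the plane *)

Section geometry.
Context (R : realType).
Local Notation P := (plane R).
Implicit Types (A Omega : set P).

Lemma enorm_ge0 (x : P) : 0 <= enorm x.
Proof. exact: sqrtr_ge0. Qed.

Lemma enorm_sqr (x : P) : enorm x ^+ 2 = x.1 ^+ 2 + x.2 ^+ 2.
Proof. by rewrite /enorm sqr_sqrtr// addr_ge0 ?sqr_ge0. Qed.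

Lemma enorm_ge1 (x : P) : `|x.1| <= enorm x.
Proof.
rewrite -(@ler_pXn2r _ 2) ?nnegrE ?enorm_ge0// real_normK ?num_real// enorm_sqr.
by rewrite lerDl sqr_ge0.
Qed.

Lemma enorm_ge2 (x : P) : `|x.2| <= enorm x.
Proof.
rewrite -(@ler_pXn2r _ 2) ?nnegrE ?enorm_ge0// real_normK ?num_real// enorm_sqr.
by rewrite lerDr sqr_ge0.
Qed.

Lemma enormN (x : P) : enorm (- x) = enorm x.
Proof. by rewrite /enorm /= !sqrrN. Qed.

Lemma enorm0 : enorm (0 : P) = 0.
Proof. by rewrite /enorm /= expr0n addr0 sqrtr0. Qed.

Lemma enormZ (t : R) (x : P) : 0 <= t -> enorm (t * x.1, t * x.2) = t * enorm x.
Proof.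
move=> t0; rewrite /enorm /= !exprMn -mulrDr sqrtrM ?sqr_ge0//.
by rewrite sqrtr_sqr ger0_norm.
Qed.

Lemma measurable_enorm : measurable_fun setT (@enorm R).
Proof.
apply: (@measurableT_comp _ _ _ _ _ _ (@Num.sqrt R)).
  by apply: continuous_measurable_fun; exact: sqrt_continuous.
by apply: measurable_funD; apply: measurable_funX; [exact: measurable_fst|exact: measurable_snd].
Qed.

(** Otherwise the segment from [z] to [z + y] leaves [Omega], and does so at a boundary
    point, whose distance to [z] is at most |y| < eps. *)
Lemma translate_inside A Omega (eps : R) (z y : P) : open Omega -> A z -> Omega z ->
  enorm y < eps -> (eps%:E < (2^-1)%:E * edist_set A (boundary Omega))%E ->
  Omega (z + y).
Proof.
move=> oO Az Oz ye dist; apply: contrapT => nO.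
pose p (t : R) : P := z + (t * y.1, t * y.2).
have p1 : p 1 = z + y by rewrite /p !mul1r -surjective_pairing.
have p0 : p 0 = z by rewrite /p !mul0r -[RHS]addr0.
pose B := [set t : R | 0 <= t /\ ~ Omega (p t)].
have hB : has_inf B.
  split; first by exists 1; split; rewrite ?p1.
  by exists 0 => t [].
have lbB t : B t -> inf B <= t by move=> Bt; apply: ge_inf => //; case: hB.
have i0 : 0 <= inf B by apply: lb_le_inf => [|t []//]; case: hB.
have i1 : inf B <= 1 by apply: lbB; split; rewrite ?p1.
have ball_p s t e : `|s - t| * (`|y.1| + `|y.2| + 1) < e -> ball (p s) e (p t).
  move=> h; have st : 0 <= `|s - t| by [].
  split; rewrite /ball /= /p /= opprD addrACA subrr add0r -mulrBl normrM;
    apply: le_lt_trans h; rewrite ler_wpM2l//.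
    by rewrite -addrA lerDl addr_ge0.
  by rewrite (@le_trans _ _ (`|y.1| + `|y.2|)) ?lerDr ?lerDl.
have L0 : 0 < `|y.1| + `|y.2| + 1 by rewrite ltr_wpDl// addr_ge0.
have nOi : ~ Omega (p (inf B)).
  move=> Oi; have /nbhs_ballP[e /= e0 eO] : nbhs (p (inf B)) Omega by exact: open_nbhs_nbhs.
  have d0 : 0 < e / (`|y.1| + `|y.2| + 1) by rewrite divr_gt0.
  have [t [Bt tlt]] : exists t, B t /\ t < inf B + e / (`|y.1| + `|y.2| + 1).
    by have [t Bt tlt] := inf_adherent d0 hB; exists t.
  have [_ nOt] := Bt; apply: nOt; apply: eO; apply: ball_p.
  rewrite distrC ger0_norm ?subr_ge0 ?lbB//.
  by rewrite -ltr_pdivlMr// ltrBlDl.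
(* Just before the parameter [inf B] the segment is still inside [Omega]. *)
have bd : boundary Omega (p (inf B)).
  split; last by move=> /interior_subset.
  move=> V /nbhs_ballP[e /= e0 eV].
  have [ib|ib] := eqVneq (inf B) 0; first by rewrite ib p0 in nOi.
  have ip : 0 < inf B by rewrite lt_neqAle eq_sym ib.
  pose d := Num.min (inf B) (e / (`|y.1| + `|y.2| + 1) / 2).
  have d0 : 0 < d by rewrite lt_min ip !divr_gt0.
  exists (p (inf B - d)); split.
    apply: contrapT => nOd.
    have := lbB (inf B - d) (conj _ nOd); rewrite subr_ge0 ge_min lexx => /(_ isT).
    by rewrite lerBrDr gerDl leNgt d0.
  apply: eV; apply: ball_p; rewrite opprB addrCA subrr addr0 gtr0_norm//.
  apply: (@le_lt_trans _ _ (e / (`|y.1| + `|y.2| + 1) / 2 * (`|y.1| + `|y.2| + 1))).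
    by apply: ler_wpM2r; [exact: ltW|rewrite ge_min lexx orbT].
  by rewrite mulrAC divfK ?gt_eqF//; lra.
have le : (edist_set A (boundary Omega) <= (enorm y)%:E)%E.
  apply: ereal_inf_le; exists (enorm (z - p (inf B)))%:E; first by exists z => //; exists (p (inf B)).
  rewrite lee_fin /p opprD addrA subrr add0r enormN enormZ//.
  by rewrite ler_piMl// enorm_ge0.
have : ((2^-1)%:E * edist_set A (boundary Omega) <= (2^-1 * enorm y)%:E)%E.
  by rewrite EFinM; apply: lee_wpmul2l => //; rewrite lee_fin invr_ge0.
move=> h; have := lt_le_trans dist h; rewrite lte_fin.
have := enorm_ge0 y; lra.
Qed.

End geometry.

(** * Dyadic annuli *)

Section dyadic.
Context (R : realType).
Local Notation P := (plane R).
Variables (e0 C beta : R).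
Hypotheses (e00 : 0 < e0) (C0 : 0 <= C) (beta_lt : beta < 2 + 4 / 3).

Definition level (k : nat) : R := e0 * 2^-1 ^+ k.

(** On the annulus between the boxes of levels [k.+1] and [k], the translation estimate is
    largest at the outer and the weight [enorm h `^ (- beta)] at the inner radius. *)
Definition annulus_bound (k : nat) : R :=
  C * (2 * level k) `^ (4 / 3) * level k.+1 `^ (- beta).

Lemma level_gt0 k : 0 < level k.
Proof. by rewrite /level mulr_gt0// exprn_gt0// invr_gt0. Qed.

Lemma annulus_bound_ge0 k : 0 <= annulus_bound k.
Proof. by rewrite /annulus_bound !mulr_ge0// powR_ge0. Qed.

Lemma geometric_sum_le (q : R) n : 0 <= q -> q < 1 -> \sum_(0 <= k < n) q ^+ k <= (1 - q)^-1.
Proof.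
move=> q0 q1; have q1' : 0 < 1 - q by rewrite subr_gt0.
have e : (1 - q) * \sum_(0 <= k < n) q ^+ k = 1 - q ^+ n.
  elim: n => [|n IH]; first by rewrite big_geq// mulr0 expr0 subrr.
  by rewrite big_nat_recr//= mulrDr IH exprS; ring.
by rewrite -[leRHS]mulr1 ler_pdivlMl// e gerBl exprn_ge0.
Qed.

(** The ratio 2^(beta - 2 - 4/3) collects the area, the translation estimate and the
    weight; it is less than 1 precisely because beta < 2 + 4/3. *)
Lemma annulus_term k : annulus_bound k * (level k *+ 2) ^+ 2 =
  annulus_bound 0 * (level 0 *+ 2) ^+ 2 * (2^-1 `^ (2 + 4 / 3 - beta)) ^+ k.
Proof.
set t : R := 2^-1 ^+ k.
have t0 : 0 < t by rewrite exprn_gt0// invr_gt0.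
have lk : level k = level 0 * t by rewrite /level expr0 mulr1.
have lk1 : level k.+1 = level 1 * t by rewrite /level exprS expr1 mulrA.
have l0 j := ltW (level_gt0 j).
have -> : (2^-1 `^ (2 + 4 / 3 - beta)) ^+ k = t `^ (4 / 3) * t `^ (- beta) * t ^+ 2.
  rewrite -powR_mulrn; last exact: powR_ge0.
  rewrite powRAC powR_mulrn; last by rewrite invr_ge0.
  rewrite -/t -(powR_mulrn 2 (ltW t0)) -!powRD ?(gt_eqF t0) ?implybT//.
  by congr (_ `^ _); ring.
have e1 : (2 * level 0 * t) `^ (4 / 3) = (2 * level 0) `^ (4 / 3) * t `^ (4 / 3).
  by apply: powRM; [exact: mulr_ge0|exact: ltW].
have e2 : (level 1 * t) `^ (- beta) = level 1 `^ (- beta) * t `^ (- beta).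
  by apply: powRM => //; exact: ltW.
have e3 : (level 0 * t) *+ 2 = level 0 *+ 2 * t by rewrite mulrnAl.
rewrite /annulus_bound lk lk1 mulrA e1 e2 e3 exprMn.
by move: (_ `^ (4 / 3)) (t `^ _) (_ `^ (- beta)) (t `^ _) => u1 u2 u3 u4; ring.
Qed.

Lemma annulus_series :
  (\sum_(0 <= k <oo) (annulus_bound k * (level k *+ 2) ^+ 2)%:E < +oo)%E.
Proof.
pose q : R := 2^-1 `^ (2 + 4 / 3 - beta).
have q0 : 0 <= q by exact: powR_ge0.
have q1 : q < 1.
  have -> : 1 = 1 `^ (2 + 4 / 3 - beta) :> R by rewrite powR1.
  apply: gt0_ltr_powR.
  - by rewrite subr_gt0.
  - by rewrite nnegrE invr_ge0.
  - by rewrite nnegrE.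
  - by rewrite invf_lt1// ltr1n.
pose A := annulus_bound 0 * (level 0 *+ 2) ^+ 2.
have A0 : 0 <= A by rewrite mulr_ge0 ?annulus_bound_ge0// sqr_ge0.
apply: (@le_lt_trans _ _ (A * (1 - q)^-1)%:E); last exact: ltry.
apply: lime_le.
  apply: is_cvg_nneseries => k _ _.
  by rewrite lee_fin mulr_ge0 ?annulus_bound_ge0// sqr_ge0.
apply: nearW => n; rewrite sumEFin lee_fin.
under eq_bigr do rewrite annulus_term.
by rewrite -mulr_sumr; apply: ler_wpM2l => //; exact: geometric_sum_le.
Qed.

(** The first level below the sup norm of [h] is [k.+1]. *)
Lemma dyadic_level (h : P) : box e0 h -> h != 0 ->
  exists2 k, box (level k) h & level k.+1 < enorm h.
Proof.
move=> hb h0.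
pose M := Num.max `|h.1| `|h.2|.
have M0 : 0 < M.
  rewrite lt_max !normr_gt0 -negb_and; apply: contra h0 => /andP[/eqP h1 /eqP h2].
  by apply/eqP; rewrite [h]surjective_pairing h1 h2.
have Mle : M <= enorm h by rewrite ge_max enorm_ge1 enorm_ge2.
have boxM r : box r h <-> M <= r.
  rewrite ge_max; split=> [[]|/andP[h1 h2]] /=.
    by rewrite !in_itv/= -!ler_norml => -> ->.
  by split; rewrite /= in_itv/= -ler_norml.
have ex : exists n, level n < M.
  have := @cvg_geometric R e0 2^-1; rewrite ger0_norm ?invr_ge0// invf_lt1// ltr1n => /(_ isT).
  move=> /cvgrPdist_lt /(_ M M0) [n _ /(_ n (leqnn n))].
  rewrite /= sub0r normrN ger0_norm; first by exists n.
  by rewrite mulr_ge0 ?ltW// exprn_gt0// invr_gt0.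
case: (ex_minnP ex) => -[|n] nM min.
  by move/boxM : hb; rewrite leNgt -[e0]mulr1 -(expr0 2^-1) nM.
exists n; last exact: lt_le_trans Mle.
by apply/boxM; rewrite leNgt; apply/negP => /min; rewrite ltnn.
Qed.

End dyadic.

(** * The two estimates *)

Section transfer.
Context (R : realType).
Local Notation P := (plane R).

Lemma ae_translate (Q : P -> Prop) (z : P) : {ae area2 R, forall x, Q x} ->
  {ae area2 R, forall y, Q (z + y)}.
Proof.
move=> [N [mN N0 QN]]; exists ((fun y => y + z) @^-1` N); split.
- by rewrite -[X in measurable X]setTI; exact: measurable_shift.
- by rewrite area2_shift.
- by move=> y nQ; apply: QN => /=; rewrite addrC.
Qed.

Lemma frob4 (A B : 'M[R]_2) : frob (A - B) ^+ 4 =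
  sqnorm4 (A 0 0 - B 0 0) (A 0 1 - B 0 1) (A 1 0 - B 1 0) (A 1 1 - B 1 1) ^+ 2.
Proof.
rewrite (_ : 4 = 2 * 2)%N// exprM /frob sqr_sqrtr.
  have e1 : lift ord0 ord0 = 1 :> 'I_2 by exact: val_inj.
  by rewrite !big_ord_recl !big_ord0 e1 !mxE /sqnorm4 !addr0 !addrA.
by apply: sumr_ge0 => i _; apply: sumr_ge0 => j _; exact: sqr_ge0.
Qed.

Lemma measurable_sqincr (g : 'I_2 -> 'I_2 -> P -> R) : (forall k j, measurable_fun setT (g k j)) ->
  measurable_fun setT (fun w : P * P => sqincr g w.2 w.1 ^+ 2).
Proof.
move=> mg; apply: measurable_funX; rewrite /sqincr /sqdiff /sqnorm4.
have H k j : measurable_fun setT (fun w : P * P => (g k j (w.1 + w.2) - g k j w.1) ^+ 2).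
  apply: measurable_funX; apply: measurable_funB.
    by apply: (measurableT_comp (mg k j)); exact: measurable_plane_add.
  by apply: (measurableT_comp (mg k j)); exact: measurable_fst.
by repeat apply: measurable_funD; exact: H.
Qed.

Section representatives.
Variables (Omega good : set P) (G g : 'I_2 -> 'I_2 -> P -> R).
Hypothesis mG : forall k j, measurable_fun setT (G k j).
Hypothesis mg : forall k j, measurable_fun setT (g k j).
Hypothesis ae_good : {ae area2 R, forall z, Omega z -> good z}.
Hypothesis gG : forall k j z, good z -> g k j z = G k j z.

(** For a good [z], the points [y] for which [z + y] is not good form a translate of a null
    set, so that the inner integrals agree; only then are the two integrals exchanged. *)
Lemma integral_representative (W : P * P -> R) : measurable_fun setT W -> (forall w, 0 <= W w) ->
  (forall z y, W (z, y) != 0 -> Omega z /\ Omega (z + y)) ->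
  (\int[area2 R]_z \int[area2 R]_y (W (z, y) * sqincr G y z ^+ 2)%:E =
   \int[area2 R]_y \int[area2 R]_z (W (z, y) * sqincr g y z ^+ 2)%:E)%E.
Proof.
move=> mW W0 WO.
have mPhi h : (forall k j, measurable_fun setT (h k j)) ->
    measurable_fun setT (fun w : P * P => (W w * sqincr h w.2 w.1 ^+ 2)%:E).
  move=> mh; apply/measurable_EFinP; apply: measurable_funM => //; exact: measurable_sqincr.
have Phi0 h (w : P * P) : (0 <= (W w * sqincr h w.2 w.1 ^+ 2)%:E)%E.
  by rewrite lee_fin mulr_ge0// sqr_ge0.
have meas1 h z : (forall k j, measurable_fun setT (h k j)) ->
    measurable_fun setT (fun y => (W (z, y) * sqincr h y z ^+ 2)%:E).
  by move=> mh; apply: (measurableT_comp (mPhi h mh)); exact: measurable_fun_pair.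
rewrite -[RHS](fubini_tonelli (m1 := area2 R) (m2 := area2 R) _ (mPhi g mg) (Phi0 g)).
apply: ge0_ae_eq_integral.
- exact: measurableT.
- exact: (measurable_fun_fubini_tonelli_F (m2 := area2 R) _ (mPhi G mG) (Phi0 G)).
- exact: (measurable_fun_fubini_tonelli_F (m2 := area2 R) _ (mPhi g mg) (Phi0 g)).
- by move=> z _; apply: integral_ge0 => y _; exact: (Phi0 G (z, y)).
- by move=> z _; apply: integral_ge0 => y _; exact: (Phi0 g (z, y)).
apply: filterS ae_good => z gz _.
apply: ge0_ae_eq_integral.
- exact: measurableT.
- exact: meas1.
- exact: meas1.
- by move=> y _; exact: (Phi0 G (z, y)).
- by move=> y _; exact: (Phi0 g (z, y)).
have [N [mN N0 QN]] := ae_translate z ae_good.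
exists N; split=> // y nE; apply: QN => gzy; apply: nE => _ /=.
have [->|W1] := eqVneq (W (z, y)) 0; first by rewrite !mul0r.
have [Oz Ozy] := WO z y W1.
have gz' := gz Oz; have gzy' := gzy Ozy.
by rewrite /sqincr /sqdiff !gG.
Qed.

End representatives.

End transfer.

Section conclusion.
Context (R : realType).
Local Notation P := (plane R).
Variables (Omega : set P) (v : P -> R[i]) (Dv : P -> 'M[R]_2).
Hypothesis Omega_open : open Omega.
Hypothesis Omega_bounded : bounded_set Omega.
Hypothesis vW : W1oo Omega v Dv.
Hypothesis beltrami : {ae area R, forall z, Omega z ->
     d_zbar (Dv z) = 4 / 3 * d_z (Dv z) ^+ 3 /\ `|d_z (Dv z)| = 2^-1}.

Let G := grad0 Omega Dv.
Let g := belt_grad Omega Dv.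
Let bg k j : bddm (g k j). Proof. exact: bddm_belt_grad vW k j. Qed.
Let mG k j : measurable_fun setT (G k j). Proof. exact: measurable_grad0 vW k j. Qed.
Let mg k j : measurable_fun setT (g k j). Proof. by case: (bg k j). Qed.

Variable A : set P.
Hypothesis mA : measurable A.
Hypothesis AO : compactly_inside A Omega.

Let inside z : A z -> Omega z.
Proof. by move=> Az; apply: (proj2 AO); exact: subset_closure. Qed.

Lemma subset_box : exists2 K, 0 < K & A `<=` box K.
Proof.
have [K [_ HK]] := Omega_bounded.
exists (Num.max K 0 + 1); first by rewrite ltr_pwDr// le_max lexx orbT.
move=> z Az; have : `|z| <= Num.max K 0 + 1.
  by apply: HK; [rewrite ltr_pwDr// le_max lexx|exact: inside].
rewrite prod_normE ge_max => /andP[z1 z2].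
by split; rewrite /= in_itv/= -ler_norml.
Qed.

Lemma A_lty : (area2 R A < +oo)%E.
Proof.
have [K K0 AK] := subset_box.
by apply: le_lt_trans (box_lty K); apply: le_measure; rewrite ?inE//; exact: measurable_box.
Qed.

Let tA : tame (area2 R) (\1_A : P -> R).
Proof. by apply: tame_indic => //; exact: A_lty. Qed.

(** The integral of |Dw|^4 over [A], for the translation by [y]. *)
Let m (y : P) : R := \int[area2 R]_x (\1_A x * sqincr g y x ^+ 2).

Let tm y : tame (area2 R) (fun x => \1_A x * sqincr g y x ^+ 2).
Proof. by apply: tameMl => //; exact: bddm_sqincr2. Qed.

Let Sg_le (y x : P) : sqincr g y x ^+ 2 <= 256.
Proof.
have H k j : (g k j (x + y) - g k j x) ^+ 2 <= 4.
  have g1 z : `|g k j z| <= 1.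
    have [h00 h01 h10 h11] := belt_bound (belt_grad_belt Omega Dv z).
    have H (i : 'I_2) : i = 0 \/ i = 1.
      by case: i => -[|[|//]] ?; [left|right]; exact: val_inj.
    by rewrite /g; case: (H k) => ->; case: (H j) => ->.
  rewrite -real_normK ?num_real// (_ : 4 = 2 ^+ 2); last by ring.
  by rewrite ler_pXn2r ?nnegrE// (le_trans (ler_normB _ _))// (_ : 2 = 1 + 1)// lerD.
rewrite (_ : 256 = 16 ^+ 2); last by ring.
rewrite ler_pXn2r ?nnegrE//; last by rewrite /sqincr /sqdiff /sqnorm4 !addr_ge0 ?sqr_ge0.
by rewrite /sqincr /sqdiff /sqnorm4; have := H 0 0; have := H 0 1; have := H 1 0; have := H 1 1; lra.
Qed.

Let m_bounded : exists2 M, 0 <= M & forall y, m y <= M.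
Proof.
exists (256 * fine (area2 R A)).
  by apply: mulr_ge0; [exact: ler0n|apply: fine_ge0; exact: measure_ge0].
move=> y; rewrite -(@Rint_indic _ _ _ (area2 R) A mA) -(RintZ _ tA).
apply: le_Rint => //; first by apply: tameMr => //; exact: bddm_cst.
by move=> x; rewrite mulrC ler_wpM2r.
Qed.

Let m_ge0 y : 0 <= m y.
Proof. by apply: ge0_Rint => x; rewrite mulr_ge0 ?sqr_ge0. Qed.

Lemma small_translation : exists e0 C : R, [/\ 0 < e0, 0 <= C & forall y : P,
  `|y.1| <= e0 -> `|y.2| <= e0 -> m y <= C * (`|y.1| + `|y.2|) `^ (4 / 3)].
Proof.
have [f [bf wf]] := weak_gradient vW beltrami.
exact: (compact_estimate Omega_open bf bg (belt_grad_belt Omega Dv) wf mA AO).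
Qed.

Lemma Rint_box r : 0 <= r -> \int[area2 R]_x (\1_(box r) x) = (r *+ 2) ^+ 2 :> R.
Proof.
move=> r0; rewrite Rint_indic; last exact: measurable_box.
exact: (congr1 fine (area2_box r0)).
Qed.

Lemma measurable_disk (eps : R) : measurable (edisk eps : set P).
Proof.
rewrite -[X in measurable X]setTI.
rewrite (_ : edisk eps = (@enorm R) @^-1` `]-oo, eps[%classic); first exact: measurable_enorm.
by apply/seteqP; split => x /=; rewrite /edisk /= in_itv.
Qed.

Lemma double_integral_le (eps k B : R) : 0 <= k -> 0 <= B -> 0 < eps ->
  (forall z y, A z -> enorm y < eps -> Omega (z + y)) ->
  (forall y : P, `|y.1| <= eps -> `|y.2| <= eps -> m y <= B) ->
  (\int[area R]_(z in A) \int[area R]_(y in edisk eps)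
     (frob (Dv (z + y) - Dv z) ^+ 4 / k)%:E <= (k^-1 * B * (eps *+ 2) ^+ 2)%:E)%E.
Proof.
move=> k0 B0 e0 inO mB.
pose W (w : P * P) : R := k^-1 * (\1_A w.1 * \1_(edisk eps) w.2).
have mW : measurable_fun setT W.
  apply: measurable_funM => //; apply: measurable_funM.
    by apply: (measurableT_comp (measurable_indic mA)); exact: measurable_fst.
  by apply: (measurableT_comp (measurable_indic (measurable_disk eps))); exact: measurable_snd.
have W0 w : 0 <= W w by rewrite mulr_ge0 ?invr_ge0.
have WO z y : W (z, y) != 0 -> Omega z /\ Omega (z + y).
  rewrite /W /= !indicE; have [/set_mem Az|_] := boolP (z \in A); last by rewrite !(mul0r,mulr0) eqxx.
  have [/set_mem yd|_] := boolP (y \in edisk eps); last by rewrite !mulr0 eqxx.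
  by split; [exact: inside|exact: inO].
have E : (\int[area R]_(z in A) \int[area R]_(y in edisk eps)
     (frob (Dv (z + y) - Dv z) ^+ 4 / k)%:E =
     \int[area2 R]_z \int[area2 R]_y (W (z, y) * sqincr G y z ^+ 2)%:E)%E.
  rewrite integral_mkcond; apply: eq_integral => z _.
  rewrite patchE; case: ifPn => [/set_mem Az|zA]; last first.
    rewrite -[LHS](@integral0 _ _ _ (area2 R) setT); apply: eq_integral => y _.
    by rewrite /W /= !indicE (negbTE zA) !(mul0r,mulr0).
  rewrite integral_mkcond; apply: eq_integral => y _.
  rewrite patchE; case: ifPn => [/set_mem yd|yd]; last first.
    by rewrite /W /= !indicE (negbTE yd) !(mul0r,mulr0).
  have Oz := inside Az; have Ozy := inO z y Az yd.
  by rewrite /W /= !indicE !mem_set// !mulr1 frob4 mulrC /sqincr /sqdiff /G !grad0_in.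
rewrite E (integral_representative mG mg (ae_good beltrami) (@belt_grad_good _ _ _) mW W0 WO).
apply: (@le_trans _ _ (\int[area2 R]_y (k^-1 * B * \1_(box eps) y)%:E)%E); last first.
  have tb : tame (area2 R) (fun y : P => k^-1 * B * \1_(box eps) y).
    by apply: tameMr; [exact: bddm_cst|exact: tame_box].
  rewrite -(EFin_Rint tb) (RintZ _ (tame_box eps)) Rint_box; last exact: ltW.
  exact: lexx.
apply: ge0_le_integral; first exact: measurableT.
- by move=> y _; apply: integral_ge0 => x _; rewrite lee_fin mulr_ge0 ?sqr_ge0.
- have mP : measurable_fun setT (fun w : P * P => (W w * sqincr g w.2 w.1 ^+ 2)%:E).
    by apply/measurable_EFinP; apply: measurable_funM; [exact: mW|exact: measurable_sqincr mg].
  apply: (measurable_fun_fubini_tonelli_G (m1 := area2 R) _ mP) => w.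
  by rewrite lee_fin mulr_ge0 ?sqr_ge0.
- apply/measurable_EFinP; apply: measurable_funM; first exact: measurable_cst.
  exact: measurable_indic_box.
move=> y _; rewrite (_ : (\int[_]_z _)%E = (k^-1 * \1_(edisk eps) y * m y)%:E); last first.
  transitivity (\int[area2 R]_z
      ((k^-1 * \1_(edisk eps) y) * (\1_A z * sqincr g y z ^+ 2))%:E)%E.
    by apply: eq_integral => z _; congr EFin; rewrite /W /=; ring.
  rewrite -(EFin_Rint (tameMr (bddm_cst _ _) (tm y))).
  by rewrite (RintZ _ (tm y)).
rewrite lee_fin -mulrA -[leRHS]mulrA; apply: ler_wpM2l; first by rewrite invr_ge0.
rewrite indicE; have [/set_mem yd|_] := boolP (y \in edisk eps); last first.
  by rewrite mul0r mulr_ge0.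
have y1 : `|y.1| <= eps by apply: le_trans (enorm_ge1 y) (ltW yd).
have y2 : `|y.2| <= eps by apply: le_trans (enorm_ge2 y) (ltW yd).
rewrite mul1r indicE mem_set ?mulr1; first exact: mB.
by split; rewrite /= in_itv/= -ler_norml.
Qed.

(** Up to [e0] the translation estimate applies; from [e0] on, the boundedness of the
    gradient suffices, the denominator being bounded below. *)
Lemma besov_estimate : exists C : R, forall eps : R, 0 < eps ->
  (eps%:E < (2^-1)%:E * edist_set A (boundary Omega))%E ->
  (\int[area R]_(z in A) \int[area R]_(y in edisk eps)
     (frob (Dv (z + y) - Dv z) ^+ 4 / eps `^ (2 + 4 / 3))%:E < C%:E)%E.
Proof.
have [e0 [C [e00 C0 HC]]] := small_translation.
have [M M0 HM] := m_bounded.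
(* [C1] serves for [eps <= e0] and [C2] for [e0 < eps]; the summand 1 makes the bound
   strict. *)
pose C1 := 4 * (C * 2 `^ (4 / 3)).
pose C2 := 4 * M * (e0 `^ (4 / 3))^-1.
have C10 : 0 <= C1 by rewrite !mulr_ge0// powR_ge0.
have C20 : 0 <= C2.
  by apply: mulr_ge0; [rewrite !mulr_ge0|rewrite invr_ge0 powR_ge0].
exists (C1 + C2 + 1) => eps ep dist.
have inO z y : A z -> enorm y < eps -> Omega (z + y).
  by move=> Az ye; exact: (translate_inside Omega_open Az (inside Az) ye dist).
have kE : eps `^ (2 + 4 / 3) = eps ^+ 2 * eps `^ (4 / 3).
  by rewrite powRD ?(gt_eqF ep) ?implybT// powR_mulrn ?ltW.
have k0 : 0 <= eps `^ (2 + 4 / 3) by exact: powR_ge0.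
have p0 : 0 < eps `^ (4 / 3) by exact: powR_gt0.
have [ee|ee] := leP eps e0.
  have mB (y : P) : `|y.1| <= eps -> `|y.2| <= eps -> m y <= C * (2 * eps) `^ (4 / 3).
    move=> y1 y2; apply: le_trans (HC y (le_trans y1 ee) (le_trans y2 ee)) _.
    have e2 : 0 <= 2 * eps by rewrite mulr_ge0// ltW.
    have yy : `|y.1| + `|y.2| <= 2 * eps by rewrite mulr_natl mulr2n lerD.
    by apply: ler_wpM2l => //; apply: ge0_ler_powR; rewrite ?nnegrE ?addr_ge0.
  apply: le_lt_trans (double_integral_le k0 _ ep inO mB) _.
    by rewrite mulr_ge0// powR_ge0.
  rewrite lte_fin kE powRM ?ltW//.
  have -> : (eps ^+ 2 * eps `^ (4 / 3))^-1 * (C * (2 `^ (4 / 3) * eps `^ (4 / 3))) *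
    (eps *+ 2) ^+ 2 = C1.
    by rewrite /C1; field; rewrite !gt_eqF.
  lra.
have mB (y : P) : `|y.1| <= eps -> `|y.2| <= eps -> m y <= M by move=> _ _; exact: HM.
apply: le_lt_trans (double_integral_le k0 M0 ep inO mB) _.
rewrite lte_fin kE.
have -> : (eps ^+ 2 * eps `^ (4 / 3))^-1 * M * (eps *+ 2) ^+ 2 =
  4 * M * (eps `^ (4 / 3))^-1 by field; rewrite !gt_eqF.
have : 4 * M * (eps `^ (4 / 3))^-1 <= C2.
  apply: ler_wpM2l; first by rewrite !mulr_ge0.
  rewrite lef_pV2 ?posrE ?powR_gt0//.
  by apply: ge0_ler_powR; rewrite ?nnegrE ?ltW.
lra.
Qed.

(** As [m], over the points of [A] whose translate stays in [A]. *)
Let mAA (h : P) : R := \int[area2 R]_x (\1_A x * \1_A (x + h) * sqincr g h x ^+ 2).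

Let tmAA h : tame (area2 R) (fun x : P => \1_A x * \1_A (x + h) * sqincr g h x ^+ 2).
Proof.
apply: tameMl; last exact: bddm_sqincr2.
apply: tameMl => //; apply: (bddm_shift h); exact: tame_bddm tA.
Qed.

Let mAA_ge0 h : 0 <= mAA h.
Proof. by apply: ge0_Rint => x; apply: mulr_ge0; [exact: mulr_ge0|exact: sqr_ge0]. Qed.

Let mAA_le h : mAA h <= m h.
Proof.
apply: le_Rint => // x; rewrite ler_wpM2r ?sqr_ge0// ler_piMr//.
Qed.

(** Inside [box e0] the point [h] lies in one of the dyadic annuli. Outside, the weight is
    at most its value at [e0], and [mAA h] vanishes unless [h] is a difference of two
    points of [A], hence in [box (2 * K)]. *)
Lemma weight_bound (e0 C K M beta : R) (h : P) : 0 < e0 -> 0 <= C -> 0 <= M -> 0 < K -> 0 < beta ->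
  A `<=` box K -> (forall y, m y <= M) ->
  (forall y : P, `|y.1| <= e0 -> `|y.2| <= e0 -> m y <= C * (`|y.1| + `|y.2|) `^ (4 / 3)) ->
  ((enorm h `^ (- beta) * mAA h)%:E <=
    \sum_(0 <= k <oo) (annulus_bound e0 C beta k * \1_(box (level e0 k)) h)%:E +
    (e0 `^ (- beta) * M * \1_(box (2 * K)) h)%:E)%E.
Proof.
move=> e00 C0 M0 K0 b0 AK HM HC.
have T0 k : (0 <= (annulus_bound e0 C beta k * \1_(box (level e0 k)) h)%:E)%E.
  by rewrite lee_fin mulr_ge0 ?annulus_bound_ge0.
have S0 : (0 <= \sum_(0 <= k <oo) (annulus_bound e0 C beta k * \1_(box (level e0 k)) h)%:E)%E.
  by apply: nneseries_ge0 => k _ _.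
have D0 : 0 <= e0 `^ (- beta) * M by apply: mulr_ge0 => //; exact: powR_ge0.
have D0' : (0 <= (e0 `^ (- beta) * M * \1_(box (2 * K)) h)%:E)%E.
  by rewrite lee_fin mulr_ge0.
have pow_le (s t : R) : 0 < s -> s <= t -> t `^ (- beta) <= s `^ (- beta).
  move=> s0 st; rewrite !powRN lef_pV2 ?posrE ?powR_gt0//; last exact: lt_le_trans st.
  apply: ge0_ler_powR => //; rewrite ?nnegrE ?ltW//; exact: lt_le_trans st.
have [hE|h0] := eqVneq h 0.
  have -> : enorm h = 0 by rewrite hE enorm0.
  by rewrite powR0 ?oppr_eq0 ?gt_eqF// mul0r; exact: adde_ge0.
have [hb|hb] := pselect (box e0 h).
  have [k hk khn] := dyadic_level e00 hb h0.
  apply: (@le_trans _ _ (annulus_bound e0 C beta k * \1_(box (level e0 k)) h)%:E).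
    rewrite indicE mem_set// mulr1 lee_fin /annulus_bound mulrC.
    apply: ler_pM => //; first exact: powR_ge0.
      case: hb => /=; rewrite !in_itv/= -!ler_norml => h1 h2.
      apply: le_trans (mAA_le h) _; apply: le_trans (HC h h1 h2) _.
      case: hk => /=; rewrite !in_itv/= -!ler_norml => k1 k2.
      have l0 := level_gt0 e00 k.
      have l20 : 0 <= 2 * level e0 k by rewrite mulr_ge0// ltW.
      have hl : `|h.1| + `|h.2| <= 2 * level e0 k by rewrite mulr_natl mulr2n lerD.
      by apply: ler_wpM2l => //; apply: ge0_ler_powR; rewrite ?nnegrE ?addr_ge0.
    by apply: pow_le; [exact: level_gt0|exact: ltW].
  apply: (@le_trans _ _ (\sum_(0 <= j <oo) (annulus_bound e0 C beta j * \1_(box (level e0 j)) h)%:E)%E).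
    apply: le_trans (nneseries_lim_ge k.+1 (fun j _ _ => T0 j)).
    by rewrite big_nat_recr//= leeDr// sume_ge0.
  by rewrite leeDl.
apply: (@le_trans _ _ (e0 `^ (- beta) * M * \1_(box (2 * K)) h)%:E); last by rewrite leeDr.
rewrite lee_fin; have [h2|h2] := pselect (box (2 * K) h).
  rewrite [in leRHS]indicE mem_set// mulr1; apply: ler_pM => //; first exact: powR_ge0.
    apply: pow_le => //; rewrite leNgt; apply/negP => he; apply: hb.
    by split; rewrite /= in_itv/= -ler_norml; apply: le_trans (ltW he);
      [exact: enorm_ge1|exact: enorm_ge2].
  exact: le_trans (mAA_le h) (HM h).
rewrite (_ : mAA h = 0) ?mulr0; first exact: mulr_ge0.
rewrite -[RHS](_ : \int[area2 R]_x (0 : R) = 0); last by rewrite /Rintegral integral0.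
apply: eq_Rint => x; rewrite !indicE.
have [/set_mem Ax|_] := boolP (x \in A); last by rewrite !mul0r.
have [/set_mem Axh|_] := boolP (x + h \in A); last by rewrite mulr0 mul0r.
exfalso; apply: h2; have [/= x1 x2] := AK _ Ax; have [/= xh1 xh2] := AK _ Axh.
move: x1 x2 xh1 xh2; rewrite !in_itv/= -!ler_norml => x1 x2 xh1 xh2.
split; rewrite /= in_itv/= -ler_norml.
  have := ler_normB (x.1 + h.1) x.1; rewrite addrAC subrr add0r => hh.
  by apply: le_trans hh _; rewrite mulr_natl mulr2n lerD.
have := ler_normB (x.2 + h.2) x.2; rewrite addrAC subrr add0r => hh.
by apply: le_trans hh _; rewrite mulr_natl mulr2n lerD.
Qed.

Lemma weighted_integral_lty beta : 0 < beta -> beta < 2 + 4 / 3 ->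
  (\int[area2 R]_h (enorm h `^ (- beta) * mAA h)%:E < +oo)%E.
Proof.
move=> b0 b1; have [e0 [C [e00 C0 HC]]] := small_translation.
have [K K0 AK] := subset_box; have [M M0 HM] := m_bounded.
pose t k (h : P) : \bar R := (annulus_bound e0 C beta k * \1_(box (level e0 k)) h)%:E.
pose D : R := e0 `^ (- beta) * M.
have D0 : 0 <= D by apply: mulr_ge0; [exact: powR_ge0|exact: M0].
have tk k : tame (area2 R) (fun h : P => annulus_bound e0 C beta k * \1_(box (level e0 k)) h).
  by apply: tameMr; [exact: bddm_cst|exact: tame_box].
have tD : tame (area2 R) (fun h : P => D * \1_(box (2 * K)) h).
  by apply: tameMr; [exact: bddm_cst|exact: tame_box].
have mt k : measurable_fun setT (t k) by apply/measurable_EFinP; case: (tk k).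
have mD : measurable_fun setT (fun h : P => (D * \1_(box (2 * K)) h)%:E).
  by apply/measurable_EFinP; case: tD.
have t0 k h : (0 <= t k h)%E.
  by rewrite lee_fin; apply: mulr_ge0 => //; exact: annulus_bound_ge0.
have D0' (h : P) : (0 <= (D * \1_(box (2 * K)) h)%:E)%E.
  by rewrite lee_fin; exact: mulr_ge0.
have mS : measurable_fun setT (fun h => (\sum_(0 <= k <oo) t k h)%E).
  by apply: ge0_emeasurable_sum => // k h _ _; exact: t0.
apply: (@le_lt_trans _ _ (\int[area2 R]_h (\sum_(0 <= k <oo) t k h +
    (D * \1_(box (2 * K)) h)%:E))%E).
  apply: ge0_le_integral.
  - exact: measurableT.
  - by move=> h _; rewrite lee_fin; apply: mulr_ge0 => //; exact: powR_ge0.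
  - apply/measurable_EFinP; apply: measurable_funM.
      by apply: (measurableT_comp (measurable_powR (- beta))); exact: measurable_enorm.
    have mK : measurable_fun setT (fun w : P * P => (\1_A w.1 * \1_A (w.1 + w.2) * sqincr g w.2 w.1 ^+ 2)).
      apply: measurable_funM; last exact: measurable_sqincr mg.
      apply: measurable_funM.
        by apply: (measurableT_comp (measurable_indic mA)); exact: measurable_fst.
      by apply: (measurableT_comp (measurable_indic mA)); exact: measurable_plane_add.
    have K0' (w : P * P) : (0 <= (\1_A w.1 * \1_A (w.1 + w.2) * sqincr g w.2 w.1 ^+ 2)%:E)%E.
      by rewrite lee_fin; apply: mulr_ge0; [exact: mulr_ge0|exact: sqr_ge0].
    have := measurable_fun_fubini_tonelli_G (m1 := area2 R) _ ((measurable_EFinP _ _).2 mK) K0'.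
    by move=> mG'; apply/measurable_EFinP; apply: eq_measurable_fun mG' => h _; rewrite /= EFin_Rint.
  - exact: emeasurable_funD.
  - by move=> h _; exact: weight_bound.
rewrite ge0_integralD//; last by move=> h _; exact: nneseries_ge0.
rewrite integral_nneseries//; apply: lte_add_pinfty; last first.
  by rewrite -(EFin_Rint tD) ltry.
rewrite (_ : (\sum_(0 <= k <oo) \int[_]_x t k x)%E =
    (\sum_(0 <= k <oo) (annulus_bound e0 C beta k * (level e0 k *+ 2) ^+ 2)%:E)%E).
  exact: annulus_series.
apply: eq_eseriesr => k _; rewrite /t -(EFin_Rint (tk k)) RintZ; last exact: tame_box.
by rewrite Rint_box// ltW// level_gt0.
Qed.

Lemma sobolev_L4 i j : Lp_on A 4%:E (fun z => Dv z i j).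
Proof.
have E : (fun z => Dv z i j) \_ A = (fun z => G i j z * \1_A z).
  apply/funext => z; rewrite patchE indicE; have [/set_mem Az|_] := boolP (z \in A).
    by rewrite mulr1 /G grad0_in//; exact: inside.
  by rewrite mulr0.
have mf : measurable_fun setT (fun z => G i j z * \1_A z).
  by apply: measurable_funM; [exact: mG|exact: measurable_indic].
rewrite /Lp_on E; apply/andP; split; first by rewrite inE.
rewrite inE /= /finite_norm unlock /=; apply: poweR_lty.
have tg : tame (area2 R) (fun z => g i j z * \1_A z) by apply: tameMr.
have tg4 : tame (area2 R) (fun z => `|g i j z * \1_A z| `^ 4).
  rewrite (_ : (fun z => _) = (fun z => `|g i j z * \1_A z| * `|g i j z * \1_A z| ^+ 3)).
    by apply: tameMl; [exact: tame_norm|apply: bddmX; exact: tame_bddm (tame_norm tg)].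
  by apply/funext => z; rewrite powR_mulrn// -exprS.
apply: (@le_lt_trans _ _ (\int[area2 R]_z (`|g i j z * \1_A z| `^ 4)%:E)%E); last first.
  by rewrite -(EFin_Rint tg4) ltry.
rewrite le_eqVlt; apply/orP; left; apply/eqP.
apply: ge0_ae_eq_integral.
- exact: measurableT.
- apply/measurable_EFinP; apply: (measurableT_comp (measurable_powR 4)).
  exact: measurableT_comp mf.
- by apply/measurable_EFinP; case: tg4.
- by move=> z _; rewrite lee_fin powR_ge0.
- by move=> z _; rewrite lee_fin powR_ge0.
apply: filterS (ae_good beltrami) => z gz _ /=; congr EFin.
rewrite !indicE; have [/set_mem Az|_] := boolP (z \in A); last by rewrite !mulr0.
by rewrite !mulr1 /g belt_grad_good//; apply: gz; exact: inside.
Qed.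

(** The substitution y = x + h turns the Gagliardo integral into the integral of
    [enorm h `^ (- beta) * mAA h] with [beta = 2 + 4 * s], and s < 1/3 means
    beta < 2 + 4/3. *)
Lemma sobolev_estimate (s : R) : 0 < s -> s < 3^-1 -> Ws4 s A Dv.
Proof.
move=> s0 s1; split; first exact: sobolev_L4.
pose beta := 2 + 4 * s.
have b0 : 0 < beta by rewrite /beta; lra.
have b1 : beta < 2 + 4 / 3 by rewrite /beta; lra.
pose W (w : P * P) : R := \1_A w.1 * \1_A (w.1 + w.2) * enorm w.2 `^ (- beta).
have mW : measurable_fun setT W.
  apply: measurable_funM; first apply: measurable_funM.
  - by apply: (measurableT_comp (measurable_indic mA)); exact: measurable_fst.
  - by apply: (measurableT_comp (measurable_indic mA)); exact: measurable_plane_add.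
  - apply: (measurableT_comp (measurable_powR (- beta))).
    by apply: (measurableT_comp (@measurable_enorm R)); exact: measurable_snd.
have W0 w : 0 <= W w by apply: mulr_ge0; [exact: mulr_ge0|exact: powR_ge0].
have WO z y : W (z, y) != 0 -> Omega z /\ Omega (z + y).
  rewrite /W /= !indicE; have [/set_mem Az|_] := boolP (z \in A); last by rewrite !mul0r eqxx.
  have [/set_mem Azy|_] := boolP (z + y \in A); last by rewrite mulr0 mul0r eqxx.
  by split; exact: inside.
have E : (\int[area R]_(x in A) \int[area R]_(y in A)
     (frob (Dv x - Dv y) ^+ 4 / enorm (x - y) `^ beta)%:E =
     \int[area2 R]_x \int[area2 R]_y (W (x, y) * sqincr G y x ^+ 2)%:E)%E.
  rewrite integral_mkcond; apply: eq_integral => x _.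
  rewrite patchE; case: ifPn => [/set_mem Ax|xA]; last first.
    rewrite -[LHS](@integral0 _ _ _ (area2 R) setT); apply: eq_integral => y _.
    by rewrite /W /= !indicE (negbTE xA) !mul0r.
  rewrite integral_mkcond.
  pose F (y : P) : \bar R := (W (x, y - x) * sqincr G (y - x) x ^+ 2)%:E.
  have mF : measurable_fun setT F.
    have mK : measurable_fun setT (fun w : P * P => (W w * sqincr G w.2 w.1 ^+ 2)%:E).
      by apply/measurable_EFinP; apply: measurable_funM; [exact: mW|exact: measurable_sqincr mG].
    have ms : measurable_fun setT (fun y : P => (x, y - x) : P * P).
      by apply: measurable_fun_pair; [exact: measurable_cst|exact: measurable_shift].
    exact: measurableT_comp mK ms.
  have F0 y : (0 <= F y)%E by rewrite lee_fin; apply: mulr_ge0; [exact: W0|exact: sqr_ge0].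
  transitivity (\int[area2 R]_y F y)%E; last first.
    rewrite -(ge0_integral_shift x mF F0); apply: eq_integral => y _.
    by rewrite /F addrK.
  apply: eq_integral => y _; rewrite patchE /F /W /=.
  have xy : x + (y - x) = y by rewrite addrCA subrr addr0.
  case: ifPn => [/set_mem Ay|yA]; last first.
    by rewrite xy [\1_A y]indicE (negbTE yA) mulr0 !mul0r.
  have Ox := inside Ax; have Oy := inside Ay.
  rewrite /sqincr /sqdiff xy !indicE !mem_set// !mul1r frob4 /G !grad0_in// powRN mulrC.
  congr (_%:E); congr (_ * _); first by rewrite -enormN opprB.
  by rewrite /sqnorm4; ring.
rewrite -/beta E (integral_representative mG mg (ae_good beltrami) (@belt_grad_good _ _ _) mW W0 WO).
apply: le_lt_trans (weighted_integral_lty b0 b1).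
rewrite le_eqVlt; apply/orP; left; apply/eqP; apply: eq_integral => h _.
transitivity (\int[area2 R]_z
    (enorm h `^ (- beta) * (\1_A z * \1_A (z + h) * sqincr g h z ^+ 2))%:E)%E.
  by apply: eq_integral => z _; congr EFin; rewrite /W /=; ring.
rewrite -(EFin_Rint (tameMr (bddm_cst _ _) (tmAA h))).
by rewrite (RintZ _ (tmAA h)).
Qed.

End conclusion.

Theorem theorem4 (R : realType) (Omega : set (plane R))
  (v : plane R -> R[i]) (Dv : plane R -> 'M[R]_2)
  (Omega_open : open Omega) (Omega_connected : connected Omega)
  (Omega_bounded : bounded_set Omega)
  (Omega_simply_connected : simply_connected Omega)
  (Omega0 : Omega (0 : plane R))
  (vW : W1oo Omega v Dv) (v0 : value_at Omega v (0 : plane R) 0)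
  (beltrami : {ae area R, forall z, Omega z ->
     d_zbar (Dv z) = 4 / 3 * d_z (Dv z) ^+ 3 /\ `|d_z (Dv z)| = 2^-1}) :
  (forall sigma : R, 0 < sigma -> sigma < 3^-1 -> Ws4_loc sigma Omega Dv) /\
  (forall Omega' : set (plane R),
     measurable Omega' -> compactly_inside Omega' Omega ->
     exists C : R, forall eps : R, 0 < eps ->
       (eps%:E < (2^-1)%:E * edist_set Omega' (boundary Omega))%E ->
       (\int[area R]_(z in Omega') \int[area R]_(y in edisk eps)
          (frob (Dv (z + y) - Dv z) ^+ 4 / eps `^ (2 + 4 / 3))%:E < C%:E)%E).
Proof.
split=> [sigma s0 s1 U mU UO|Omega' mO' O'O].
- exact: (sobolev_estimate Omega_open Omega_bounded vW beltrami mU UO s0 s1).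
- exact: (besov_estimate Omega_open Omega_bounded vW beltrami mO' O'O).
Qed.
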